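(* Let $\alpha\in\mathbb{C}\setminus\{0,-1\}$ and $\mathfrak{g}=D(2,1,\alpha)$. Every simple weight $\mathfrak{g}$-module $M$ is bounded and has degree less than or equal to $8$.
   Context: The ground field is $\mathbb{C}$. For $\alpha\in\mathbb{C}\setminus\{0,-1\}$, $\mathfrak{g}=\mathfrak{g}_{\bar 0}\oplus\mathfrak{g}_{\bar 1}=D(2,1,\alpha)$ is the contragredient Lie superalgebra $\mathfrak{g}(A)$ with Cartan matrix $$A=\begin{pmatrix}0&1&\alpha\\1&0&-\alpha-1\\ \alpha&-\alpha-1&0\end{pmatrix}$$ and three simple roots $\beta_1,\beta_2,\beta_3$, all odd: it is generated by odd $e_i,f_i$ and even $h_i$ ($i=1,2,3$), where the $h_i$ form a basis of the Cartan subalgebra $\mathfrak{h}$, with relations $[h_i,h_j]=0$, $[e_i,f_j]=\delta_{ij}h_i$, $[h_i,e_j]=a_{ij}e_j$, $[h_i,f_j]=-a_{ij}f_j$, modulo the maximal ideal intersecting $\mathfrak{h}$ trivially. Its even part is $\mathfrak{g}_{\bar 0}\cong\mathfrak{sl}_2\times\mathfrak{sl}_2\times\mathfrak{sl}_2$ and $\mathfrak{g}_{\bar 1}$ is the tensor product of the three standard representations. A weight module is a ($\mathbb{Z}/2\mathbb{Z}$-graded) module with $M=\bigoplus_{\mu\in\mathfrak{h}^*}M_\mu$, $M_\mu=\{m: h m=\mu(h)m\ \forall h\in\mathfrak{h}\}$; no finiteness of $\dim M_\mu$ is assumed, and $M$ is not assumed to be a highest weight module. It is bounded if there is a constant $c$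 with $\dim M_\mu<c$ for all $\mu\in\mathfrak{h}^*$; its degree is $\deg M=\max_{\mu}\dim M_\mu$. *)

(* Defs.v *)
From HB Require Import structures.
From mathcomp Require Import all_boot all_order all_algebra.
From mathcomp Require Import boolp classical_sets reals.
From mathcomp Require Import complex.

Set Implicit Arguments.
Unset Strict Implicit.
Unset Printing Implicit Defensive.
Import Order.TTheory GRing.Theory Num.Theory.
Local Open Scope classical_set_scope.
Local Open Scope ring_scope.

(* A Z/2-grading is a family P : bool -> set V, with P false the even part    *)
(* and P true the odd part.                                                   *)
Section Linear.
Variables (K : numFieldType) (V : lmodType K).
Implicit Types (S W : set V) (P : bool -> set V).

Definition subspace S : Prop :=
  S 0 /\ forall a u v, S u -> S v -> S (a *: u + v).

Record grading P : Prop := Grading {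
  grading_sub : forall b, subspace (P b);
  grading_sum : forall v, exists v0 v1, [/\ P false v0, P true v1 & v = v0 + v1];
  grading_dir : forall v, P false v -> P true v -> v = 0 }.

Definition graded P S : Prop :=
  forall v0 v1, P false v0 -> P true v1 -> S (v0 + v1) -> S v0 /\ S v1.

Definition lin_indep n (v : 'I_n -> V) : Prop :=
  forall c : 'I_n -> K, \sum_i c i *: v i = 0 -> forall i, c i = 0.

Definition has_dim W n : Prop :=
  exists v : 'I_n -> V, [/\ forall i, W (v i), lin_indep v &
    forall w, W w -> exists c : 'I_n -> K, w = \sum_i c i *: v i].

Lemma subspaceD S u v : subspace S -> S u -> S v -> S (u + v).
Proof. by case=> _ SL Su Sv; rewrite -[u]scale1r; apply: SL. Qed.

Lemma subspaceZ S a u : subspace S -> S u -> S (a *: u).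
Proof. by case=> S0 SL Su; rewrite -[_ *: _]addr0; apply: SL. Qed.

Lemma subspaceN S u : subspace S -> S u -> S (- u).
Proof. by rewrite -scaleN1r; apply: subspaceZ. Qed.

Lemma subspaceB S u v : subspace S -> S u -> S v -> S (u - v).
Proof. by move=> sS Su Sv; apply: subspaceD => //; apply: subspaceN. Qed.

Lemma grading_uniq P u0 u1 v0 v1 : grading P ->
  P false u0 -> P true u1 -> P false v0 -> P true v1 ->
  u0 + u1 = v0 + v1 -> u0 = v0 /\ u1 = v1.
Proof.
move=> gP u0P u1P v0P v1P E.
have D : u0 - v0 = v1 - u1.
  by apply/eqP; rewrite subr_eq addrAC eq_sym subr_eq [v1 + v0]addrC E.
have Z : u0 - v0 = 0.
  apply: (grading_dir gP); first exact: (subspaceB (grading_sub gP _)).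
  by rewrite D; exact: (subspaceB (grading_sub gP _)).
split; first exact: subr0_eq.
by apply/esym/subr0_eq; rewrite -D.
Qed.

End Linear.

Record lieSuperalgebra (K : numFieldType) := LieSuperalgebra {
  lie_sort :> lmodType K;
  lie_part : bool -> set lie_sort;
  bracket : lie_sort -> lie_sort -> lie_sort;
  lie_grading : grading lie_part;
  bracket_part : forall a b x y,
    lie_part a x -> lie_part b y -> lie_part (a (+) b) (bracket x y);
  bracketPl : forall c x y z,
    bracket (c *: x + y) z = c *: bracket x z + bracket y z;
  bracketPr : forall c x y z,
    bracket z (c *: x + y) = c *: bracket z x + bracket z y;
  bracketC : forall a b x y, lie_part a x -> lie_part b y ->
    bracket x y = - ((-1) ^+ (a && b) *: bracket y x);
  bracketJ : forall a b x y z, lie_part a x -> lie_part b y ->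
    bracket x (bracket y z) =
      bracket (bracket x y) z + (-1) ^+ (a && b) *: bracket y (bracket x z) }.

Arguments lie_part {K} _.
Arguments bracket {K _}.

Lemma bracketBl (K : numFieldType) (g : lieSuperalgebra K) (x y z : g) :
  bracket (x - y) z = bracket x z - bracket y z.
Proof. by rewrite addrC -scaleN1r bracketPl scaleN1r addrC. Qed.

Lemma bracketBr (K : numFieldType) (g : lieSuperalgebra K) (x y z : g) :
  bracket z (x - y) = bracket z x - bracket z y.
Proof. by rewrite addrC -scaleN1r bracketPr scaleN1r addrC. Qed.

(* By super skew-symmetry a graded left ideal is two-sided. *)
Record lie_ideal (K : numFieldType) (g : lieSuperalgebra K) (I : set g) : Prop :=
  LieIdeal {
    ideal_sub : subspace I;
    ideal_graded : graded (lie_part g) I;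
    ideal_bracket : forall x y, I y -> I (bracket x y) }.

Section Quotient.
Variables (K : numFieldType) (g : lieSuperalgebra K) (I : set g).
Hypothesis idI : lie_ideal I.

Let sI := ideal_sub idI.

Definition quo_rel (x y : g) : bool := `[< I (x - y) >].

Lemma quo_refl : reflexive quo_rel.
Proof. by move=> x; apply/asboolP; rewrite subrr; case: sI. Qed.

Lemma quo_sym : symmetric quo_rel.
Proof.
by move=> x y; apply/asboolP/asboolP => H; rewrite -opprB; exact: (subspaceN sI).
Qed.

Lemma quo_trans : transitive quo_rel.
Proof.
move=> y x z /asboolP xy /asboolP yz; apply/asboolP.
by have -> : x - z = (x - y) + (y - z) by [rewrite addrA subrK];
  exact: (subspaceD sI).
Qed.

Definition quo_equiv := EquivRel quo_rel quo_refl quo_sym quo_trans.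

Definition quo : Type := {eq_quot quo_equiv}%qT.
HB.instance Definition _ := Choice.on quo.
HB.instance Definition _ := EqQuotient.on quo.

Definition quo_pi (x : g) : quo := \pi_quo%qT x.

Lemma quo_piP x y : quo_pi x = quo_pi y <-> I (x - y).
Proof.
by split=> [/(@eqmodP _ quo_equiv) /asboolP //|H]; apply/(@eqmodP _ quo_equiv)/asboolP.
Qed.

Lemma quo_ind (T : quo -> Prop) : (forall x, T (quo_pi x)) -> forall u, T u.
Proof. by move=> H u; rewrite -[u]reprK; exact: H. Qed.

Lemma quo_repr x : I (repr (quo_pi x) - x).
Proof. by apply/quo_piP; rewrite /quo_pi reprK. Qed.

Definition quo_add (u v : quo) : quo := quo_pi (repr u + repr v).
Definition quo_opp (u : quo) : quo := quo_pi (- repr u).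
Definition quo_scale (c : K) (u : quo) : quo := quo_pi (c *: repr u).
Definition quo_bracket (u v : quo) : quo := quo_pi (bracket (repr u) (repr v)).

Lemma quo_piD x y : quo_add (quo_pi x) (quo_pi y) = quo_pi (x + y).
Proof.
by apply/quo_piP; rewrite opprD addrACA; exact: (subspaceD sI (quo_repr x) (quo_repr y)).
Qed.

Lemma quo_piN x : quo_opp (quo_pi x) = quo_pi (- x).
Proof. by apply/quo_piP; rewrite -opprD; exact: (subspaceN sI (quo_repr x)). Qed.

Lemma quo_piZ c x : quo_scale c (quo_pi x) = quo_pi (c *: x).
Proof. by apply/quo_piP; rewrite -scalerBr; exact: (subspaceZ _ sI (quo_repr x)). Qed.

Lemma quo_addA : associative quo_add.
Proof.
move=> u v w; elim/quo_ind: u => x; elim/quo_ind: v => y; elim/quo_ind: w => z.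
by rewrite !quo_piD addrA.
Qed.

Lemma quo_addC : commutative quo_add.
Proof.
by move=> u v; elim/quo_ind: u => x; elim/quo_ind: v => y; rewrite !quo_piD addrC.
Qed.

Lemma quo_add0 : left_id (quo_pi 0) quo_add.
Proof. by move=> u; elim/quo_ind: u => x; rewrite quo_piD add0r. Qed.

Lemma quo_addN : left_inverse (quo_pi 0) quo_opp quo_add.
Proof. by move=> u; elim/quo_ind: u => x; rewrite quo_piN quo_piD addNr. Qed.

HB.instance Definition _ :=
  GRing.isZmodule.Build quo quo_addA quo_addC quo_add0 quo_addN.

Lemma quo_scaleA a b u : quo_scale a (quo_scale b u) = quo_scale (a * b) u.
Proof. by elim/quo_ind: u => x; rewrite !quo_piZ scalerA. Qed.

Lemma quo_scale1 : left_id 1 quo_scale.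
Proof. by move=> u; elim/quo_ind: u => x; rewrite quo_piZ scale1r. Qed.

Lemma quo_scaleDr : right_distributive quo_scale +%R.
Proof.
move=> a u v; elim/quo_ind: u => x; elim/quo_ind: v => y.
rewrite -[quo_pi x + quo_pi y]/(quo_add _ _) -[RHS]/(quo_add _ _).
by rewrite !(quo_piD, quo_piZ) scalerDr.
Qed.

Lemma quo_scaleDl u : {morph quo_scale^~ u : a b / a + b}.
Proof.
move=> a b; elim/quo_ind: u => x; rewrite -[RHS]/(quo_add _ _).
by rewrite !(quo_piD, quo_piZ) scalerDl.
Qed.

HB.instance Definition _ :=
  GRing.Zmodule_isLmodule.Build K quo quo_scaleA quo_scale1 quo_scaleDr quo_scaleDl.

Lemma quo_piP' c x y : quo_pi (c *: x + y) = c *: quo_pi x + quo_pi y.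
Proof. by rewrite -quo_piD -quo_piZ. Qed.

Definition quo_part b : set quo := quo_pi @` lie_part g b.

Lemma quo_grading : grading quo_part.
Proof.
have gg := lie_grading g; split.
- move=> b; have [P0 PL] := grading_sub gg b; split; first by exists 0.
  move=> a _ _ [x Px <-] [y Py <-]; exists (a *: x + y); first exact: PL.
  exact: quo_piP'.
- move=> u; elim/quo_ind: u => x; have [x0 [x1 [P0 P1 ->]]] := grading_sum gg x.
  exists (quo_pi x0), (quo_pi x1); split; [by exists x0|by exists x1|].
  by rewrite -quo_piD.
- move=> _ [x Px <-] [y Py] /quo_piP Iyx; apply/quo_piP; rewrite subr0.
  have Nx : lie_part g false (- x) by exact: (subspaceN (grading_sub gg _)).
  have := ideal_graded idI Nx Py; rewrite addrC => /(_ Iyx) [INx _].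
  by rewrite -[x]opprK; exact: (subspaceN sI).
Qed.

Lemma ideal_bracketr x y : I x -> I (bracket x y).
Proof.
have gg := lie_grading g.
have H b c u v : lie_part g b u -> lie_part g c v -> I u -> I (bracket u v).
  move=> Pu Pv Iu; rewrite (bracketC Pu Pv); apply: (subspaceN sI).
  by apply: (subspaceZ _ sI); exact: ideal_bracket.
have [x0 [x1 [X0 X1 ->]]] := grading_sum gg x.
have [y0 [y1 [Y0 Y1 ->]]] := grading_sum gg y.
move=> /(ideal_graded idI X0 X1) [I0 I1].
rewrite -[x0]scale1r bracketPl -[y0]scale1r !bracketPr !scale1r.
by do ![apply: (subspaceD sI)]; [exact: (H _ _ _ _ X0 Y0)|exact: (H _ _ _ _ X0 Y1)|
  exact: (H _ _ _ _ X1 Y0)|exact: (H _ _ _ _ X1 Y1)].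
Qed.

Lemma quo_pi_bracket x y :
  quo_bracket (quo_pi x) (quo_pi y) = quo_pi (bracket x y).
Proof.
apply/quo_piP; set x' := repr _; set y' := repr _.
have -> : bracket x' y' - bracket x y = bracket x' (y' - y) + bracket (x' - x) y.
  by rewrite bracketBl bracketBr addrA subrK.
apply: (subspaceD sI); first by apply: (ideal_bracket idI); exact: quo_repr.
by apply: ideal_bracketr; exact: quo_repr.
Qed.

Lemma quo_bracket_part a b u v :
  quo_part a u -> quo_part b v -> quo_part (a (+) b) (quo_bracket u v).
Proof.
move=> [x Px <-] [y Py <-]; rewrite quo_pi_bracket.
by exists (bracket x y) => //; exact: bracket_part.
Qed.

Lemma quo_bracketPl c u v w :
  quo_bracket (c *: u + v) w = c *: quo_bracket u w + quo_bracket v w.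
Proof.
elim/quo_ind: u => x; elim/quo_ind: v => y; elim/quo_ind: w => z.
by rewrite -quo_piP' !quo_pi_bracket bracketPl quo_piP'.
Qed.

Lemma quo_bracketPr c u v w :
  quo_bracket w (c *: u + v) = c *: quo_bracket w u + quo_bracket w v.
Proof.
elim/quo_ind: u => x; elim/quo_ind: v => y; elim/quo_ind: w => z.
by rewrite -quo_piP' !quo_pi_bracket bracketPr quo_piP'.
Qed.

Lemma quo_bracketC a b u v : quo_part a u -> quo_part b v ->
  quo_bracket u v = - ((-1) ^+ (a && b) *: quo_bracket v u).
Proof.
move=> [x Px <-] [y Py <-]; rewrite !quo_pi_bracket (bracketC Px Py).
by rewrite -quo_piN -quo_piZ.
Qed.

Lemma quo_bracketJ a b u v w : quo_part a u -> quo_part b v ->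
  quo_bracket u (quo_bracket v w) = quo_bracket (quo_bracket u v) w +
    (-1) ^+ (a && b) *: quo_bracket v (quo_bracket u w).
Proof.
move=> [x Px <-] [y Py <-]; elim/quo_ind: w => z; rewrite !quo_pi_bracket.
by rewrite (bracketJ _ Px Py) -quo_piD -quo_piZ.
Qed.

Definition lie_quo : lieSuperalgebra K :=
  LieSuperalgebra quo_grading quo_bracket_part quo_bracketPl quo_bracketPr
    quo_bracketC quo_bracketJ.

End Quotient.

(* The sum of all graded ideals that intersect H trivially, as the            *)
(* intersection of all subspaces that contain them.  It contains every such   *)
(* ideal, and for the Cartan subalgebra of a contragredient Lie superalgebra  *)
(* with independent simple roots it is itself one (graded ideals are sums of  *)
(* root spaces), hence the maximal one.                                       *)
Section Radical.
Variables (K : numFieldType) (g : lieSuperalgebra K) (H : set g).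

Definition radical : set g := fun x =>
  forall S : set g, subspace S ->
    (forall I, lie_ideal I -> I `&` H `<=` [set 0] -> I `<=` S) -> S x.

Lemma radical_ideal : lie_ideal radical.
Proof.
have gg := lie_grading g; split.
- split=> [S [] //|a u v Ru Rv S sS IS].
  by have [_ SL] := sS; apply: SL; [exact: Ru|exact: Rv].
- move=> v0 v1 P0 P1 R01.
  suff H01 S : subspace S ->
      (forall I, lie_ideal I -> I `&` H `<=` [set 0] -> I `<=` S) ->
      S v0 /\ S v1.
    by split=> S sS IS; case: (H01 S sS IS).
  move=> sS IS.
  pose T : set g := fun v => forall w0 w1,
    lie_part g false w0 -> lie_part g true w1 -> v = w0 + w1 -> S w0 /\ S w1.
  suff : T (v0 + v1) by apply.
  apply: R01 => [|I iI IH v Iv w0 w1 W0 W1 E].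
    have z0 : lie_part g false 0 by case: (grading_sub gg false).
    have z1 : lie_part g true 0 by case: (grading_sub gg true).
    split=> [w0 w1 W0 W1 E|a u v Tu Tv w0 w1 W0 W1 E].
      have [<- <-] := grading_uniq gg z0 z1 W0 W1 (etrans (addr0 0) E).
      by case: sS.
    have [u0 [u1 [U0 U1 Eu]]] := grading_sum gg u.
    have [t0 [t1 [T0 T1 Et]]] := grading_sum gg v.
    have [Su0 Su1] := Tu _ _ U0 U1 Eu; have [St0 St1] := Tv _ _ T0 T1 Et.
    have A0 : lie_part g false (a *: u0 + t0) by case: (grading_sub gg false) => _; apply.
    have A1 : lie_part g true (a *: u1 + t1) by case: (grading_sub gg true) => _; apply.
    have [|<- <-] := grading_uniq gg A0 A1 W0 W1.
      by rewrite -E Eu Et scalerDr addrACA.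
    by case: sS => _ SL; split; apply: SL.
  rewrite E in Iv; have [I0 I1] := ideal_graded iI W0 W1 Iv.
  by split; apply: (IS I).
- move=> x y Ry S sS IS; pose T : set g := fun z => S (bracket x z).
  suff : T y by [].
  apply: Ry => [|I iI IH z Iz].
    have br0 : bracket x 0 = 0 by have := bracketBr 0 0 x; rewrite !subrr.
    case: sS => S0 SL; split; first by rewrite /T br0.
    by move=> a u v Tu Tv; rewrite /T bracketPr; exact: SL.
  by apply: (IS I) => //; exact: ideal_bracket.
Qed.

End Radical.

(* Contragredient Lie superalgebras all of whose simple roots are odd.  The   *)
(* Lie superalgebra contra_pre A generated by e_i, f_i, h_i subject to the    *)
(* Chevalley relations is a quotient of nonassociative bracket expressions by *)
(* the congruence generated by the vector space axioms, the Lie superalgebra  *)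
(* axioms and these relations.                                                *)
(* The Cartan subalgebra is the span of the h_i, without added derivations,   *)
(* so the definition below is the usual g(A) only when A is invertible.       *)
Section Contragredient.
Variables (K : numFieldType) (n : nat) (A : 'M[K]_n).

Inductive gen := Ge of 'I_n | Gf of 'I_n | Gh of 'I_n.

Definition gen_parity (x : gen) : bool := if x is Gh _ then false else true.

Inductive term :=
| Tgen of gen
| Tzero
| Tadd of term & term
| Tscale of K & term
| Tbr of term & term.

Inductive thom : bool -> term -> Prop :=
| thom_gen x : thom (gen_parity x) (Tgen x)
| thom_zero b : thom b Tzero
| thom_add b s t : thom b s -> thom b t -> thom b (Tadd s t)
| thom_scale b c t : thom b t -> thom b (Tscale c t)
| thom_br a b s t : thom a s -> thom b t -> thom (a (+) b) (Tbr s t).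

Local Notation "s +t t" := (Tadd s t) (at level 50, left associativity).
Local Notation "c *t t" := (Tscale c t) (at level 40, left associativity).
Local Notation "[ s ; t ]t" := (Tbr s t) (at level 0).
Local Notation e i := (Tgen (Ge i)).
Local Notation f i := (Tgen (Gf i)).
Local Notation h i := (Tgen (Gh i)).

Reserved Notation "s =t t" (at level 70).
Inductive teq : term -> term -> Prop :=
| teq_refl s : s =t s
| teq_sym s t : s =t t -> t =t s
| teq_trans s t u : s =t t -> t =t u -> s =t u
| teq_add s s' t t' : s =t s' -> t =t t' -> s +t t =t s' +t t'
| teq_scale c s s' : s =t s' -> c *t s =t c *t s'
| teq_br s s' t t' : s =t s' -> t =t t' -> [s; t]t =t [s'; t']t
| teq_addA s t u : s +t (t +t u) =t s +t t +t u
| teq_addC s t : s +t t =t t +t s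
| teq_add0 s : Tzero +t s =t s
| teq_addN s : (-1) *t s +t s =t Tzero
| teq_scaleA b c s : b *t (c *t s) =t (b * c) *t s
| teq_scale1 s : 1 *t s =t s
| teq_scaleDr c s t : c *t (s +t t) =t c *t s +t c *t t
| teq_scaleDl b c s : (b + c) *t s =t b *t s +t c *t s
| teq_brPl c s t u : [c *t s +t t; u]t =t c *t [s; u]t +t [t; u]t
| teq_brPr c s t u : [u; c *t s +t t]t =t c *t [u; s]t +t [u; t]t
| teq_brC a b s t : thom a s -> thom b t ->
    [s; t]t =t (-1) *t ((-1) ^+ (a && b) *t [t; s]t)
| teq_brJ a b s t u : thom a s -> thom b t ->
    [s; [t; u]t]t =t [[s; t]t; u]t +t (-1) ^+ (a && b) *t [t; [s; u]t]t
| teq_hh i j : [h i; h j]t =t Tzero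
| teq_ef i j : [e i; f j]t =t (i == j)%:R *t h i
| teq_he i j : [h i; e j]t =t A i j *t e j
| teq_hf i j : [h i; f j]t =t - A i j *t f j
where "s =t t" := (teq s t).

(* The parity automorphism, used to see that the even and odd parts meet in 0. *)
Fixpoint tsigma (t : term) : term :=
  match t with
  | Tgen x => (-1) ^+ gen_parity x *t Tgen x
  | Tzero => Tzero
  | Tadd s t => tsigma s +t tsigma t
  | Tscale c t => c *t tsigma t
  | Tbr s t => [tsigma s; tsigma t]t
  end.

Lemma teq_scale0 s : 0 *t s =t Tzero.
Proof.
rewrite -(addNr (1 : K)); apply: teq_trans (teq_scaleDl _ _ _) _.
by apply: teq_trans (teq_addN s); apply: teq_add; [exact: teq_refl|exact: teq_scale1].
Qed.

Lemma teq_scalez c : c *t Tzero =t Tzero.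
Proof.
apply: teq_trans (teq_scale _ (teq_sym (teq_scale0 Tzero))) _.
by apply: teq_trans (teq_scaleA _ _ _) _; rewrite mulr0; exact: teq_scale0.
Qed.

Lemma teq_addr0 s : s +t Tzero =t s.
Proof. exact: teq_trans (teq_addC _ _) (teq_add0 _). Qed.

Lemma teq_brZl c s t : [c *t s; t]t =t c *t [s; t]t.
Proof.
have z : [Tzero; t]t =t Tzero.
  apply: teq_trans (teq_br (teq_sym (teq_addN Tzero)) (teq_refl t)) _.
  by apply: teq_trans (teq_brPl _ _ _ _) (teq_addN _).
apply: teq_trans (teq_br (teq_sym (teq_addr0 _)) (teq_refl t)) _.
apply: teq_trans (teq_brPl _ _ _ _) _.
by apply: teq_trans (teq_addr0 _); apply: teq_add; [exact: teq_refl|].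
Qed.

Lemma teq_brZr c s t : [t; c *t s]t =t c *t [t; s]t.
Proof.
have z : [t; Tzero]t =t Tzero.
  apply: teq_trans (teq_br (teq_refl t) (teq_sym (teq_addN Tzero))) _.
  by apply: teq_trans (teq_brPr _ _ _ _) (teq_addN _).
apply: teq_trans (teq_br (teq_refl t) (teq_sym (teq_addr0 _))) _.
apply: teq_trans (teq_brPr _ _ _ _) _.
by apply: teq_trans (teq_addr0 _); apply: teq_add; [exact: teq_refl|].
Qed.

Lemma teq_brZZ b c s t : [b *t s; c *t t]t =t (b * c) *t [s; t]t.
Proof.
apply: teq_trans (teq_brZl _ _ _) _.
by apply: teq_trans (teq_scale _ (teq_brZr _ _ _)) (teq_scaleA _ _ _).
Qed.

Lemma thom_sigma b t : thom b t -> thom b (tsigma t).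
Proof. by elim=> *; constructor=> //; constructor. Qed.

Lemma tsigma_hom b t : thom b t -> tsigma t =t (-1) ^+ b *t t.
Proof.
elim=> [x|{}b|{}b s u _ IHs _ IHu|{}b c s _ IHs|a {}b s u _ IHs _ IHu] /=.
- exact: teq_refl.
- exact: teq_sym (teq_scalez _).
- exact: teq_trans (teq_add IHs IHu) (teq_sym (teq_scaleDr _ _ _)).
- apply: teq_trans (teq_scale _ IHs) _; apply: teq_trans (teq_scaleA _ _ _) _.
  by rewrite mulrC; exact: teq_sym (teq_scaleA _ _ _).
- apply: teq_trans (teq_br IHs IHu) _; apply: teq_trans (teq_brZZ _ _ _ _) _.
  by rewrite -signr_addb; exact: teq_refl.
Qed.

Lemma tsigma_teq s t : s =t t -> tsigma s =t tsigma t.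
Proof.
have Z0 i c : c *t (1 *t h i) =t c *t h i by apply/teq_scale/teq_scale1.
elim=> /= *; try by [econstructor; eauto].
- exact: teq_brC (thom_sigma _) (thom_sigma _).
- exact: teq_brJ (thom_sigma _) (thom_sigma _).
- apply: teq_trans (teq_brZZ _ _ _ _) _.
  by apply: teq_trans (teq_scale _ (teq_hh _ _)) (teq_scalez _).
- apply: teq_trans (teq_brZZ _ _ _ _) _; rewrite mulrNN mulr1.
  apply: teq_trans (teq_scale1 _) _; apply: teq_trans (teq_ef _ _) _.
  exact: teq_sym.
- apply: teq_trans (teq_brZZ _ _ _ _) _; rewrite mul1r.
  apply: teq_trans (teq_scale _ (teq_he _ _)) _.
  apply: teq_trans (teq_scaleA _ _ _) _; rewrite mulrC.
  exact: teq_sym (teq_scaleA _ _ _).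
- apply: teq_trans (teq_brZZ _ _ _ _) _; rewrite mul1r.
  apply: teq_trans (teq_scale _ (teq_hf _ _)) _.
  apply: teq_trans (teq_scaleA _ _ _) _; rewrite mulrC.
  exact: teq_sym (teq_scaleA _ _ _).
Qed.

HB.instance Definition _ := gen_eqMixin term.
HB.instance Definition _ := gen_choiceMixin term.

Definition teqb (s t : term) : bool := `[< s =t t >].

Lemma teqb_refl : reflexive teqb.
Proof. by move=> s; apply/asboolP; exact: teq_refl. Qed.

Lemma teqb_sym : symmetric teqb.
Proof. by move=> s t; apply/asboolP/asboolP; exact: teq_sym. Qed.

Lemma teqb_trans : transitive teqb.
Proof. by move=> t s u /asboolP st /asboolP tu; apply/asboolP; exact: teq_trans tu. Qed.

Definition teq_equiv := EquivRel teqb teqb_refl teqb_sym teqb_trans.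

Definition pre : Type := {eq_quot teq_equiv}%qT.
HB.instance Definition _ := Choice.on pre.
HB.instance Definition _ := EqQuotient.on pre.

Definition pre_pi (t : term) : pre := \pi_pre%qT t.

Lemma pre_piP s t : pre_pi s = pre_pi t <-> s =t t.
Proof.
by split=> [/(@eqmodP _ teq_equiv) /asboolP //|H]; apply/(@eqmodP _ teq_equiv)/asboolP.
Qed.

Lemma pre_ind (T : pre -> Prop) : (forall t, T (pre_pi t)) -> forall u, T u.
Proof. by move=> H u; rewrite -[u]reprK; exact: H. Qed.

Lemma pre_repr t : repr (pre_pi t) =t t.
Proof. by apply/pre_piP; rewrite /pre_pi reprK. Qed.

Definition pre_add (u v : pre) : pre := pre_pi (repr u +t repr v).
Definition pre_scale (c : K) (u : pre) : pre := pre_pi (c *t repr u).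
Definition pre_opp (u : pre) : pre := pre_scale (-1) u.
Definition pre_bracket (u v : pre) : pre := pre_pi [repr u; repr v]t.

Lemma pre_piD s t : pre_add (pre_pi s) (pre_pi t) = pre_pi (s +t t).
Proof. by apply/pre_piP/teq_add; exact: pre_repr. Qed.

Lemma pre_piZ c t : pre_scale c (pre_pi t) = pre_pi (c *t t).
Proof. by apply/pre_piP/teq_scale; exact: pre_repr. Qed.

Lemma pre_pi_bracket s t : pre_bracket (pre_pi s) (pre_pi t) = pre_pi [s; t]t.
Proof. by apply/pre_piP/teq_br; exact: pre_repr. Qed.

Lemma pre_addA : associative pre_add.
Proof.
move=> u v w; elim/pre_ind: u => x; elim/pre_ind: v => y; elim/pre_ind: w => z.
by rewrite !pre_piD; apply/pre_piP; exact: teq_addA.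
Qed.

Lemma pre_addC : commutative pre_add.
Proof.
move=> u v; elim/pre_ind: u => x; elim/pre_ind: v => y; rewrite !pre_piD.
by apply/pre_piP; exact: teq_addC.
Qed.

Lemma pre_add0 : left_id (pre_pi Tzero) pre_add.
Proof.
by move=> u; elim/pre_ind: u => x; rewrite pre_piD; apply/pre_piP; exact: teq_add0.
Qed.

Lemma pre_addN : left_inverse (pre_pi Tzero) pre_opp pre_add.
Proof.
move=> u; elim/pre_ind: u => x; rewrite /pre_opp pre_piZ pre_piD.
by apply/pre_piP; exact: teq_addN.
Qed.

HB.instance Definition _ :=
  GRing.isZmodule.Build pre pre_addA pre_addC pre_add0 pre_addN.

Lemma pre_scaleA a b u : pre_scale a (pre_scale b u) = pre_scale (a * b) u.
Proof.
by elim/pre_ind: u => x; rewrite !pre_piZ; apply/pre_piP; exact: teq_scaleA.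
Qed.

Lemma pre_scale1 : left_id 1 pre_scale.
Proof.
by move=> u; elim/pre_ind: u => x; rewrite pre_piZ; apply/pre_piP; exact: teq_scale1.
Qed.

Lemma pre_scaleDr : right_distributive pre_scale +%R.
Proof.
move=> a u v; elim/pre_ind: u => x; elim/pre_ind: v => y.
rewrite -[pre_pi x + pre_pi y]/(pre_add _ _) -[RHS]/(pre_add _ _).
by rewrite !(pre_piD, pre_piZ); apply/pre_piP; exact: teq_scaleDr.
Qed.

Lemma pre_scaleDl u : {morph pre_scale^~ u : a b / a + b}.
Proof.
move=> a b; elim/pre_ind: u => x; rewrite -[RHS]/(pre_add _ _).
rewrite !(pre_piD, pre_piZ); by apply/pre_piP; exact: teq_scaleDl.
Qed.

HB.instance Definition _ :=
  GRing.Zmodule_isLmodule.Build K pre pre_scaleA pre_scale1 pre_scaleDr pre_scaleDl.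

Lemma pre_addE s t : pre_pi s + pre_pi t = pre_pi (s +t t).
Proof. exact: pre_piD. Qed.

Lemma pre_scaleE c t : c *: pre_pi t = pre_pi (c *t t).
Proof. exact: pre_piZ. Qed.

Definition pre_part b : set pre := pre_pi @` thom b.

Lemma pre_grading : grading pre_part.
Proof.
split.
- move=> b; split; first by exists Tzero => //; constructor.
  move=> c _ _ [s Hs <-] [t Ht <-]; exists (c *t s +t t).
    by constructor=> //; constructor.
  by rewrite pre_scaleE pre_addE.
- have hom2 b t : thom b t -> exists v0 v1,
      [/\ pre_part false v0, pre_part true v1 & pre_pi t = v0 + v1].
    case: b => Ht; [exists 0, (pre_pi t)|exists (pre_pi t), 0];
      (split; [| |by rewrite ?add0r ?addr0]); try by [exists t];
      by exists Tzero => //; constructor.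
  move=> u; elim/pre_ind: u; elim.
  + by move=> x; apply: (hom2 (gen_parity x)); constructor.
  + by apply: (hom2 false); constructor.
  + move=> s [s0 [s1 [[x0 X0 <-] [x1 X1 <-] Es]]].
    move=> t [t0 [t1 [[y0 Y0 <-] [y1 Y1 <-] Et]]].
    exists (pre_pi (x0 +t y0)), (pre_pi (x1 +t y1)); split.
    * by exists (x0 +t y0) => //; constructor.
    * by exists (x1 +t y1) => //; constructor.
    * by rewrite -!pre_addE Es Et addrACA.
  + move=> c s [s0 [s1 [[x0 X0 <-] [x1 X1 <-] Es]]].
    exists (pre_pi (c *t x0)), (pre_pi (c *t x1)); split.
    * by exists (c *t x0) => //; constructor.
    * by exists (c *t x1) => //; constructor.
    * by rewrite -!pre_scaleE Es scalerDr.
  + move=> s [s0 [s1 [[x0 X0 <-] [x1 X1 <-] Es]]].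
    move=> t [t0 [t1 [[y0 Y0 <-] [y1 Y1 <-] Et]]].
    exists (pre_pi ([x0; y0]t +t [x1; y1]t)), (pre_pi ([x0; y1]t +t [x1; y0]t)).
    split.
    * exists ([x0; y0]t +t [x1; y1]t) => //; constructor.
        exact: (thom_br X0 Y0).
      exact: (thom_br X1 Y1).
    * exists ([x0; y1]t +t [x1; y0]t) => //; constructor.
        exact: (thom_br X0 Y1).
      exact: (thom_br X1 Y0).
    * have brDl a b c : [a +t b; c]t =t [a; c]t +t [b; c]t.
        apply: teq_trans (teq_br (teq_add (teq_sym (teq_scale1 _)) (teq_refl _)) (teq_refl _)) _.
        apply: teq_trans (teq_brPl _ _ _ _) _.
        exact: teq_add (teq_scale1 _) (teq_refl _).
      have brDr a b c : [c; a +t b]t =t [c; a]t +t [c; b]t.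
        apply: teq_trans (teq_br (teq_refl _) (teq_add (teq_sym (teq_scale1 _)) (teq_refl _))) _.
        apply: teq_trans (teq_brPr _ _ _ _) _.
        exact: teq_add (teq_scale1 _) (teq_refl _).
      rewrite -!pre_pi_bracket Es Et !pre_addE !pre_pi_bracket.
      rewrite ((pre_piP _ _).2 (brDl _ _ _)) -pre_addE.
      rewrite !((pre_piP _ _).2 (brDr _ _ _)) -!pre_addE.
      by rewrite [RHS]addrACA [X in _ = _ + X]addrC.
- move=> _ [s Hs <-] [t Ht E].
  have H : pre_pi s = - pre_pi s.
    have Hst := (pre_piP _ _).1 E.
    have := tsigma_teq Hst.
    move/(teq_trans (teq_sym (tsigma_hom Ht))) => H1.
    have := teq_trans H1 (tsigma_hom Hs) => /pre_piP.
    by rewrite -!pre_scaleE expr0 expr1 scale1r scaleN1r E.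
  apply/eqP; have : 2%:R *: pre_pi s == 0.
    by rewrite scaler_nat mulr2n {1}H addNr.
  by rewrite scaler_eq0 pnatr_eq0.
Qed.

Lemma pre_bracket_part a b u v :
  pre_part a u -> pre_part b v -> pre_part (a (+) b) (pre_bracket u v).
Proof.
move=> [x Px <-] [y Py <-]; rewrite pre_pi_bracket.
by exists [x; y]t => //; constructor.
Qed.

Lemma pre_bracketPl c u v w :
  pre_bracket (c *: u + v) w = c *: pre_bracket u w + pre_bracket v w.
Proof.
elim/pre_ind: u => x; elim/pre_ind: v => y; elim/pre_ind: w => z.
rewrite pre_scaleE pre_addE !pre_pi_bracket pre_scaleE pre_addE.
by apply/pre_piP; exact: teq_brPl.
Qed.

Lemma pre_bracketPr c u v w :
  pre_bracket w (c *: u + v) = c *: pre_bracket w u + pre_bracket w v.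
Proof.
elim/pre_ind: u => x; elim/pre_ind: v => y; elim/pre_ind: w => z.
rewrite pre_scaleE pre_addE !pre_pi_bracket pre_scaleE pre_addE.
by apply/pre_piP; exact: teq_brPr.
Qed.

Lemma pre_bracketC a b u v : pre_part a u -> pre_part b v ->
  pre_bracket u v = - ((-1) ^+ (a && b) *: pre_bracket v u).
Proof.
move=> [x Px <-] [y Py <-]; rewrite !pre_pi_bracket -[RHS]scaleN1r (pre_scaleE _ [y; x]t) pre_scaleE.
by apply/pre_piP; exact: (teq_brC Px Py).
Qed.

Lemma pre_bracketJ a b u v w : pre_part a u -> pre_part b v ->
  pre_bracket u (pre_bracket v w) = pre_bracket (pre_bracket u v) w +
    (-1) ^+ (a && b) *: pre_bracket v (pre_bracket u w).
Proof.
move=> [x Px <-] [y Py <-]; elim/pre_ind: w => z; rewrite !pre_pi_bracket.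
by rewrite pre_scaleE pre_addE; apply/pre_piP; exact: teq_brJ.
Qed.

Definition contra_pre : lieSuperalgebra K :=
  LieSuperalgebra pre_grading pre_bracket_part pre_bracketPl pre_bracketPr
    pre_bracketC pre_bracketJ.

Definition pre_cartan : set contra_pre :=
  range (fun x : 'rV[K]_n => \sum_i x 0 i *: (pre_pi (h i) : contra_pre)).

Definition contragredient : lieSuperalgebra K :=
  lie_quo (radical_ideal pre_cartan).

Definition contra_gen (x : gen) : contragredient :=
  quo_pi (radical_ideal pre_cartan) (pre_pi (Tgen x)).

(* The Cartan subalgebra h is identified with 'rV[K]_n by means of its basis  *)
(* h_0, ..., h_(n-1); accordingly h^* is {scalar 'rV[K]_n}.                   *)
Definition cartan (x : 'rV[K]_n) : contragredient :=
  \sum_i x 0 i *: contra_gen (Gh i).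

End Contragredient.

Record supermodule (K : numFieldType) (g : lieSuperalgebra K) := Supermodule {
  mod_sort :> lmodType K;
  mod_part : bool -> set mod_sort;
  act : g -> mod_sort -> mod_sort;
  mod_grading : grading mod_part;
  act_part : forall a b x m,
    lie_part g a x -> mod_part b m -> mod_part (a (+) b) (act x m);
  actPl : forall c x y m, act (c *: x + y) m = c *: act x m + act y m;
  actPr : forall c x m m', act x (c *: m + m') = c *: act x m + act x m';
  act_bracket : forall a b x y m, lie_part g a x -> lie_part g b y ->
    act (bracket x y) m = act x (act y m) - (-1) ^+ (a && b) *: act y (act x m) }.

Arguments mod_part {K g} _.
Arguments act {K g _}.

Section Modules.
Variables (K : numFieldType) (g : lieSuperalgebra K) (M : supermodule g).

Record submodule (S : set M) : Prop := Submodule {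
  submod_sub : subspace S;
  submod_graded : graded (mod_part M) S;
  submod_act : forall x m, S m -> S (act x m) }.

Definition simple_module : Prop :=
  (exists m : M, m <> 0) /\
  forall S : set M, submodule S -> S = [set 0] \/ S = setT.

End Modules.

Section WeightModules.
Variables (K : numFieldType) (n : nat) (A : 'M[K]_n).
Variable M : supermodule (contragredient A).
Implicit Type mu : {scalar 'rV[K]_n}.

Definition weight_space mu : set M :=
  [set m | forall x : 'rV[K]_n, act (cartan A x) m = mu x *: m].

(* The sum of the weight spaces is automatically direct. *)
Definition weight_module : Prop :=
  forall m : M, exists k (mu : 'I_k -> {scalar 'rV[K]_n}) (v : 'I_k -> M),
    (forall i, weight_space (mu i) (v i)) /\ m = \sum_i v i.

Definition bounded : Prop :=
  exists c : nat, forall mu, exists2 d, has_dim (weight_space mu) d & (d < c)%N.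

(* d is the maximum of the dimensions of the weight spaces, which are all     *)
(* finite.                                                                    *)
Definition has_degree (d : nat) : Prop :=
  (exists mu, has_dim (weight_space mu) d) /\
  forall mu, exists2 d', has_dim (weight_space mu) d' & (d' <= d)%N.

End WeightModules.

Definition D21_cartan (K : numFieldType) (alpha : K) : 'M[K]_3 :=
  \matrix_(i, j) nth 0 (nth [::] [:: [:: 0; 1; alpha];
                                     [:: 1; 0; - alpha - 1];
                                     [:: alpha; - alpha - 1; 0]] i) j.

Definition D21 (K : numFieldType) (alpha : K) : lieSuperalgebra K :=
  contragredient (D21_cartan alpha).

(* Main.v *)
(* Let sl_2^(k), k = 0, 1, 2, be the three ideals of the even part, with root
   vectors E_k, F_k, and T_k = E_k F_k.

   Weight spaces are finite-dimensional.  U(g) is spanned by U(g_0) times words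
   of length at most 8 in the odd root vectors, so all the spaces U(g)_(mu - nu)
   are finitely generated over C[T_0, T_1, T_2] and the Cartan part.  By Zorn's
   lemma and Dixmier's form of Schur's lemma (C is uncountable), M_mu has a
   T-stable hyperplane N.  Composing finitely many elements of U(g)_(mu - nu)
   with M_mu -> M_mu / N gives finitely many linear forms on M_nu, and their
   common kernel is 0 because M is simple.

   Degree at most 8.  Put E = E_0, F = F_0 and let the four "lower" odd root
   vectors y be those of weight -1 for sl_2^(0); [E, y] runs over the "upper" ones.
   If F kills a nonzero vector put t = 0 and J = 0; if E does, exchange E and F;
   otherwise E is bijective on M, and J = E^-1.  In the last case Mathieu's twisted
   localization is done inside M: the operators y + t [E, y] J satisfy the
   relations of the y, their squares being 0 and their anticommutators multiples of
   a twisted F whose kernel is nonzero for a suitable root t of a quadratic equation.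
   Hence there is a weight vector v killed by the four (twisted) y, which can be
   taken to be an eigenvector of T_1 and T_2.  Then M is spanned by the x_S u
   where S is a set of upper odd roots and u runs over the vectors obtained from v
   by powers of E_1 or F_1, of E_2 or F_2, and of E_0 or J.  A weight determines the
   parity of #|S|, and together with S these powers, so it occurs at most 8 times. *)
Require Import Defs.
From HB Require Import structures.
From mathcomp Require Import all_boot all_order all_algebra.
From mathcomp Require Import boolp classical_sets reals.
From mathcomp Require Import complex.
From mathcomp Require Import ring lra zify.
Set Implicit Arguments.
Unset Strict Implicit.
Unset Printing Implicit Defensive.
Import Order.TTheory GRing.Theory Num.Theory.
Local Open Scope classical_set_scope.
Local Open Scope ring_scope.

(** * Uncountability of the complex numbers *)

(** Two obstacles shape the argument. Nothing bounds the weight spaces at the start, so an operator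
    on one of them need not have an eigenvector. Finite generation still gives maximal proper stable
    subspaces, hence an eigenvector of the dual kind: a linear form. Uncountability makes the simple
    quotient one-dimensional, since a non-scalar $T$ would turn the $(T-a)^{-1}g$ into uncountably
    many independent vectors in a space of countable dimension. Secondly, no vector killed by half
    of the odd roots is given. When $E$ is invertible on $M$, localizing at $E$ changes nothing, and
    conjugation with $E^t$ makes sense for every scalar $t$ because its series stop. So $t$ is free
    to make the twisted $F$ singular: that $E$ times the twisted $F$ kills an eigenvector of $EF$ is
    a quadratic condition on $t$. The algebra comes as a quotient by a maximal ideal, without a
    basis. Beyond the defining relations, the proof uses only those forced by singular vectors of
    nonzero height lying in the radical. *)

(* K is not a countable union of finite sets: every f has an infinite sublevel set. *)
Definition uncountable_field (K : numFieldType) : Prop :=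
  forall f : K -> nat, exists n, forall k, exists s : seq K,
    [/\ uniq s, size s = k & forall z, z \in s -> (f z <= n)%N].

Lemma avoid_seq (R : realType) (s : seq R) (a b : R) : a < b ->
  exists a' b', [/\ a <= a', a' < b', b' <= b & forall z, z \in s -> ~ (a' <= z <= b')].
Proof.
elim: s a b => [|z s IH] a b ab; first by exists a, b; split.
have [a1 [b1 [aa1 ab1 bb1 H1]]] : exists a' b',
    [/\ a <= a', a' < b', b' <= b & ~ (a' <= z <= b')].
  have [zm|mz] := lerP z ((a + b) / 2).
    by exists ((a + 3 * b) / 4), b; split; [lra|lra|lra|move/andP=> [? ?]; lra].
  by exists a, ((a + b) / 2); split; [lra|lra|lra|move/andP=> [? ?]; lra].
have [a' [b' [aa' ab' bb' H']]] := IH _ _ ab1.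
exists a', b'; split; [exact: le_trans aa'|by []|exact: le_trans bb1|].
move=> w; rewrite inE => /orP[/eqP -> /andP[h1 h2]|]; last exact: H'.
by apply: H1; rewrite (le_trans aa' h1) (le_trans h2 bb').
Qed.

(* Cantor's nested intervals. *)
Lemma real_uncountable (R : realType) (f : R -> nat) :
  exists n, forall k, exists s : seq R,
    [/\ uniq s, size s = k & forall z, z \in s -> (f z <= n)%N].
Proof.
apply: contrapT => /forallNP N.
have fin n : exists s : seq R, forall z, (f z <= n)%N -> z \in s.
  have /existsNP[k Hk] := N n; apply: contrapT => /forallNP Hs; apply: Hk.
  elim: k => [|k [s [us ss Ps]]]; first by exists [::].
  have /existsNP[z] := Hs s.
  move=> /not_implyP[fz /negP zs]; exists (z :: s); split=> /=.
  - by rewrite zs.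
  - by rewrite ss.
  - by move=> w; rewrite inE => /orP[/eqP ->|]; [|exact: Ps].
have step n (I : {p : R * R | p.1 < p.2}) : exists I' : {p : R * R | p.1 < p.2},
    [/\ (sval I).1 <= (sval I').1, (sval I').2 <= (sval I).2 &
        forall z, (f z <= n)%N -> ~ ((sval I').1 <= z <= (sval I').2)].
  case: I => [[a b] /= ab]; have [s Hs] := fin n.
  have [a' [b' [h1 h2 h3 h4]]] := avoid_seq s ab.
  by exists (exist _ (a', b') h2); split=> //= z /Hs; exact: h4.
pose nxt n I := proj1_sig (cid (step n I)).
have nxtP n I := proj2_sig (cid (step n I)).
have I0 : ((0 : R), (1 : R)).1 < ((0 : R), (1 : R)).2 by rewrite /= ltr01.
pose J := fix J n := if n is n'.+1 then nxt n' (J n') else exist _ ((0 : R), (1 : R)) I0.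
have mono1 n m : (sval (J n)).1 <= (sval (J (n + m)%N)).1.
  elim: m => [|m IH]; first by rewrite addn0.
  by rewrite addnS; apply: (le_trans IH); case: (nxtP (n + m)%N (J (n + m)%N)).
have mono2 n m : (sval (J (n + m)%N)).2 <= (sval (J n)).2.
  elim: m => [|m IH]; first by rewrite addn0.
  by rewrite addnS; apply: (le_trans _ IH); case: (nxtP (n + m)%N (J (n + m)%N)).
have ub n m : (sval (J n)).1 <= (sval (J m)).2.
  apply: (le_trans (mono1 n m)); apply: (le_trans _ (mono2 m n)).
  by rewrite addnC; apply: ltW; exact: proj2_sig (J (m + n)%N).
pose s := sup (range (fun n => (sval (J n)).1)).
have H n : (sval (J n)).1 <= s <= (sval (J n)).2.
  apply/andP; split; last first.
    by apply: ge_sup; [exists (sval (J 0%N)).1, 0%N|move=> _ [m _ <-]].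
  apply: ub_le_sup; last by exists n.
  by exists (sval (J 0%N)).2 => _ [m _ <-].
(* Interval number [f s] + 1 avoids all points of value at most [f s], but [s] lies in every
   interval. *)
by have [_ _ /(_ s (leqnn _))] := nxtP (f s) (J (f s)); apply; exact: (H (f s).+1).
Qed.

Lemma complex_uncountable (R : realType) : uncountable_field R[i]%C.
Proof.
move=> f; have [n Hn] := real_uncountable (fun r => f r%:C%C).
exists n => k; have [s [us ss Ps]] := Hn k.
exists [seq r%:C%C | r <- s]; split; last by move=> _ /mapP[r rs ->]; exact: Ps.
  by rewrite map_inj_uniq // => r t; case.
by rewrite size_map.
Qed.

(** * Linear algebra without finiteness assumptions *)

Section LinearAlgebra.
Variables (K : numFieldType) (V : lmodType K).
Implicit Types (S W G : set V) (T : {linear V -> V}).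

(** As an intersection, the span yields inclusions in subspaces and induction on its elements
    without finite linear combinations. *)
Definition span G : set V := fun v => forall S, subspace S -> G `<=` S -> S v.

Lemma subspace_span G : subspace (span G).
Proof.
by split=> [S [] //|a u v Gu Gv S sS GS]; case: (sS) => _; apply; [exact: Gu|exact: Gv].
Qed.

Lemma sub_span G : G `<=` span G.
Proof. by move=> v Gv S _; apply. Qed.

Lemma span_ind G (Q : V -> Prop) : Q 0 ->
  (forall a u v, Q u -> Q v -> Q (a *: u + v)) -> (forall g, G g -> Q g) ->
  forall v, span G v -> Q v.
Proof. by move=> Q0 QL GQ v; apply; [split|exact: GQ]. Qed.

Lemma span_min G S : subspace S -> G `<=` S -> span G `<=` S.
Proof. by move=> sS GS v; apply. Qed.

Lemma span_mono G G' : G `<=` G' -> span G `<=` span G'.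
Proof.
by move=> GG'; apply: span_min; [exact: subspace_span|move=> v /GG'; exact: sub_span].
Qed.

Lemma subspace0 S : subspace S -> S 0. Proof. by case. Qed.

Lemma subspace_sum S I (r : seq I) (P : pred I) (F : I -> V) : subspace S ->
  (forall i, P i -> S (F i)) -> S (\sum_(i <- r | P i) F i).
Proof.
by move=> sS SF; apply: big_ind => //; [exact: subspace0|move=> u v; exact: subspaceD].
Qed.

Lemma subspaceDr S u v : subspace S -> S v -> S (u + v) -> S u.
Proof. by move=> sS Sv Suv; rewrite -[u](addrK v); exact: subspaceB. Qed.

Lemma subspace_preim T S : subspace S -> subspace (T @^-1` S).
Proof.
by move=> sS; split=> [|a u v] /=; rewrite ?linear0 ?linearP; [exact: subspace0|case: sS => _;
  apply].
Qed.

Lemma subspaceI S S' : subspace S -> subspace S' -> subspace (S `&` S').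
Proof. by move=> [? h] [? h']; split=> // a u v [? ?] [? ?]; split; [apply: h|apply: h']. Qed.

Lemma subspaceT : subspace (@setT V). Proof. by []. Qed.

Lemma subspace_zero : subspace [set (0 : V)].
Proof. by split=> // a u v -> ->; rewrite scaler0 addr0. Qed.

Lemma span_image T G v : span G v -> span (T @` G) (T v).
Proof.
apply: (span_min (subspace_preim T (subspace_span _))) => u Gu.
by apply: sub_span; exists u.
Qed.

(** The operator $\prod_k(T-k)$ over the list [ks]. On an eigenvector it is a scalar that vanishes
    exactly when the eigenvalue is listed. *)
Definition oppl T (ks : seq K) (v : V) : V := foldr (fun k u => T u - k *: u) v ks.

Lemma opplP T ks a u v : oppl T ks (a *: u + v) = a *: oppl T ks u + oppl T ks v.
Proof.
elim: ks => //= k ks ->; rewrite linearP [k *: (_ + _)]scalerDr opprD addrACA.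
by rewrite scalerBr !scalerA mulrC.
Qed.

Lemma oppl_eigen T ks k v : T v = k *: v ->
  oppl T ks v = \prod_(a <- ks) (k - a) *: v.
Proof.
move=> Tv; elim: ks => [|a ks /= ->]; first by rewrite big_nil scale1r.
by rewrite big_cons linearZ Tv /= !scalerA -scalerBl mulrBl (mulrC k).
Qed.

Lemma oppl_cat T ks ks' v : oppl T (ks ++ ks') v = oppl T ks (oppl T ks' v).
Proof. exact: foldr_cat. Qed.

Lemma opplC1 T ks k v : oppl T ks (T v - k *: v) = T (oppl T ks v) - k *: oppl T ks v.
Proof.
have TB a u w : T (u - a *: w) = T u - a *: T w by rewrite -!scaleNr [u + _]addrC linearP addrC.
elim: ks => //= a ks ->; set o := oppl _ _ _.
rewrite !TB !scalerBr !scalerA (mulrC a) !opprB !addrA.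
by rewrite ![_ - k *: _ + _]addrAC; congr (_ + _); rewrite addrAC.
Qed.

Lemma opplC T ks ks' v : oppl T ks (oppl T ks' v) = oppl T ks' (oppl T ks v).
Proof. by elim: ks' => //= k ks' <-; rewrite opplC1. Qed.

Lemma oppl0 T ks : oppl T ks 0 = 0.
Proof. by elim: ks => //= k ks ->; rewrite linear0 scaler0 subr0. Qed.

(** Modulo generators of eigenvalue [k], a product of factors $T-a$ with $a\neq k$ kills [z]. The
    difference again has eigenvalue [k], and there this product is a nonzero scalar. *)
Lemma span_eigen T G k z : (forall g, G g -> exists a, T g = a *: g) ->
  span G z -> T z = k *: z -> span [set g | G g /\ T g = k *: g] z.
Proof.
move=> GE Gz Tz; set G' := [set g | _].
have [ks [z' [kks G'z' E]]] : exists ks z', [/\ k \notin ks, span G' z' & oppl T ks (z - z') = 0].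
  elim/span_ind: {Tz} Gz => [|a u v|g Gg].
  - exists [::], 0; split=> //=; [exact: subspace0 (subspace_span _)|by rewrite subrr].
  - move=> [ks [u' [hks Gu' Eu]]] [ls [v' [hls Gv' Ev]]].
    exists (ks ++ ls), (a *: u' + v'); split.
    + by rewrite mem_cat negb_or hks.
    + by case: (subspace_span G') => _; apply.
    + have -> : a *: u + v - (a *: u' + v') = a *: (u - u') + (v - v').
        by rewrite opprD addrACA scalerBr.
      rewrite opplP !oppl_cat Ev oppl0 addr0 opplC Eu oppl0 scaler0 //.
  - have [a Ta] := GE _ Gg.
    have [ak|/eqP ak] := eqVneq a k.
      exists [::], g; split=> //=; last by rewrite subrr.
      by apply: sub_span; split=> //; rewrite -ak.
    exists [:: a], 0; split=> /=; last by rewrite subr0 Ta subrr.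
      by rewrite inE eq_sym; apply/eqP.
    exact: subspace0 (subspace_span _).
suff -> : z = z' by [].
have Tz' : T z' = k *: z'.
  apply: (G'z' [set w | T w = k *: w]); last by move=> g [].
  by split=> [|a u v /= Eu Ev];
    rewrite /= ?linear0 ?scaler0 // linearP Eu Ev scalerDr !scalerA mulrC.
have Tzz : T (z - z') = k *: (z - z') by rewrite linearB Tz Tz' scalerBr.
move: E; rewrite (oppl_eigen _ Tzz) => /eqP; rewrite scaler_eq0 => /orP[|].
  rewrite prodf_seq_eq0 => /hasP[a aks /=]; rewrite subr_eq0 => /eqP E.
  by rewrite E aks in kks.
by rewrite subr_eq0 => /eqP.
Qed.

(** Bounds the dimension through dependence, so that it passes to subsets and asks for no basis. *)
Definition dimle W n : Prop := forall v : 'I_n.+1 -> V, (forall i, W (v i)) ->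
  exists2 c : 'I_n.+1 -> K, (exists i, c i != 0) & \sum_i c i *: v i = 0.

Lemma dimle_sub W W' n : W `<=` W' -> dimle W' n -> dimle W n.
Proof. by move=> WW' H v Wv; apply: H => i; exact: WW'. Qed.

Lemma wide_kernel m n (A : 'M[K]_(m, n)) : (n < m)%N ->
  exists2 c : 'rV[K]_m, c != 0 & c *m A = 0.
Proof.
move=> nm; have /rowV0Pn[c /sub_kermxP cA c0] : kermx A != 0.
  by rewrite kermx_eq0 /row_free neq_ltn (leq_ltn_trans (rank_leq_col A) nm).
by exists c.
Qed.

(** The forms separate points, so a relation between the rows of their values is one between the
    vectors. Linearity is asked on [W] only, where the forms will be chosen. *)
Lemma dimle_fun W n (phi : 'I_n -> V -> K) : subspace W ->
  (forall i a u v, W u -> W v -> phi i (a *: u + v) = a * phi i u + phi i v) ->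
  (forall w, W w -> (forall i, phi i w = 0) -> w = 0) -> dimle W n.
Proof.
move=> sW lphi inj v Wv.
have [c c0 cA] := wide_kernel (\matrix_(i, j) phi j (v i)) (ltnSn n).
exists (c 0); first by move/rV0Pn: c0 => [i ci]; exists i.
have phi0 j : phi j 0 = 0.
  have := lphi j 1 0 0 (subspace0 sW) (subspace0 sW).
  by rewrite scaler0 addr0 mul1r => /eqP;
    rewrite -subr_eq0 opprD addrA subrr sub0r oppr_eq0 => /eqP.
apply: inj => [|j]; first by apply: subspace_sum => // i _; exact: subspaceZ.
have -> : phi j (\sum_i c 0 i *: v i) = \sum_i c 0 i * phi j (v i).
  suff [] : phi j (\sum_i c 0 i *: v i) =
    \sum_i c 0 i * phi j (v i) /\ W (\sum_i c 0 i *: v i) by [].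
  apply: (big_ind2 (fun u a => phi j u = a /\ W u)).
  - by split; [exact: phi0|exact: subspace0].
  - move=> u a u' a' [<- Wu] [<- Wu']; split; last exact: subspaceD.
    by rewrite -[u]scale1r lphi // mul1r scale1r.
  - move=> i _; split; last exact: subspaceZ.
    by rewrite -[_ *: _]addr0 lphi ?phi0 ?addr0 //; exact: subspace0.
have /rowP /(_ j) := cA; rewrite !mxE => E.
by rewrite -[RHS]E; apply: eq_bigr => i _; rewrite mxE.
Qed.

Lemma span_seq (s : seq V) z : span [set` s] z ->
  exists c : 'I_(size s) -> K, z = \sum_i c i *: s`_i.
Proof.
elim/span_ind => {z} [|a u v|v].
- by exists (fun=> 0); rewrite big1 // => i _; rewrite scale0r.
- move=> [c ->] [d ->]; exists (fun i => a * c i + d i).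
  rewrite scaler_sumr -big_split /=; apply: eq_bigr => i _.
  by rewrite scalerDl scalerA.
- move=> /= vs; have iv : (index v s < size s)%N by rewrite index_mem.
  exists (fun i => (i == Ordinal iv)%:R).
  rewrite (bigD1 (Ordinal iv)) //= eqxx scale1r nth_index // big1 ?addr0 //.
  by move=> i /negbTE ->; rewrite scale0r.
Qed.

Lemma dimle_span W (s : seq V) : W `<=` span [set` s] -> dimle W (size s).
Proof.
move=> Ws v Wv.
have /choice[c Hc] : forall i, exists c : 'I_(size s) -> K, v i = \sum_j c j *: s`_j.
  by move=> i; apply: span_seq; apply: Ws.
have [d d0 dA] := wide_kernel (\matrix_(i, j) c i j) (ltnSn (size s)).
exists (d 0); first by move/rV0Pn: d0 => [i di]; exists i.
have -> : \sum_i d 0 i *: v i = \sum_i \sum_j (d 0 i * c i j) *: s`_j.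
  by apply: eq_bigr => i _; rewrite Hc scaler_sumr; apply: eq_bigr => j _; rewrite scalerA.
rewrite exchange_big /= big1 // => j _.
rewrite -scaler_suml; have /rowP /(_ j) := dA; rewrite !mxE => E.
have -> : \sum_i d 0 i * c i j = 0 by rewrite -[RHS]E; apply: eq_bigr => i _; rewrite mxE.
by rewrite scale0r.
Qed.

Lemma dimle_has_dim W n : subspace W -> dimle W n ->
  exists2 d, has_dim W d & (d <= n)%N.
Proof.
move=> sW Wn.
pose P d := `[< exists v : 'I_d -> V, (forall i, W (v i)) /\ lin_indep v >].
have exP : exists d, (d <= n)%N && P d.
  by exists 0%N; apply/asboolP; exists (fun=> 0); split=> [|c _] [].
have [d /andP[dn /asboolP[v [Wv iv]]] maxd] :=
  ex_maxnP exP (fun d (h : (d <= n)%N && P d) => (andP h).1).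
exists d => //; exists v; split=> // w Ww.
pose v' (i : 'I_d.+1) := if unlift ord0 i is Some j then v j else w.
have Wv' i : W (v' i) by rewrite /v'; case: unlift.
have sumE (c : 'I_d.+1 -> K) : \sum_i c i *: v' i = c ord0 *: w + \sum_i c (lift ord0 i) *: v i.
  rewrite big_ord_recl /v' unlift_none; congr (_ + _).
  by apply: eq_bigr => i _; rewrite liftK.
have [c [i ci] c0] : exists2 c : 'I_d.+1 -> K, (exists i, c i != 0) & \sum_i c i *: v' i = 0.
  (* Maximality ranges over [d <= n] and says nothing about [n + 1] vectors; there the bound on [W]
     itself applies. *)
  have [E|ne] := eqVneq d n; first by subst n; exact: Wn.
  apply: contrapT => H.
  have : (d.+1 <= n)%N && P d.+1.
    rewrite ltn_neqAle ne dn; apply/asboolP; exists v'; split=> // c c0 i.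
    by apply/eqP/negPn/negP => ci; apply: H; exists c => //; exists i.
  by move/maxd; rewrite ltnn.
rewrite sumE in c0.
have c00 : c ord0 != 0.
  apply/eqP => c00; move: c0; rewrite c00 scale0r add0r => /iv ci0.
  move: ci; case: (unliftP ord0 i) => [j ->|->]; rewrite ?ci0 ?c00 eqxx //.
exists (fun j => - (c ord0)^-1 * c (lift ord0 j)).
have -> : \sum_i (- (c ord0)^-1 * c (lift ord0 i)) *: v i =
    - (c ord0)^-1 *: \sum_i c (lift ord0 i) *: v i.
  by rewrite scaler_sumr; apply: eq_bigr => k _; rewrite scalerA.
rewrite scaleNr; apply/eqP; rewrite -addr_eq0 -[w]scale1r.
by rewrite -(mulVf c00) -scalerA -scalerDr c0 scaler0.
Qed.

Lemma graded_span P G : grading P -> (forall v, G v -> exists b, P b v) -> graded P (span G).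
Proof.
move=> gP GP v0 v1 P0 P1 /(@span_ind G (fun v => forall v0 v1, P false v0 ->
  P true v1 -> v = v0 + v1 -> span G v0 /\ span G v1)) H.
have sG := subspace_span G.
apply: H => // [|a u v|v].
- move=> w0 w1 W0 W1 /esym E.
  have Z b : P b 0 by case: (grading_sub gP b).
  have [-> ->] := grading_uniq gP W0 W1 (Z _) (Z _) (etrans E (esym (addr0 0))).
  by split; exact: subspace0.
- move=> Hu Hv w0 w1 W0 W1 E.
  have [u0 [u1 [U0 U1 Eu]]] := grading_sum gP u.
  have [t0 [t1 [T0 T1 Et]]] := grading_sum gP v.
  have [Su0 Su1] := Hu _ _ U0 U1 Eu; have [St0 St1] := Hv _ _ T0 T1 Et.
  have A0 : P false (a *: u0 + t0) by case: (grading_sub gP false) => _; apply.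
  have A1 : P true (a *: u1 + t1) by case: (grading_sub gP true) => _; apply.
  have [|<- <-] := grading_uniq gP A0 A1 W0 W1.
    by rewrite -E Eu Et scalerDr addrACA.
  by case: sG => _ SL; split; apply: SL.
- move=> Gv w0 w1 W0 W1 E; have [[] Pv] := GP v Gv.
  + have Z : P false 0 by case: (grading_sub gP false).
    have [<- <-] := grading_uniq gP Z Pv W0 W1 (etrans (add0r _) E).
    by split; [exact: subspace0|exact: sub_span].
  + have Z : P true 0 by case: (grading_sub gP true).
    have [<- <-] := grading_uniq gP Pv Z W0 W1 (etrans (addr0 _) E).
    by split; [exact: sub_span|exact: subspace0].
Qed.

Definition pact T (p : {poly K}) (v : V) : V := \sum_(i < size p) p`_i *: iter i T v.

Lemma pact_wide T (p : {poly K}) v n : (size p <= n)%N ->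
  pact T p v = \sum_(i < n) p`_i *: iter i T v.
Proof.
move=> pn; rewrite /pact (big_ord_widen n (fun i => p`_i *: iter i T v)) // big_mkcond /=.
by apply: eq_bigr => i _; case: ltnP => // h; rewrite nth_default ?scale0r.
Qed.

Lemma pactP T a p q v : pact T (a *: p + q) v = a *: pact T p v + pact T q v.
Proof.
set n := maxn (size p) (size q).
rewrite !(@pact_wide _ _ _ n) ?leq_maxl ?leq_maxr //; last first.
  by rewrite (leq_trans (size_polyD _ _)) // geq_max leq_maxr (leq_trans (size_scale_leq _ _)) ?leq_maxl.
rewrite scaler_sumr -big_split; apply: eq_bigr => i _ /=.
by rewrite coefD coefZ scalerDl scalerA.
Qed.

Lemma pact0 T v : pact T 0 v = 0.
Proof. by rewrite /pact size_poly0 big_ord0. Qed.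

Lemma pact_linear T p a u v : pact T p (a *: u + v) = a *: pact T p u + pact T p v.
Proof.
rewrite /pact scaler_sumr -big_split; apply: eq_bigr => i _ /=.
have -> : iter i T (a *: u + v) = a *: iter i T u + iter i T v.
  by elim: (i : nat) => //= n ->; rewrite linearP.
by rewrite scalerDr !scalerA mulrC.
Qed.

Lemma pactMX T p v : pact T (p * 'X) v = pact T p (T v).
Proof.
rewrite (@pact_wide _ _ _ (size p).+1); last first.
  by have [->|p0] := eqVneq p 0; rewrite ?mul0r ?size_poly0 // size_mulX.
rewrite big_ord_recl coefMX eqxx scale0r add0r.
by apply: eq_bigr => i _; rewrite coefMX /= -iterS iterSr.
Qed.

Lemma pactC T c v : pact T c%:P v = c *: v.
Proof.
rewrite (@pact_wide _ _ _ 1) ?size_polyC ?leq_b1 // big_ord1 coefC eqxx //.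
Qed.

Lemma pactD T p q v : pact T (p + q) v = pact T p v + pact T q v.
Proof. by rewrite -[p]scale1r pactP !scale1r. Qed.

Lemma pactZ T a p v : pact T (a *: p) v = a *: pact T p v.
Proof. by rewrite -[a *: p]addr0 pactP pact0 addr0. Qed.

Lemma pactM T p q v : pact T (p * q) v = pact T p (pact T q v).
Proof.
elim/poly_ind: p v => [|p c IH] v; first by rewrite mul0r !pact0.
have E : pact T q (T v) = T (pact T q v).
  by rewrite /pact linear_sum; apply: eq_bigr => i _; rewrite linearZ /= -iterS iterSr.
have -> : (p * 'X + c%:P) * q = p * q * 'X + c *: q by rewrite mulrDl mulrAC mul_polyC.
by rewrite !pactD pactZ !pactMX pactC IH E.
Qed.

Lemma pactXsub T a v : pact T ('X - a%:P) v = T v - a *: v.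
Proof.
by rewrite -polyCN -['X]mul1r pactD pactMX !pactC scale1r scaleNr.
Qed.

Lemma pact_sum T I (r : seq I) (P : pred I) (F : I -> {poly K}) v :
  pact T (\sum_(i <- r | P i) F i) v = \sum_(i <- r | P i) pact T (F i) v.
Proof. by apply: (big_morph (pact T ^~ v)) => [p q|]; rewrite ?pactD ?pact0. Qed.

Lemma pact_stable T W p : subspace W -> (forall v, W v -> W (T v)) ->
  forall v, W v -> W (pact T p v).
Proof.
move=> sW TW v Wv; apply: subspace_sum => // i _; apply: subspaceZ => //.
by elim: (i : nat) => //= n; apply: TW.
Qed.

End LinearAlgebra.

(** * Eigenvectors and joint eigenfunctionals over an algebraically closed field *)

Section ClosedField.
Variables (K : numClosedFieldType) (V : lmodType K).
Implicit Types (S W G : set V) (T : {linear V -> V}).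

(* A nonzero polynomial in T that does not kill v modulo A splits into
   factors T - a, so one of them has to be non-injective modulo A. *)
Lemma pact_injective T (A X : set V) (p : {poly K}) v :
  subspace X -> (forall u, X u -> X (T u)) ->
  (forall a u, X u -> A (T u - a *: u) -> A u) -> subspace A ->
  p != 0 -> X v -> A (pact T p v) -> A v.
Proof.
move=> sX TX inj sA p0 Xv; have [rs E] := closed_field_poly_normal p.
have lp0 : lead_coef p != 0 by rewrite lead_coef_eq0.
rewrite E pactZ => Aq.
have {Aq} : A (pact T (\prod_(z <- rs) ('X - z%:P)) v).
  by rewrite -[pact _ _ _](scalerK lp0); exact: subspaceZ.
elim: rs {E} => [|r rs IH]; first by rewrite big_nil -polyC1 pactC scale1r.
rewrite big_cons pactM pactXsub => /inj H; apply: IH; apply: H.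
exact: pact_stable.
Qed.

(** The iterates of [v] are dependent, so a nonzero polynomial in [T] kills [v], and one of its
    linear factors is not injective. *)
Lemma exists_eigenvector T W n v : subspace W -> dimle W n ->
  (forall u, W u -> W (T u)) -> W v -> v <> 0 ->
  exists u a, [/\ W u, u <> 0 & T u = a *: u].
Proof.
move=> sW Wn TW Wv v0; apply: contrapT => H.
have Wi i : W (iter i T v) by elim: i => //= i; apply: TW.
have [c [i ci] c0] := Wn (fun i => iter i T v) (fun i => Wi i).
apply: v0.
pose p := \poly_(i < n.+1) c (inord i).
have cp (j : 'I_n.+1) : p`_j = c j by rewrite coef_poly ltn_ord inord_val.
apply: (@pact_injective T [set 0] W p v) => //.
- move=> a u Wu /= /eqP; rewrite subr_eq0 => /eqP Tu; apply: contrapT => u0.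
  by apply: H; exists u, a.
- exact: subspace_zero.
- by apply: contra_neq ci => p0; rewrite -cp p0 coef0.
- rewrite /= (pact_wide _ _ (size_poly _ _)) -[RHS]c0.
  by apply: eq_bigr => j _; rewrite cp.
Qed.

(* A commutative family of operators on a finitely generated module over an
   uncountable algebraically closed field has a joint eigenfunctional
   (Zorn's lemma and Dixmier's form of Schur's lemma). *)
Lemma joint_eigenfunctional (I : countType) (T : I -> {linear V -> V}) X (G : seq V) :
  uncountable_field K -> subspace X -> (forall i x, X x -> X (T i x)) ->
  (forall i j x, X x -> T i (T j x) = T j (T i x)) ->
  (forall g, g \in G -> X g) ->
  (forall N, subspace N -> (forall i x, N x -> N (T i x)) ->
     (forall g, g \in G -> N g) -> X `<=` N) ->
  (exists2 x, X x & x <> 0) ->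
  exists N v, [/\ subspace N, forall i x, N x -> N (T i x), X v, ~ N v &
    forall x, X x -> exists a, N (x - a *: v)].
Proof.
move=> uncK sX TX TC GX gen [x0 Xx0 x00].
pose stab N := subspace N /\ forall i x, N x -> N (T i x).
(* Properness is expressed by a missing generator: as [G] is finite, the union of a chain still
   misses one. *)
pose good N := [/\ stab N, N `<=` X & exists2 g, g \in G & ~ N g].
have good0 : good [set 0].
  split; [split; [exact: subspace_zero|by move=> i x ->; rewrite linear0]| |].
    by move=> x ->; exact: subspace0.
  apply: contrapT => H; apply: x00.
  have : [set 0] x0; last by [].
  apply: (gen [set 0]) => //; [exact: subspace_zero|by move=> i x ->; rewrite linear0|].
  by move=> g gG; apply: contrapT => ng; apply: H; exists g.
(* The alternative [set0] accounts for the empty chain, whose union is not a subspace. *)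
have [F FP Ftot|A [[A0|gA] maxA]] := @Zorn_bigcup V (fun N => N = set0 \/ good N).
- have [[N0 FN0 gN0]|H] := pselect (exists2 N, F N & good N); last first.
    left; apply/seteqP; split=> // x [N FN Nx].
    have [E|gN] := FP N FN; first by rewrite E in Nx.
    by case: H; exists N.
  right; have gF N x : F N -> N x -> good N.
    by move=> FN Nx; case: (FP N FN) => // E; rewrite E in Nx.
  split.
  + split; first split.
    * by exists N0 => //; case: gN0 => [[sN _] _ _]; exact: subspace0.
    * move=> a u v [N1 F1 N1u] [N2 F2 N2v].
      have [s12|s21] := Ftot _ _ F1 F2.
        by exists N2 => //; case: (gF _ _ F2 N2v) => [[[_ h] _] _ _]; apply: h => //; apply: s12.
      by exists N1 => //; case: (gF _ _ F1 N1u) => [[[_ h] _] _ _]; apply: h => //; apply: s21.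
    * move=> i x [N FN Nx]; exists N => //.
      by case: (gF _ _ FN Nx) => [[_ h] _ _]; apply: h.
  + by move=> x [N FN Nx]; case: (gF _ _ FN Nx) => [_ h _]; apply: h.
  + apply: contrapT => H.
    have {}H g : g \in G -> exists2 N, F N & N g.
      by move=> gG; apply: contrapT => h; apply: H; exists g.
    have [N FN GN] : exists2 N, F N & forall g, g \in G -> N g.
      elim: (G) H => [|g G' IH] H; first by exists N0.
      have [|N FN GN] := IH; first by move=> h hG; apply: H; rewrite inE hG orbT.
      have [N' FN' N'g] := H g (mem_head _ _).
      have [s12|s21] := Ftot _ _ FN FN'.
        by exists N' => // h; rewrite inE => /orP[/eqP ->|/GN /s12].
      by exists N => // h; rewrite inE => /orP[/eqP ->|/GN //]; exact: s21.
    by have [E|[_ _ [g /GN]]] := FP N FN; [case: gN0 => _ _ [g gG]; have := GN g gG; rewrite E|].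
- exfalso; apply: (maxA [set 0]); last by right.
  by rewrite A0; split=> // /(_ 0 erefl).
have [[sA TA] AX [g0 g0G Ag0]] := gA.
(* By maximality of [A], the quotient $X/A$ is simple over the algebra generated by the [T i]. *)
have dich B : stab B -> A `<=` B -> B `<=` X -> B `<=` A \/ X `<=` B.
  move=> [sB TB] AB BX; apply: contrapT => /not_orP[nBA nXB].
  apply: (maxA B); first by split.
  right; split=> //; apply: contrapT => H; apply: nXB; apply: gen => // g gG.
  by apply: contrapT => ng; apply: H; exists g.
have XgA g : g \in G -> X g by exact: GX.
(* Otherwise no $S-a$ vanishes on $X/A$, so each is bijective there by simplicity. The vectors
   $(S-a)^{-1}g_0$ lie in a space of countable dimension; a relation among finitely many of them,
   with denominators cleared, puts [g0] into [A]. *)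
have eig i : exists a, forall x, X x -> A (T i x - a *: x).
  apply: contrapT => H; pose S := T i.
  have linS a : exists S' : {linear V -> V}, forall x, S' x = S x - a *: x.
    have lin : linear (fun x => S x - a *: x).
      move=> b u v; rewrite linearP scalerDr opprD addrACA !scalerBr !scalerA.
      by rewrite mulrC.
    pose S' : {linear V -> V} := HB.pack (fun x => S x - a *: x)
      (GRing.isLinear.Build K V V *:%R (fun x => S x - a *: x) lin).
    by exists S'.
  have SX x : X x -> X (S x) by exact: TX.
  have SaX a x : X x -> X (S x - a *: x).
    by move=> Xx; apply: (subspaceB sX); [exact: SX|exact: subspaceZ].
  have SaC a j x : X x -> T j (S x - a *: x) = S (T j x) - a *: T j x.
    by move=> Xx; rewrite -!scaleNr [S x + _]addrC linearP addrC /S TC.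
  have inj a x : X x -> A (S x - a *: x) -> A x.
    have [S' S'E] := linS a.
    pose B := X `&` [set x | A (S x - a *: x)].
    have sB : stab B.
      split; first by apply: subspaceI => //=; under eq_set do rewrite -S'E; exact: subspace_preim.
      move=> j y [Xy /= Ay]; split; [exact: TX|by rewrite /= -SaC //; exact: TA].
    have [||BA Xx Ax|XB] := dich B sB.
    - move=> y Ay; split; [exact: AX|apply: (subspaceB sA); [exact: TA|exact: subspaceZ]].
    - by move=> y [].
    - by apply: BA.
    - by case: H; exists a => y /XB [].
  have surj a : exists2 u, X u & A (g0 - (S u - a *: u)).
    have [S' S'E] := linS a.
    pose B := [set x | X x /\ exists2 u, X u & A (x - (S u - a *: u))].
    suff XB : X `<=` B by have [_] := XB g0 (GX _ g0G).
    have sB : stab B.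
      split; first split.
      - split; first exact: subspace0.
        by exists 0; [exact: subspace0|rewrite -S'E linear0 subrr; exact: subspace0].
      - move=> b u v [Xu [u' Xu' Au]] [Xv [v' Xv' Av]]; split.
          by case: sX => _; apply.
        exists (b *: u' + v'); first by case: sX => _; apply.
        rewrite -S'E linearP !S'E opprD addrACA -scalerBr.
        by case: sA => _; apply.
      - move=> j x [Xx [u Xu Au]]; split; first exact: TX.
        exists (T j u); first exact: TX.
        by rewrite -SaC // -raddfB; exact: TA.
    have [||BA|//] := dich B sB.
    - move=> y Ay; split; [exact: AX|exists 0; first exact: subspace0].
      by rewrite -S'E linear0 subr0.
    - by move=> y [].
    - case: H; exists a => y Xy; apply: BA; split; first exact: SaX.
      by exists y => //; rewrite subrr; exact: subspace0.
  pose word (w : seq I) := foldr (fun j u => T j u) g0 w.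
  have Xw w : X (word w).
    by elim: w => [|j w IH] /=; [exact: GX|exact: TX].
  (* There are countably many words; the spans of those with code below [n] exhaust $X/A$. *)
  pose Sp n := span [set x | exists2 w : seq I, (pickle w < n)%N & x = word w].
  have Spm n m : (n <= m)%N -> Sp n `<=` Sp m.
    move=> nm; apply: span_mono => _ [w h ->]; exists w => //.
    exact: leq_trans nm.
  have XD x : X x -> exists n, exists2 z, Sp n z & A (x - z).
    pose D := [set x | X x /\ exists n, exists2 z, Sp n z & A (x - z)].
    suff XD : X `<=` D by move=> /XD [].
    have TSp j n z : Sp n z -> exists m, Sp m (T j z).
      elim/span_ind => [|a u v [m hm] [m' hm']|_ [w _ ->]].
      - by exists 0%N; rewrite linear0; exact: subspace0 (subspace_span _).
      - exists (maxn m m'); rewrite linearP;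
        case: (subspace_span [set x | exists2 w : seq I, (pickle w < maxn m m')%N & x =
          word w]) => _; apply.
          exact: (Spm _ _ (leq_maxl m m')).
        exact: (Spm _ _ (leq_maxr m m')).
      - by exists (pickle (j :: w)).+1; apply: sub_span; exists (j :: w).
    have sD : stab D.
      split; first split.
      - split; first exact: subspace0.
        by exists 0%N, 0; rewrite ?subrr; [exact: subspace0 (subspace_span _)|exact: subspace0].
      - move=> a u v [Xu [n [z nz Az]]] [Xv [m [y my Ay]]]; split.
          by case: sX => _; apply.
        exists (maxn n m), (a *: z + y).
          case: (subspace_span [set x | exists2 w : seq I, (pickle w < maxn n m)%N & x =
            word w]) => _; apply.
            exact: (Spm _ _ (leq_maxl n m)).
          exact: (Spm _ _ (leq_maxr n m)).
        by rewrite opprD addrACA -scalerBr; case: sA => _; apply.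
      - move=> j y [Xy [n [z nz Az]]]; split; first exact: TX.
        have [m mz] := TSp j n z nz; exists m, (T j z) => //.
        by rewrite -raddfB; exact: TA.
    have [||DA|//] := dich D sD.
    - move=> y Ay; split; [exact: AX|exists 0%N, 0; last by rewrite subr0].
      exact: subspace0 (subspace_span _).
    - by move=> y [].
    - case: Ag0; apply: DA; split; first exact: GX.
      exists (pickle ([::] : seq I)).+1, g0; last by rewrite subrr; exact: subspace0.
      by apply: sub_span; exists [::].
  have /choice[u Hu] : forall a, exists u, X u /\ A (g0 - (S u - a *: u)).
    by move=> a; have [u] := surj a; exists u.
  have /choice[f Hf] : forall a, exists n, exists2 z, Sp n z & A (u a - z).
    by move=> a; apply: XD; case: (Hu a).
  (* One stage contains, modulo [A], the vectors $(S-a)^{-1}g_0$ for more values of $a$ than there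
     are words spanning it. *)
  have [n Hn] := uncK f.
  pose gs := pmap (fun k => omap word (unpickle k : option (seq I))) (iota 0 n).
  have dimS : dimle (Sp n) (size gs).
    apply: dimle_span; apply: span_mono => _ [w wn ->] /=.
    rewrite mem_pmap; apply/mapP; exists (pickle w); first by rewrite mem_iota.
    by rewrite pickleK.
  have [s [us ss Ps]] := Hn (size gs).+1.
  have /choice[z Hz] : forall k : 'I_(size gs).+1, exists z, Sp n z /\ A (u s`_k - z).
    move=> k; have [z Sz Az] := Hf s`_k; exists z; split=> //.
    by apply: Spm Sz; apply: Ps; rewrite mem_nth // ss.
  have [c [k0 ck0] c0] := dimS z (fun k => (Hz k).1).
  (* The relation $\sum_k c_k(S-s_k)^{-1}g_0=0$ becomes $p(S)g_0=0$ modulo [A]. Here $p\neq0$, as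
     $p(s_{k_0})$ is $c_{k_0}$ times a product of nonzero differences. *)
  pose q (k : 'I_(size gs).+1) : {poly K} := \prod_(j | j != k) ('X - (s`_j)%:P).
  pose p : {poly K} := \sum_k c k *: q k.
  apply: Ag0; apply: (@pact_injective S A X p) => //; last first.
  - have -> : pact S p g0 = \sum_k c k *: pact S (q k) (g0 - (S (u s`_k) - s`_k *: u s`_k))
        + pact S (\prod_(j < (size gs).+1) ('X - (s`_j)%:P)) (\sum_k c k *: (u s`_k - z k)).
      have pl r x y a : pact S r (a *: x + y) = a *: pact S r x + pact S r y by exact: pact_linear.
      have pB r x y : pact S r (x - y) = pact S r x - pact S r y.
        by rewrite addrC -scaleN1r pl scaleN1r addrC.
      have -> : \sum_k c k *: (u s`_k - z k) = \sum_k c k *: u s`_k.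
        transitivity (\sum_k c k *: u s`_k - \sum_k c k *: z k); last by rewrite c0 subr0.
        by rewrite -sumrB; apply: eq_bigr => k _; rewrite scalerBr.
      have -> : forall r (F : 'I_(size gs).+1 ->
        V), pact S r (\sum_k c k *: F k) = \sum_k c k *: pact S r (F k).
        move=> r F; apply: (big_rec2 (fun u1 u2 => pact S r u1 = u2)).
          by have := pB r 0 0; rewrite !subrr.
        by move=> k u1 u2 _ <-; rewrite pl.
      rewrite -big_split pact_sum; apply: eq_bigr => k _ /=.
      rewrite pactZ -scalerDr pB (bigD1 k) //= mulrC pactM pactXsub -/(q k).
      by rewrite subrK.
    have sAA j x : A x -> A (pact S j x) by apply: pact_stable => //; exact: TA.
    apply: (subspaceD sA).
      by apply: (subspace_sum _ sA) => k _; apply: (subspaceZ _ sA); apply: sAA; case: (Hu s`_k).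
    by apply: sAA; apply: (subspace_sum _ sA) => k _; apply: (subspaceZ _ sA); case: (Hz k).
  - exact: GX.
  - apply/eqP => p0; move: ck0.
    have : p.[s`_k0] = 0 by rewrite p0 horner0.
    rewrite horner_sum (bigD1 k0) //= big1 => [|k kk0]; last first.
      rewrite hornerZ horner_prod (bigD1 k0) 1?eq_sym //= hornerXsubC subrr.
      by rewrite mul0r mulr0.
    rewrite addr0 hornerZ => /eqP; rewrite mulf_eq0 => /orP[->//|].
    rewrite horner_prod prodf_seq_eq0 => /hasP[j _ /andP[jk0]].
    rewrite hornerXsubC subr_eq0 nth_uniq ?ss //.
    by rewrite (eq_sym (k0 : nat)) -[_ == _]/(j == k0) (negbTE jk0).
exists A, g0; split=> //; first exact: GX.
have /choice[a Ha] := eig.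
(* Each [T i] is a scalar modulo [A], so [A] plus the line of [g0] is stable, hence all of [X]. *)
move=> x Xx; pose B := [set x | X x /\ exists b, A (x - b *: g0)].
have sB : stab B.
  split; first split.
  - by split; [exact: subspace0|exists 0; rewrite scale0r subr0; exact: subspace0].
  - move=> b u v [Xu [c Ac]] [Xv [d Ad]]; split; first by case: sX => _; apply.
    exists (b * c + d); rewrite scalerDl -scalerA opprD addrACA -scalerBr.
    by case: sA => _; apply.
  - move=> i y [Xy [c Ac]]; split; first exact: TX.
    exists (a i * c).
    have -> : T i y - (a i * c) *: g0 = (T i y - a i *: y) + a i *: (y - c *: g0).
      by rewrite scalerBr addrA subrK scalerA.
    by apply: (subspaceD sA); [exact: Ha|exact: subspaceZ].
have [||BA|XB] := dich B sB.
- by move=> y Ay; split; [exact: AX|exists 0; rewrite scale0r subr0].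
- by move=> y [].
- by case: Ag0; apply: BA; split; [exact: GX|exists 1; rewrite scale1r subrr; exact: subspace0].
- by have [] := XB x Xx.
Qed.

End ClosedField.

(** * Brackets of D(2,1,alpha) *)

Section SuperBracket.
Variables (K : numFieldType) (g : lieSuperalgebra K).
Implicit Types (x y z : g).
Local Notation "[ x ; y ]" := (bracket x y).
Local Notation even := (lie_part g false).
Local Notation odd := (lie_part g true).

Lemma bracket0r x : [x; 0] = 0.
Proof. by have := bracketBr 0 0 x; rewrite !subrr. Qed.
Lemma bracket0l x : [0; x] = 0.
Proof. by have := bracketBl 0 0 x; rewrite !subrr. Qed.
Lemma bracketZr c x y : [x; c *: y] = c *: [x; y].
Proof. by have := bracketPr c y 0 x; rewrite bracket0r !addr0. Qed.
Lemma bracketZl c x y : [c *: x; y] = c *: [x; y].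
Proof. by have := bracketPl c x 0 y; rewrite bracket0l !addr0. Qed.
Lemma bracketDr x y z : [x; y + z] = [x; y] + [x; z].
Proof. by have := bracketPr 1 y z x; rewrite !scale1r. Qed.
Lemma bracketDl x y z : [x + y; z] = [x; z] + [y; z].
Proof. by have := bracketPl 1 x y z; rewrite !scale1r. Qed.
Lemma bracket_oo x y : odd x -> odd y -> [x; y] = [y; x].
Proof. by move=> ox oy; rewrite (bracketC ox oy) expr1 scaleN1r opprK. Qed.
Lemma bracket_ev x y b : even x -> lie_part g b y -> [x; y] = - [y; x].
Proof. by move=> ex hy; rewrite (bracketC ex hy) expr0 scale1r. Qed.
Lemma bracket_oe x y : odd x -> even y -> [x; y] = - [y; x].
Proof. by move=> ex hy; rewrite (bracketC ex hy) expr0 scale1r. Qed.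

Lemma jacobi_oo x y z : odd x -> odd y -> [x; [y; z]] = [[x; y]; z] - [y; [x; z]].
Proof. by move=> ox oy; rewrite (bracketJ z ox oy) expr1 scaleN1r. Qed.
Lemma jacobi_e x y z b : even x -> lie_part g b y ->
  [x; [y; z]] = [[x; y]; z] + [y; [x; z]].
Proof. by move=> ex hy; rewrite (bracketJ z ex hy) expr0 scale1r. Qed.
Lemma bracket_eo x y : even x -> odd y -> odd [x; y].
Proof. by move=> ex oy; exact: (bracket_part ex oy). Qed.
Lemma bracket_ee x y : even x -> even y -> even [x; y].
Proof. by move=> ex oy; exact: (bracket_part ex oy). Qed.
Lemma bracket_oo_even x y : odd x -> odd y -> even [x; y].
Proof. by move=> ex oy; exact: (bracket_part ex oy). Qed.

Lemma partZ b c x : lie_part g b x -> lie_part g b (c *: x).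
Proof. exact: (subspaceZ _ (grading_sub (lie_grading g) b)). Qed.

End SuperBracket.

Definition sg (K : numFieldType) (b : bool) : K := if b then 1 else -1.

Lemma sg_neq0 (K : numFieldType) b : sg K b != 0.
Proof. by case: b; rewrite /sg ?oppr_eq0 oner_eq0. Qed.

Lemma sgN (K : numFieldType) b : sg K (~~ b) = - sg K b.
Proof. by case: b; rewrite /sg //= opprK. Qed.

Lemma sg2 (K : numFieldType) b : sg K b * sg K b = 1.
Proof. by case: b; rewrite /sg ?mulr1 ?mulrNN ?mulr1. Qed.

Definition cij (K : numFieldType) (c : 'I_3 -> K) (i j : 'I_3) : K :=
  if i == j then 0 else c i + c j.

Definition distinct (i j k : 'I_3) := [&& i != j, i != k & j != k].

Lemma distinctP (i j k : 'I_3) : distinct i j k -> [/\ i != j, i != k & j != k].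
Proof. by case/and3P. Qed.

Lemma distinct_swap (i j k : 'I_3) : distinct i j k -> distinct j i k.
Proof. by case/and3P=> h1 h2 h3; apply/and3P; split=> //; rewrite eq_sym. Qed.

Lemma distinct_rot (i j k : 'I_3) : distinct i j k -> distinct j k i.
Proof. by case/and3P=> h1 h2 h3; apply/and3P; split=> //; rewrite eq_sym. Qed.

Lemma third (i j : 'I_3) : i != j -> exists k, distinct i j k.
Proof.
case: i => [[|[|[|//]]] hi]; case: j => [[|[|[|//]]] hj] // _;
by [exists (@Ordinal 3 0 isT)|exists (@Ordinal 3 1 isT)|exists (@Ordinal 3 2 isT)].
Qed.

Lemma exists_neq (j : 'I_3) : exists i, j != i.
Proof.
by case: j => [[|[|[|//]]] hj]; [exists (@Ordinal 3 1 isT)|exists (@Ordinal 3 0 isT)..].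
Qed.

Lemma distinct_or (i j k l : 'I_3) : distinct i j k -> [\/ l = i, l = j | l = k].
Proof.
case: i => [[|[|[|//]]] hi]; case: j => [[|[|[|//]]] hj] //;
case: k => [[|[|[|//]]] hk] // _; case: l => [[|[|[|//]]] hl];
by [apply: Or31; apply: val_inj|apply: Or32; apply: val_inj|apply: Or33; apply: val_inj].
Qed.

(* The symmetric form of the relations of D(2,1,alpha): the Cartan matrix is
   a_ij = c_i + c_j off the diagonal with c_0 + c_1 + c_2 = 0, and e true i,
   e false i are the positive and negative simple root vectors e_i, f_i. *)
Record chevalley (K : numFieldType) (g : lieSuperalgebra K) := Chevalley {
  cc : 'I_3 -> K;
  ee : bool -> 'I_3 -> g;
  hh : 'I_3 -> g;
  cc_neq0 : forall i, cc i != 0;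
  cc_sum : forall i j k, distinct i j k -> cc i + cc j + cc k = 0;
  ee_odd : forall b i, lie_part g true (ee b i);
  ef_br : forall b i j, bracket (ee b i) (ee (~~ b) j) = (i == j)%:R *: hh i;
  he_br : forall b i j, bracket (hh i) (ee b j) = (sg K b * cij cc i j) *: ee b j;
  chev_gen : forall Q : bool -> set g, (forall b, subspace (Q b)) ->
    (forall b i, Q true (ee b i)) ->
    (forall a b x y, Q a x -> Q b y -> Q (a (+) b) (bracket x y)) ->
    forall x, exists x0 x1, [/\ Q false x0, Q true x1 & x = x0 + x1] }.

(* x true and x false have weight beta and - beta, where beta is the sum of the
   three simple roots. *)
Record d21 (K : numFieldType) (g : lieSuperalgebra K) := D21Basis {
  d21_chevalley :> chevalley g;
  xx : bool -> g;
  xx_odd : forall b, lie_part g true (xx b);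
  ee_sq : forall b i, bracket (ee d21_chevalley b i) (ee d21_chevalley b i) = 0;
  serre : forall b i j k, distinct i j k ->
    bracket (ee d21_chevalley b k) (bracket (ee d21_chevalley b i) (ee d21_chevalley b j)) =
    (sg K b * cc d21_chevalley k) *: xx b }.

(** * Brackets that follow from the Chevalley relations alone *)

Section ChevalleyTable.
Variables (K : numFieldType) (g : lieSuperalgebra K) (D : chevalley g).
Implicit Types (b : bool) (i j k : 'I_3).
Local Notation "[ x ; y ]" := (bracket x y).
Local Notation c := (cc D).
Local Notation e := (ee D).
Local Notation h := (hh D).
Local Notation even := (lie_part g false).
Local Notation odd := (lie_part g true).

Definition EE b i j : g := [e b i; e b j].
Local Notation E := EE.

Lemma cij_distinct i j k : distinct i j k -> cij c i j = - c k.
Proof.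
move=> d; have [ij _ _] := distinctP d.
by rewrite /cij (negbTE ij); apply/eqP; rewrite -addr_eq0 cc_sum.
Qed.

Lemma cijC i j : cij c i j = cij c j i.
Proof. by rewrite /cij eq_sym addrC. Qed.

Lemma EC b i j : E b i j = E b j i.
Proof. by apply: bracket_oo; exact: ee_odd. Qed.

Lemma E_even b i j : even (E b i j).
Proof. by apply: bracket_oo_even; exact: ee_odd. Qed.

Lemma h_even i : even (h i).
Proof.
rewrite -[h i]scale1r -[1]/((true)%:R : K) -(eqxx i) -(ef_br D true i i).
by apply: bracket_oo_even; exact: ee_odd.
Qed.

Lemma ef_ii b i : [e b i; e (~~ b) i] = h i.
Proof. by rewrite ef_br eqxx scale1r. Qed.

Lemma ef_ij b i j : i != j -> [e b i; e (~~ b) j] = 0.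
Proof. by move=> /negbTE ij; rewrite ef_br ij scale0r. Qed.

Lemma fe_ii b i : [e (~~ b) i; e b i] = h i.
Proof. by rewrite -{2}[b]negbK ef_ii. Qed.

Lemma fe_ij b i j : i != j -> [e (~~ b) i; e b j] = 0.
Proof. by move=> ij; rewrite -{2}[b]negbK ef_ij. Qed.

Lemma fE b i j : i != j -> [e (~~ b) i; E b i j] = (sg K b * cij c i j) *: e b j.
Proof.
move=> ij; rewrite jacobi_oo; try exact: ee_odd.
by rewrite fe_ii he_br fe_ij // bracket0r subr0.
Qed.

Lemma fE' b i j : i != j -> [e (~~ b) j; E b i j] = (sg K b * cij c i j) *: e b i.
Proof. by move=> ij; rewrite EC cijC fE // eq_sym. Qed.

Lemma fE0 b i j k : distinct i j k -> [e (~~ b) k; E b i j] = 0.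
Proof.
move=> d; have [ij ik jk] := distinctP d.
rewrite jacobi_oo; try exact: ee_odd.
by rewrite !fe_ij 1?eq_sym // bracket0l bracket0r subr0.
Qed.

Lemma hE b i j k : [h k; E b i j] = (sg K b * (cij c k i + cij c k j)) *: E b i j.
Proof.
rewrite (jacobi_e _ (h_even k) (ee_odd D b i)) !he_br bracketZl bracketZr.
by rewrite -scalerDl -mulrDr.
Qed.

Lemma sc_neq0 b k : sg K b * c k != 0.
Proof. by rewrite mulf_neq0 ?sg_neq0 ?cc_neq0. Qed.

Lemma scI b k (u v : g) : (sg K b * c k) *: u = (sg K b * c k) *: v -> u = v.
Proof. exact: (scalerI (sc_neq0 b k)). Qed.

Lemma hh0 i j : [h i; h j] = 0.
Proof.
rewrite -(ef_ii true j) (jacobi_e _ (h_even i) (ee_odd D _ j)) !he_br.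
rewrite bracketZl bracketZr -scalerDl [~~ true]/= /sg mulN1r mul1r subrr scale0r //.
Qed.

Lemma EE_complement b i j k i' j' : distinct i j k -> distinct i' j' k ->
  E b i' j' = E b i j.
Proof.
move=> d /distinctP[i'j' i'k j'k].
have [Ei|Ei|Ei] := distinct_or i' d; have [Ej|Ej|Ej] := distinct_or j' d; subst i' j';
  by rewrite ?eqxx in i'j' i'k j'k *; rewrite // EC.
Qed.

(** The shape of the cubic bracket survives only in the factor [c k]; this makes all cubic brackets
    proportional modulo the radical. *)
Lemma f_cubic b i j k i' j' l : distinct i j k -> distinct i' j' l ->
  [e (~~ b) l; [e b k; E b i j]] = (sg K b * c k) *: E b i' j'.
Proof.
move=> d d'; have d1 := distinct_rot d; have d2 := distinct_rot d1.
have [ij ik jk] := distinctP d.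
rewrite jacobi_oo; try exact: ee_odd.
have [El|El|El] := distinct_or l d; subst l.
- rewrite fe_ij // bracket0l sub0r fE // bracketZr (cij_distinct d).
  by rewrite mulrN scaleNr opprK (EE_complement b d1 d') EC.
- rewrite fe_ij // bracket0l sub0r fE' // bracketZr (cij_distinct d).
  by rewrite mulrN scaleNr opprK (EE_complement b d2 d').
- rewrite fe_ii fE0 // bracket0r subr0 hE (EE_complement b d d').
  rewrite (cij_distinct d2) cijC (cij_distinct d1); congr (_ * _ *: _).
  by have s := cc_sum D d; rewrite -[RHS](subr0 (c k)) -s; ring.
Qed.

End ChevalleyTable.

(** * Brackets that use the vanishing squares and the cubic relation *)

Section Table.
Variables (K : numFieldType) (g : lieSuperalgebra K) (D : d21 g).
Implicit Types (b : bool) (i j k : 'I_3).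
Local Notation "[ x ; y ]" := (bracket x y).
Local Notation c := (cc D).
Local Notation e := (ee D).
Local Notation h := (hh D).
Local Notation x := (xx D).
Local Notation even := (lie_part g false).
Local Notation odd := (lie_part g true).
Local Notation E := (EE D).

(** By the Jacobi identity $2\,\mathrm{ad}(e_i)^2=\mathrm{ad}[e_i,e_i]=0$. *)
Lemma eE0 b i j : [e b i; E b i j] = 0.
Proof.
rewrite /EE; have := jacobi_oo (e b j) (ee_odd D b i) (ee_odd D b i).
rewrite ee_sq bracket0l sub0r => /eqP; rewrite -addr_eq0 -mulr2n -scaler_nat.
by rewrite scaler_eq0 pnatr_eq0 => /eqP.
Qed.

Lemma eE b i j k : distinct i j k -> [e b k; E b i j] = (sg K b * c k) *: x b.
Proof. exact: serre. Qed.

Lemma fx b i j k : distinct i j k -> [e (~~ b) k; x b] = E b i j.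
Proof.
move=> d; apply: (@scI _ _ D b k); rewrite -bracketZr -(eE b d).
rewrite jacobi_oo; try exact: ee_odd.
rewrite fe_ii fE0 // bracket0r subr0 hE; congr (_ *: _); congr (_ * _).
have [ij ik jk] := distinctP d.
rewrite (cij_distinct D (distinct_rot (distinct_rot d))).
rewrite cijC (cij_distinct D (distinct_rot d)).
by rewrite -opprD; have s := cc_sum D d; rewrite -[in RHS](subr0 (c k)) -s; ring.
Qed.

Lemma xf b i j k : distinct i j k -> [x b; e (~~ b) k] = E b i j.
Proof. by move=> d; rewrite bracket_oo ?(fx _ d) //; [exact: xx_odd|exact: ee_odd]. Qed.

Lemma ex0 b k : [e b k; x b] = 0.
Proof.
have [j jk] := exists_neq k.
have [i d] := third jk.
have d' : distinct j i k by exact: distinct_rot.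
apply: (@scI _ _ D b k); rewrite scaler0 -bracketZr -(eE b d').
have := jacobi_oo (E b j i) (ee_odd D b k) (ee_odd D b k).
rewrite ee_sq bracket0l sub0r => /eqP; rewrite -addr_eq0 -mulr2n -scaler_nat.
by rewrite scaler_eq0 pnatr_eq0 => /eqP.
Qed.

Lemma xe0 b k : [x b; e b k] = 0.
Proof. by rewrite bracket_oo ?ex0 //; [exact: xx_odd|exact: ee_odd]. Qed.

Lemma xE0 b i j : [x b; E b i j] = 0.
Proof.
rewrite /EE jacobi_oo; [|exact: xx_odd|exact: ee_odd].
by rewrite !xe0 bracket0l bracket0r subr0.
Qed.

Lemma xF b i j k : distinct i j k ->
  [x b; E (~~ b) i j] = - (sg K b * c k) *: e b k.
Proof.
move=> d; have [ij ik jk] := distinctP d.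
have d1 : distinct j k i by exact: distinct_rot.
have d2 : distinct k i j by exact: distinct_rot.
rewrite /EE jacobi_oo; [|exact: xx_odd|exact: ee_odd].
rewrite (xf _ d1) (xf _ d2).
rewrite (bracket_ev (E_even D b j k) (ee_odd D _ j)) fE //.
rewrite (EC D b k i) fE // (cij_distinct D d1) cijC (cij_distinct D d2).
by rewrite -!scaleNr -scalerDl; congr (_ *: _); have := cc_sum D d => s;
  rewrite -[in RHS](subr0 (c k)) -s; ring.
Qed.

Lemma xx0 b : [x b; x b] = 0.
Proof.
have d : distinct (@Ordinal 3 0 isT) (@Ordinal 3 1 isT) (@Ordinal 3 2 isT) by [].
apply: (@scI _ _ D b (@Ordinal 3 2 isT)); rewrite scaler0 -bracketZr -(eE b d).
rewrite jacobi_oo; [|exact: xx_odd|exact: ee_odd].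
by rewrite xe0 xE0 bracket0l bracket0r subr0.
Qed.

Lemma Ee0 b i j : [E b i j; e b i] = 0.
Proof. by rewrite (bracket_ev (E_even D b i j) (ee_odd D _ i)) eE0 oppr0. Qed.
Lemma Ee0' b i j : [E b i j; e b j] = 0.
Proof. by rewrite EC Ee0. Qed.
Lemma Ee b i j k : distinct i j k -> [E b i j; e b k] = - (sg K b * c k) *: x b.
Proof. by move=> d; rewrite (bracket_ev (E_even D b i j) (ee_odd D _ k)) eE // scaleNr. Qed.
Lemma Ef b i j : i != j -> [E b i j; e (~~ b) i] = - (sg K b * cij c i j) *: e b j.
Proof. by move=> d; rewrite (bracket_ev (E_even D b i j) (ee_odd D _ i)) fE // scaleNr. Qed.
Lemma Ef' b i j : i != j -> [E b i j; e (~~ b) j] = - (sg K b * cij c i j) *: e b i.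
Proof. by move=> d; rewrite EC cijC Ef // eq_sym. Qed.
Lemma Ef0 b i j k : distinct i j k -> [E b i j; e (~~ b) k] = 0.
Proof. by move=> d; rewrite (bracket_ev (E_even D b i j) (ee_odd D _ k)) fE0 // oppr0. Qed.
Lemma Ex0 b i j : [E b i j; x b] = 0.
Proof. by rewrite (bracket_ev (E_even D b i j) (xx_odd D b)) xE0 oppr0. Qed.
Lemma Fx b i j k : distinct i j k -> [E (~~ b) i j; x b] = (sg K b * c k) *: e b k.
Proof.
by move=> d; rewrite (bracket_ev (E_even D (~~ b) i j) (xx_odd D b)) (xF _ d) scaleNr opprK.
Qed.
Lemma Ey b i j k : distinct i j k -> [E b i j; x (~~ b)] = - (sg K b * c k) *: e (~~ b) k.
Proof. by move=> d; rewrite -{1}[b]negbK (Fx _ d) sgN mulNr. Qed.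

Lemma EF b i j k : distinct i j k -> [E b i j; E (~~ b) i j] = (sg K b * c k) *: (h i + h j).
Proof.
move=> d; have [ij ik jk] := distinctP d.
rewrite {2}/EE (jacobi_e _ (E_even D b i j) (ee_odd D _ i)) Ef // Ef' //.
rewrite bracketZl bracketZr ef_ii fe_ii (cij_distinct D d) -scalerDr addrC.
by rewrite mulrN opprK.
Qed.

Lemma EE0 b i j k : distinct i j k -> [E b i j; E b i k] = 0.
Proof.
move=> d; rewrite {2}/EE (jacobi_e _ (E_even D b i j) (ee_odd D _ i)) Ee0 bracket0l add0r.
by rewrite Ee // bracketZr ex0 scaler0.
Qed.

Lemma EF0 b i j k : distinct i j k -> [E b i j; E (~~ b) i k] = 0.
Proof.
move=> d; have [ij ik jk] := distinctP d.
rewrite {2}/EE (jacobi_e _ (E_even D b i j) (ee_odd D _ i)) Ef // Ef0 // bracket0r addr0.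
by rewrite bracketZl ef_ij // scaler0.
Qed.

Lemma xy b : [x b; x (~~ b)] =
  - (h (@Ordinal 3 0 isT) + h (@Ordinal 3 1 isT) + h (@Ordinal 3 2 isT)).
Proof.
have d : distinct (@Ordinal 3 0 isT) (@Ordinal 3 1 isT) (@Ordinal 3 2 isT) by [].
set i := Ordinal _ in d *; set j := Ordinal _ in d *; set k := Ordinal _ in d *.
apply: (@scI _ _ D (~~ b) k); rewrite -bracketZr -(eE (~~ b) d).
rewrite jacobi_oo; [|exact: xx_odd|exact: ee_odd].
rewrite (xf _ d) (xF _ d) (EF _ d) bracketZr fe_ii sgN scaleNr opprK.
by rewrite mulNr scaleNr scalerN opprK [in RHS]scalerDr.
Qed.

Lemma hx b i : [h i; x b] = (sg K b * \sum_j cij c i j) *: x b.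
Proof.
have d : distinct (@Ordinal 3 0 isT) (@Ordinal 3 1 isT) (@Ordinal 3 2 isT) by [].
rewrite -[\sum_j _]/(\sum_(j < 3) _) 3!big_ord_recr big_ord0 /= add0r.
set i0 := widen_ord _ _; set i1 := widen_ord _ _; set i2 := ord_max.
have -> : i0 = @Ordinal 3 0 isT by exact: val_inj.
have -> : i1 = @Ordinal 3 1 isT by exact: val_inj.
have -> : i2 = @Ordinal 3 2 isT by exact: val_inj.
move: d; set j0 := Ordinal _; set j1 := Ordinal _; set j2 := Ordinal _ => d.
apply: (@scI _ _ D b j2); rewrite -bracketZr -(eE b d).
rewrite (jacobi_e _ (h_even D i) (ee_odd D _ j2)) hE he_br bracketZl bracketZr (eE b d).
by rewrite -scalerDl !scalerA; congr (_ *: _); ring.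
Qed.

End Table.

Lemma big_I3 (R : Type) (idx : R) (op : Monoid.com_law idx) (F : 'I_3 -> R) i j k :
  distinct i j k -> \big[op/idx]_l F l = op (F i) (op (F j) (F k)).
Proof.
move=> d; have [ij ik jk] := distinctP d.
rewrite (bigD1 i) //= (bigD1 j) 1?eq_sym //= (bigD1 k) /=; last first.
  by rewrite ![k == _]eq_sym ik jk.
rewrite big1 ?Monoid.mulm1 // => l /andP[/andP[li lj] lk].
by have [E|E|E] := distinct_or l d; subst l; rewrite eqxx in li lj lk.
Qed.

(** * Relations in the contragredient Lie superalgebra *)

Section Singular.
Variables (K : numFieldType) (g : lieSuperalgebra K) (C : chevalley g).
Local Notation "[ x ; y ]" := (bracket x y).
Local Notation e := (ee C).
Local Notation h := (hh C).

(* A singular vector u of positive height for b (of negative height for ~~ b)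
   generates the ideal spanned by the ad(e b i_1) ... ad(e b i_m) u, on which
   the height element rho has no eigenvalue 0. *)
Lemma radical_singular (H : set g) (rho u : g) (b p : bool) (w : 'I_3 -> K) (n : nat) :
  lie_part g false rho -> (forall z, H z -> [rho; z] = 0) ->
  (forall j, [rho; e b j] = sg K b *: e b j) ->
  lie_part g p u -> (forall j, [e (~~ b) j; u] = 0) -> (forall i, [h i; u] = w i *: u) ->
  [rho; u] = (sg K b * n.+1%:R) *: u -> radical H u.
Proof.
move=> erho Hrho rhoe pu fu hu rhou.
pose G (s : seq 'I_3) := foldr (fun i z => [e b i; z]) u s.
pose I := span (range G).
have sI : subspace I := subspace_span _.
have pG s : exists q, lie_part g q (G s).
  elim: s => [|i s [q IH]]; first by exists p.
  by exists (true (+) q); exact: (bracket_part (ee_odd C b i) IH).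
have hG s i : exists a, [h i; G s] = a *: G s.
  elim: s => [|j s [a IH]]; first by exists (w i).
  exists (sg K b * cij (cc C) i j + a) => /=.
  rewrite (jacobi_e _ (h_even C i) (ee_odd C b j)) he_br IH bracketZl bracketZr.
  by rewrite -scalerDl.
have rG s : [rho; G s] = (sg K b * (n + size s).+1%:R) *: G s.
  elim: s => [|j s IH] /=; first by rewrite addn0.
  rewrite (jacobi_e _ erho (ee_odd C b j)) rhoe IH bracketZl bracketZr -scalerDl.
  by rewrite addnS [(_.+2)%:R]mulrS mulrDr mulr1.
have preim x : subspace [set z | I [x; z]].
  split=> [|a z z'] /=; first by rewrite bracket0r; exact: subspace0.
  by rewrite bracketPr; case: sI => _; apply.
have eI i z : I z -> I [e b i; z].
  apply: (span_min (preim _)) => _ [s _ <-] /=.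
  by apply: sub_span; exists (i :: s).
have fI j z : I z -> I [e (~~ b) j; z].
  apply: (span_min (preim _)) => _ [s _ <-] /=.
  elim: s => [|i s IH] /=; first by rewrite fu; exact: subspace0.
  rewrite jacobi_oo; try exact: ee_odd.
  apply: (subspaceB sI); last exact: eI.
  rewrite -{2}[b]negbK ef_br bracketZl; have [a ->] := hG s j.
  by do 2!apply: (subspaceZ _ sI); apply: sub_span; exists s.
have Iu : I u by apply: sub_span; exists [::].
have idI : lie_ideal I.
  split=> //.
    by apply: (graded_span (lie_grading g)) => _ [s _ <-].
  move=> x y Iy.
  (* Elements whose adjoint action preserves [I] are closed under brackets and include all simple
     root vectors. *)
  pose Q q := lie_part g q `&` [set z | forall y, I y -> I [z; y]].
  have [|||x0 [x1 [[_ X0] [_ X1] ->]]] := @chev_gen _ _ C Q _ _ _ x.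
  - move=> q; apply: subspaceI; first exact: grading_sub (lie_grading g) q.
    split=> [z Iz|a z z' Hz Hz' t It] /=; first by rewrite bracket0l; exact: subspace0.
    by rewrite bracketPl; case: sI => _; apply; [exact: Hz|exact: Hz'].
  - move=> b' i; split; first exact: ee_odd.
    have [->|->] : b' = b \/ b' = ~~ b by case: (b') (b) => [] []; auto.
      exact: eI.
    exact: fI.
  - move=> q r z z' [qz Hz] [rz' Hz']; split; first exact: bracket_part.
    move=> t It; have -> : [[z; z']; t] = [z; [z'; t]] - (-1) ^+ (q && r) *: [z'; [z; t]].
      by rewrite (bracketJ t qz rz') addrK.
    apply: (subspaceB sI); first by apply: Hz; apply: Hz'.
    by apply: (subspaceZ _ sI); apply: Hz'; apply: Hz.
  - by rewrite bracketDl; apply: (subspaceD sI); [exact: X0|exact: X1].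
move=> S sS; apply; last exact: Iu.
  exact: idI.
move=> z [Iz Hz] /=.
have lin : linear (bracket rho) by move=> a x y; exact: bracketPr.
pose T : {linear g -> g} :=
  HB.pack (bracket rho) (GRing.isLinear.Build K g g *:%R (bracket rho) lin).
have Tz : T z = 0 *: z by rewrite scale0r; exact: Hrho.
have TG x : range G x -> exists a, T x = a *: x.
  by move=> [s _ <-]; exists (sg K b * (n + size s).+1%:R); exact: rG.
have := span_eigen TG Iz Tz; apply: (span_min (subspace_zero _)).
move=> _ [[s _ <-]]; rewrite scale0r /T /= rG => /eqP.
rewrite scaler_eq0 mulf_eq0 pnatr_eq0 (negbTE (sg_neq0 _ _)) /=.
by move/eqP.
Qed.

(** The height element. Its coefficients solve $Ax=(1,1,1)$ for $a_{ij}=c_i+c_j$ off the diagonal: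
    the $j$-th equation reads $-(c_i+c_k)/c_j=1$. *)
Definition rho : g :=
  \sum_i (cc C i ^+ 2 / \prod_j cc C j) *: h i.

Lemma rho_even : lie_part g false rho.
Proof.
apply: subspace_sum => [|i _]; first exact: grading_sub (lie_grading g) false.
by apply: partZ; exact: h_even.
Qed.

Lemma rho_e b j : [rho; e b j] = sg K b *: e b j.
Proof.
rewrite (_ : [rho; e b j] = \sum_i [(cc C i ^+ 2 / \prod_j cc C j) *: h i; e b j]); last first.
  apply: (big_morph (fun z => [z; e b j])) => [x y|]; [exact: bracketDl|exact: bracket0l].
have [i0 ij] := exists_neq j.
have [k d] := third ij.
have [ji jk ik] := distinctP d.
set P := \prod_j _.
have PE : P = cc C j * (cc C i0 * cc C k) by exact: (big_I3 _ _ d).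
have P0 : P != 0 by rewrite PE !mulf_neq0 ?cc_neq0.
rewrite (big_I3 _ _ d) /= !bracketZl !he_br !scalerA -!scalerDl; congr (_ *: _).
rewrite {1}/cij eqxx (cijC C i0) (cijC C k) (cij_distinct C d).
have d' : distinct j k i0 by exact: distinct_rot (distinct_swap d).
rewrite (cij_distinct C d').
have ci : cc C j = - (cc C i0 + cc C k).
  by apply/eqP; rewrite -addr_eq0 addrA cc_sum.
have := P0; rewrite PE ci => P0'.
field.
by move: P0'; rewrite !mulf_eq0 !negb_or oppr_eq0 => /and3P[-> -> ->].
Qed.

Lemma rho_h i : [rho; h i] = 0.
Proof.
rewrite (_ : [rho; h i] = \sum_j [(cc C j ^+ 2 / \prod_j cc C j) *: h j; h i]); last first.
  by apply: (big_morph (fun z => [z; h i])) => [x y|]; [exact: bracketDl|exact: bracket0l].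
by rewrite big1 // => j _; rewrite bracketZl hh0 scaler0.
Qed.

(** Lowering $[e_i,e_i]$ gives a multiple of $[h_i,e_i]=a_{ii}e_i=0$, so it is singular. Its height
    is 2, passed as the successor of [1]. *)
Lemma radical_ee (H : set g) b i : (forall z, H z -> [rho; z] = 0) -> radical H [e b i; e b i].
Proof.
move=> Hrho.
have ei := ee_odd C b i.
apply: (@radical_singular H rho _ b false
  (fun k => 2%:R * (sg K b * cij (cc C) k i)) 1) => //.
- exact: rho_even.
- exact: rho_e.
- exact: (bracket_oo_even ei ei).
- move=> j; rewrite jacobi_oo //; last exact: ee_odd.
  have [->|ji] := eqVneq j i; last by rewrite !fe_ij // bracket0l bracket0r subrr.
  rewrite !fe_ii (bracket_oe ei (h_even C i)) he_br /cij eqxx mulr0 scale0r oppr0.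
  by rewrite subrr.
- move=> k; rewrite (jacobi_e _ (h_even C k) ei) he_br bracketZl bracketZr -scalerDl.
  by congr (_ *: _); ring.
- rewrite (jacobi_e _ rho_even ei) rho_e bracketZl bracketZr -scalerDl.
  by congr (_ *: _); ring.
Qed.

(** By [f_cubic], every lowering operator cancels the two terms; the combination is singular of
    height 3. *)
Lemma radical_serre (H : set g) b i j k i' j' k' : (forall z, H z -> [rho; z] = 0) ->
  distinct i j k -> distinct i' j' k' ->
  radical H (cc C k' *: [e b k; EE C b i j] - cc C k *: [e b k'; EE C b i' j']).
Proof.
move=> Hrho d d'.
apply: (@radical_singular H rho _ b true
  (fun l => sg K b * (cij (cc C) l i + cij (cc C) l j + cij (cc C) l k)) 2) => //.
- exact: rho_even.
- exact: rho_e.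
- apply: (subspaceB (grading_sub (lie_grading g) true)); apply: partZ;
  exact: (bracket_part (ee_odd C _ _) (E_even C _ _ _)).
- move=> l; have [m lm] := exists_neq l; have [n d1] := third lm.
  have d2 : distinct m n l by exact: distinct_rot.
  rewrite bracketBr !bracketZr (f_cubic C b d d2) (f_cubic C b d' d2) !scalerA.
  by rewrite -scalerBl [X in X *: _](_ : _ = 0) ?scale0r //; ring.
- move=> l; rewrite bracketBr !bracketZr.
  rewrite !(jacobi_e _ (h_even C l) (ee_odd C _ _)) !he_br !bracketZl !bracketZr.
  rewrite !bracketDr !bracketZr -!scalerDl scalerBr !scalerA.
  congr (_ *: _ - _ *: _); first by ring.
  have S i1 j1 k1 : distinct i1 j1 k1 ->
    cij (cc C) l i1 + cij (cc C) l j1 + cij (cc C) l k1 = \sum_m cij (cc C) l m.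
    by move=> d1; rewrite (big_I3 _ _ d1) /= addrA.
  by rewrite (S _ _ _ d) -(S _ _ _ d'); ring.
- rewrite bracketBr !bracketZr !(jacobi_e _ rho_even (ee_odd C _ _)) !rho_e.
  rewrite !bracketZl !bracketZr !bracketDr !bracketZr -!scalerDl scalerBr !scalerA.
  by congr (_ *: _ - _ *: _); ring.
Qed.

End Singular.

Section Contragredient.
Variables (K : numFieldType) (alpha : K).
Hypotheses (alpha_neq0 : alpha != 0) (alpha_neqN1 : alpha != -1).
Local Notation A := (D21_cartan alpha).
Local Notation P := (contra_pre A).
Local Notation pi t := (pre_pi A t : P).

(** The solution of $c_0+c_1=1$, $c_0+c_2=\alpha$, $c_1+c_2=-\alpha-1$. Its entries are all nonzero
    exactly when $\alpha\neq0,-1$. *)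
Definition d21_c (i : 'I_3) : K := nth 0 [:: 1 + alpha; - alpha; -1] i.

Lemma d21_c_neq0 i : d21_c i != 0.
Proof.
case: i => [[|[|[|//]]] ?]; rewrite /d21_c /= ?oppr_eq0 ?oner_eq0 //.
by rewrite addrC addr_eq0.
Qed.

Lemma d21_c_sum i j k : distinct i j k -> d21_c i + d21_c j + d21_c k = 0.
Proof.
case: i => [[|[|[|//]]] hi]; case: j => [[|[|[|//]]] hj] //;
case: k => [[|[|[|//]]] hk] // _; rewrite /d21_c /=; ring.
Qed.

Lemma D21_cartanE i j : A i j = cij d21_c i j.
Proof.
rewrite mxE /cij /d21_c; case: i => [[|[|[|//]]] hi]; case: j => [[|[|[|//]]] hj] //=;
by rewrite -?val_eqE /=; ring.
Qed.

Definition pre_e b i : P := pi (Tgen K (if b then Ge i else Gf i)).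
Definition pre_h i : P := pi (Tgen K (Gh i)).

Lemma pre_e_odd b i : lie_part P true (pre_e b i).
Proof.
rewrite /pre_e; case: b; eexists; try reflexivity.
  exact: (thom_gen K (Ge i)).
exact: (thom_gen K (Gf i)).
Qed.

Lemma pre_ef b i j : bracket (pre_e b i) (pre_e (~~ b) j) = (i == j)%:R *: pre_h i.
Proof.
have H i' j' : bracket (pre_e true i') (pre_e false j') = (i' == j')%:R *: pre_h i'.
  rewrite [LHS]pre_pi_bracket [RHS]pre_scaleE; apply/pre_piP; exact: teq_ef.
case: b; first exact: H.
rewrite bracket_oo; try exact: pre_e_odd.
by rewrite H eq_sym; case: eqP => [->|_] //; rewrite !scale0r.
Qed.

Lemma pre_he b i j : bracket (pre_h i) (pre_e b j) = (sg K b * cij d21_c i j) *: pre_e b j.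
Proof.
rewrite -D21_cartanE [LHS]pre_pi_bracket [RHS]pre_scaleE; apply/pre_piP.
by case: b; rewrite /sg ?mul1r ?mulN1r; [exact: teq_he|exact: teq_hf].
Qed.

Lemma pre_gen (Q : bool -> set P) : (forall b, subspace (Q b)) ->
  (forall b i, Q true (pre_e b i)) ->
  (forall a b x y, Q a x -> Q b y -> Q (a (+) b) (bracket x y)) ->
  forall x, exists x0 x1, [/\ Q false x0, Q true x1 & x = x0 + x1].
Proof.
move=> sQ Qe Qb; have Q0 b : Q b 0 by exact: subspace0.
have QZ b a x : Q b x -> Q b (a *: x) by exact: subspaceZ.
have QD b x y : Q b x -> Q b y -> Q b (x + y) by exact: subspaceD.
move=> x; elim/pre_ind: x; elim.
- case=> i.
  + by exists 0, (pre_e true i); split=> //; rewrite add0r.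
  + by exists 0, (pre_e false i); split=> //; rewrite add0r.
  + exists (pre_h i), 0; split=> //; last by rewrite addr0.
    have := pre_ef true i i; rewrite eqxx scale1r => <-.
    exact: (Qb true true).
- by exists 0, 0; split=> //; rewrite addr0.
- move=> s [s0 [s1 [S0 S1 Es]]] t [t0 [t1 [T0 T1 Et]]].
  exists (s0 + t0), (s1 + t1); split; [exact: QD|exact: QD|].
  by rewrite addrACA -Es -Et [RHS]pre_addE.
- move=> c s [s0 [s1 [S0 S1 Es]]].
  exists (c *: s0), (c *: s1); split; [exact: QZ|exact: QZ|].
  by rewrite -scalerDr -Es [RHS]pre_scaleE.
- move=> s [s0 [s1 [S0 S1 Es]]] t [t0 [t1 [T0 T1 Et]]].
  exists (bracket s0 t0 + bracket s1 t1), (bracket s0 t1 + bracket s1 t0); split.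
  + by apply: QD; [exact: (Qb false false)|exact: (Qb true true)].
  + by apply: QD; [exact: (Qb false true)|exact: (Qb true false)].
  + have -> : pre_pi A (Tbr s t) = bracket (pi s) (pi t) by rewrite [RHS]pre_pi_bracket.
    rewrite Es Et !bracketDl !bracketDr !addrA [LHS]addrAC.
    by congr (_ + _); rewrite addrAC.
Qed.

Definition pre_chevalley : chevalley P :=
  Chevalley d21_c_neq0 d21_c_sum pre_e_odd pre_ef pre_he pre_gen.

Local Notation C := pre_chevalley.
Local Notation H := (@pre_cartan K 3 A).
Local Notation idR := (radical_ideal H).
Local Notation q x := (quo_pi idR x : D21 alpha).

Lemma cartan_rho z : H z -> bracket (rho C) z = 0.
Proof.
move=> [x _ <-]; rewrite (_ : bracket _ _ =
  \sum_i bracket (rho C) (x 0 i *: (pi (Tgen K (Gh i))))); last first.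
  by apply: (big_morph (bracket (rho C))) => [y z'|]; [exact: bracketDr|exact: bracket0r].
by rewrite big1 // => i _; rewrite bracketZr (rho_h C i) scaler0.
Qed.

Lemma q_bracket x y : bracket (q x) (q y) = q (bracket x y).
Proof. exact: quo_pi_bracket. Qed.

Lemma qZ a x : a *: q x = q (a *: x).
Proof. exact: quo_piZ. Qed.

Lemma q_part b x : lie_part P b x -> lie_part (D21 alpha) b (q x).
Proof. by exists x. Qed.

Lemma q_eq x y : radical H (x - y) -> q x = q y.
Proof. by move=> h; apply/quo_piP. Qed.

Lemma q0 : q 0 = 0.
Proof. by rewrite -(scale0r 0) -qZ scale0r. Qed.

Definition D21_e b i : D21 alpha := q (pre_e b i).
Definition D21_h i : D21 alpha := q (pre_h i).

Lemma D21_e_odd b i : lie_part (D21 alpha) true (D21_e b i).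
Proof. by apply: q_part; exact: pre_e_odd. Qed.

Lemma D21_ef b i j : bracket (D21_e b i) (D21_e (~~ b) j) = (i == j)%:R *: D21_h i.
Proof. by rewrite q_bracket pre_ef qZ. Qed.

Lemma D21_he b i j : bracket (D21_h i) (D21_e b j) = (sg K b * cij d21_c i j) *: D21_e b j.
Proof. by rewrite q_bracket pre_he qZ. Qed.

Lemma D21_gen (Q : bool -> set (D21 alpha)) : (forall b, subspace (Q b)) ->
  (forall b i, Q true (D21_e b i)) ->
  (forall a b x y, Q a x -> Q b y -> Q (a (+) b) (bracket x y)) ->
  forall x, exists x0 x1, [/\ Q false x0, Q true x1 & x = x0 + x1].
Proof.
move=> sQ Qe Qb x; elim/quo_ind: x => x.
have [|//||x0 [x1 [Q0 Q1 ->]]] := @pre_gen (fun b y => Q b (q y)) _ _ _ x.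
- move=> b; split; first by rewrite q0; exact: subspace0.
  by move=> a u v Qu Qv; rewrite quo_piP'; case: (sQ b) => _; apply.
- by move=> a b y z Qy Qz; rewrite -q_bracket; exact: Qb.
- by exists (q x0), (q x1); split=> //; rewrite -quo_piD.
Qed.

Definition D21_chevalley : chevalley (D21 alpha) :=
  Chevalley d21_c_neq0 d21_c_sum D21_e_odd D21_ef D21_he D21_gen.

Local Notation i0 := (@Ordinal 3 0 isT).
Local Notation i1 := (@Ordinal 3 1 isT).
Local Notation i2 := (@Ordinal 3 2 isT).

(** Once divided by their factor $\pm c_k$ the cubic brackets agree, so the choice of the last index
    is immaterial. *)
Definition D21_x b : D21 alpha :=
  (sg K b * d21_c i2)^-1 *: bracket (D21_e b i2) (bracket (D21_e b i0) (D21_e b i1)).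

Lemma D21_x_odd b : lie_part (D21 alpha) true (D21_x b).
Proof.
apply: partZ; apply: (bracket_part (D21_e_odd _ _) (bracket_part (D21_e_odd _ _) (D21_e_odd _ _))).
Qed.

Lemma D21_ee b i : bracket (D21_e b i) (D21_e b i) = 0.
Proof.
rewrite q_bracket -q0; apply: q_eq; rewrite subr0.
exact: (radical_ee b i cartan_rho).
Qed.

Lemma D21_serre b i j k : distinct i j k ->
  bracket (D21_e b k) (bracket (D21_e b i) (D21_e b j)) = (sg K b * d21_c k) *: D21_x b.
Proof.
move=> d; have c2 := d21_c_neq0 i2.
apply: (scalerI c2); rewrite /D21_x !scalerA.
rewrite [X in _ = X *: _](_ : _ = d21_c k); last first.
  by field; rewrite sg_neq0 c2.
rewrite (q_bracket (pre_e b i) (pre_e b j)) (q_bracket (pre_e b i0) (pre_e b i1)).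
rewrite (q_bracket (pre_e b k)) (q_bracket (pre_e b i2)) !qZ; apply: q_eq.
exact: (radical_serre b cartan_rho d (isT : distinct i0 i1 i2)).
Qed.

Definition D21_d21 : d21 (D21 alpha) :=
  @D21Basis _ _ D21_chevalley D21_x D21_x_odd D21_ee D21_serre.

End Contragredient.

HB.instance Definition _ (K : numFieldType) (g : lieSuperalgebra K)
    (M : supermodule g) (u : g) :=
  GRing.isLinear.Build K M M *:%R (@act K g M u) (fun a => actPr a u).

(** * Weights and sl_2-strings *)

Section Action.
Variables (K : numFieldType) (g : lieSuperalgebra K) (M : supermodule g).
Implicit Types (u v : g) (m : M).
Local Notation "u *> m" := (act u m) (at level 35, right associativity).

Lemma act0l m : (0 : g) *> m = 0.
Proof. by have := actPl (-1) (0 : g) 0 m; rewrite scaler0 addr0 scaleN1r addNr. Qed.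
Lemma actDl u v m : (u + v) *> m = u *> m + v *> m.
Proof. by have := actPl 1 u v m; rewrite !scale1r. Qed.
Lemma actZl a u m : (a *: u) *> m = a *: (u *> m).
Proof. by rewrite -[a *: u]addr0 actPl act0l addr0. Qed.

Lemma actr0 u : u *> (0 : M) = 0. Proof. exact: linear0. Qed.
Lemma actDr u m m' : u *> (m + m') = u *> m + u *> m'. Proof. exact: linearD. Qed.
Lemma actZr u a m : u *> (a *: m) = a *: (u *> m). Proof. exact: linearZ. Qed.
Lemma actNr u m : u *> (- m) = - (u *> m). Proof. exact: linearN. Qed.
Lemma actBr u m m' : u *> (m - m') = u *> m - u *> m'. Proof. exact: linearB. Qed.

Lemma act_oo u v m : lie_part g true u -> lie_part g true v ->
  bracket u v *> m = u *> v *> m + v *> u *> m.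
Proof. by move=> ou ov; rewrite (act_bracket _ ou ov) expr1 scaleN1r opprK. Qed.
Lemma act_e u v m b : lie_part g false u -> lie_part g b v ->
  u *> v *> m = v *> u *> m + bracket u v *> m.
Proof. by move=> ou ov; rewrite (act_bracket _ ou ov) expr0 scale1r addrC subrK. Qed.

Lemma act_commute u v m b : lie_part g false u -> lie_part g b v -> bracket u v = 0 ->
  u *> v *> m = v *> u *> m.
Proof. by move=> ou ov uv; rewrite (act_e _ ou ov) uv act0l addr0. Qed.

Lemma act_span (G : set M) u : (forall z, G z -> span G (u *> z)) ->
  forall m, span G m -> span G (u *> m).
Proof. exact: (span_min (subspace_preim (act u) (subspace_span G))). Qed.

Lemma iter_commute (A B : M -> M) n m : (forall z, A (B z) = B (A z)) ->
  A (iter n B m) = iter n B (A m).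
Proof. by move=> AB; elim: n => //= n <-. Qed.

Lemma iter_act_linear n u : linear (iter n (act u : M -> M)).
Proof. by move=> a x y; elim: n => //= n ->; exact: actPr. Qed.

End Action.

Section Weights.
Variables (K : numFieldType) (g : lieSuperalgebra K) (D : d21 g).
Implicit Types (b : bool) (i j k f : 'I_3) (l r : {ffun 'I_3 -> K}).
Local Notation "[ x ; y ]" := (bracket x y).
Local Notation c := (cc D).
Local Notation e := (ee D).
Local Notation h := (hh D).
Local Notation x := (xx D).

Definition nxt k : 'I_3 := ordS k.

Lemma distinct_nxt k : distinct (nxt k) (nxt (nxt k)) k.
Proof. by case: k => [[|[|[|//]]] hk]. Qed.

(** A root vector of the $k$-th $\mathfrak{sl}_2$: its root is, up to sign, the sum of the two
    simple roots other than the $k$-th. *)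
Definition EV b k := EE D b (nxt k) (nxt (nxt k)).

Lemma EE_EV b i j k : distinct i j k -> EE D b i j = EV b k.
Proof. by move=> d; exact: EE_complement (distinct_nxt k) d. Qed.

Lemma EV_even b k : lie_part g false (EV b k). Proof. exact: E_even. Qed.

Lemma EV_comm b b' k k' : k != k' -> [EV b k; EV b' k'] = 0.
Proof.
move=> kk'; have [j d] := third kk'.
have d1 : distinct j k' k by exact: distinct_swap (distinct_rot d).
have d2 : distinct j k k' by exact: distinct_rot (distinct_rot d).
rewrite -(EE_EV b d1) -(EE_EV b' d2).
have [->|->] : b' = b \/ b' = ~~ b by case: (b') (b) => [] []; auto.
  exact: EE0 d1.
exact: EF0 d1.
Qed.

Lemma EV_self b k : [EV b k; EV (~~ b) k] = (sg K b * c k) *: (h (nxt k) + h (nxt (nxt k))).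
Proof. exact: (EF D b (distinct_nxt k)). Qed.

Definition has_root (u : g) r : Prop := forall i, [h i; u] = r i *: u.

Definition rt b i : {ffun 'I_3 -> K} := [ffun j => sg K b * cij c j i].
Definition ert b k : {ffun 'I_3 -> K} := rt b (nxt k) + rt b (nxt (nxt k)).
Definition xrt b : {ffun 'I_3 -> K} := \sum_i rt b i.

Lemma e_root b i : has_root (e b i) (rt b i).
Proof. by move=> j; rewrite he_br ffunE. Qed.

Lemma EV_root b k : has_root (EV b k) (ert b k).
Proof. by move=> j; rewrite hE !ffunE mulrDr. Qed.

Lemma x_root b : has_root (x b) (xrt b).
Proof.
by move=> j; rewrite hx sum_ffunE mulr_sumr; congr (_ *: _); apply: eq_bigr => i _; rewrite ffunE.
Qed.

(* Normalized so that the simple coroot of the k-th sl_2 pairs to 2 with its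
   root and to +-1 with every odd root. *)
Definition phi k r : K := - (r (nxt k) + r (nxt (nxt k))) / c k.

Lemma phiD k r r' : phi k (r + r') = phi k r + phi k r'.
Proof. by rewrite /phi !ffunE; field; exact: cc_neq0. Qed.

Lemma phi_mulz k r n : phi k (r *~ n) = n%:~R * phi k r.
Proof.
have phi0 : phi k 0 = 0 by rewrite /phi !ffunE addr0 oppr0 mul0r.
have H (m : nat) : phi k (r *+ m) = m%:R * phi k r.
  by elim: m => [|m IH]; rewrite ?mulr0n ?phi0 ?mul0r // !mulrS phiD IH mulrDl mul1r.
case: n => m; first by rewrite -!pmulrn H.
rewrite NegzE !mulrNz -!pmulrn.
have -> : phi k (- (r *+ m.+1)) = - phi k (r *+ m.+1) by rewrite /phi !ffunE; field; exact: cc_neq0.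
by rewrite H mulNr.
Qed.

Lemma phi_rt k b i : phi k (rt b i) = if i == k then - sg K b else sg K b.
Proof.
rewrite /phi !ffunE; have d := distinct_nxt k.
move: d; set i1 := nxt k; set i2 := nxt i1 => d; have [d12 d1k d2k] := distinctP d.
have ck := cc_neq0 D k; have s := cc_sum D d.
have [E|E|E] := distinct_or i d; subst i; rewrite ?eqxx.
- rewrite (negbTE d1k) /cij eqxx eq_sym (negbTE d12).
  have -> : c k = - (c i1 + c i2) by apply/eqP; rewrite -addr_eq0 addrC s.
  have : c i1 + c i2 != 0 by move: ck; apply: contra_neq => E; rewrite -s E add0r.
  by move=> n0; rewrite mulr0 add0r [c i2 + _]addrC invrN mulrNN mulfK.
- rewrite (negbTE d2k) /cij eqxx (negbTE d12).
  have -> : c k = - (c i1 + c i2) by apply/eqP; rewrite -addr_eq0 addrC s.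
  have : c i1 + c i2 != 0 by move: ck; apply: contra_neq => E; rewrite -s E add0r.
  by move=> n0; rewrite mulr0 addr0 invrN mulrNN mulfK.
- rewrite /cij (negbTE d1k) (negbTE d2k).
  have -> : sg K b * (c i1 + c k) + sg K b * (c i2 + c k) = sg K b * c k.
    by rewrite -[RHS]addr0 -(mulr0 (sg K b)) -s; ring.
  by field.
Qed.

Lemma phi_ert k b f : phi k (ert b f) = if f == k then 2%:R * sg K b else 0.
Proof.
rewrite /ert phiD !phi_rt; have d := distinct_nxt f; have [d12 d1 d2] := distinctP d.
have [E|E|E] := distinct_or k d; subst k.
- by rewrite eqxx eq_sym (negbTE d12) eq_sym (negbTE d1) addNr.
- by rewrite eqxx (negbTE d12) eq_sym (negbTE d2) addrN.
- by rewrite (negbTE d1) (negbTE d2) eqxx mulr_natl mulr2n.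
Qed.

Lemma phi_xrt k b : phi k (xrt b) = sg K b.
Proof.
have d := distinct_nxt k; rewrite /xrt (big_I3 _ _ d) /= !phiD !phi_rt eqxx.
by have [_ /negbTE-> /negbTE->] := distinctP d; rewrite subrr addr0.
Qed.

End Weights.

(** * Strings of weight vectors under the even root vectors *)

Section Ladders.
Variables (K : numFieldType) (g : lieSuperalgebra K) (D : d21 g) (M : supermodule g).
Implicit Types (b : bool) (i k f : 'I_3) (l r : {ffun 'I_3 -> K}) (m z : M).
Local Notation "[ x ; y ]" := (bracket x y).
Local Notation "u *> m" := (act u m) (at level 35, right associativity).
Local Notation c := (cc D).
Local Notation e := (ee D).
Local Notation h := (hh D).
Local Notation x := (xx D).
Local Notation EV := (EV D).

Definition wt l : set M := [set m | forall i, h i *> m = l i *: m].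

Lemma subspace_wt l : subspace (wt l).
Proof.
split=> [i|a u v Hu Hv i]; first by rewrite actr0 scaler0.
by rewrite actPr Hu Hv scalerDr !scalerA mulrC.
Qed.

Lemma wt_act u r b l m : lie_part g b u -> has_root D u r -> wt l m -> wt (r + l) (u *> m).
Proof.
move=> pu ur lm i; rewrite (act_e _ (h_even D i) pu) lm ur actZr actZl -scalerDl.
by rewrite ffunE addrC.
Qed.

(** The eigenvalue conditions are imposed for one [h i] after another, each time keeping the
    generators that satisfy them. *)
Lemma wt_span (G : set M) l z : (forall v, G v -> exists l', wt l' v) ->
  span G z -> wt l z -> span (G `&` wt l) z.
Proof.
move=> GW Gz lz.
pose G' (s : seq 'I_3) := [set v | G v /\ forall i, i \in s -> h i *> v = l i *: v].
suff H s : span (G' s) z.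
  apply: span_mono (H (enum 'I_3)) => v [Gv Hv]; split=> // i.
  by apply: Hv; rewrite mem_enum.
elim: s => [|i s IH].
  by apply: span_mono Gz => v Gv; split.
have ev v : G' s v -> exists a, act (h i) v = a *: v.
  by move=> [/GW[l' l'v] _]; exists (l' i); exact: l'v.
have := @span_eigen _ _ (act (h i) : {linear M -> M}) _ _ _ ev IH (lz i).
apply: span_mono => v [[Gv Hv] Ev]; split=> // i'.
by rewrite inE => /orP[/eqP ->|/Hv].
Qed.

Lemma wt_uniq l l' m : wt l m -> wt l' m -> m <> 0 -> l = l'.
Proof.
move=> H H' m0; apply/ffunP => i; apply/eqP; rewrite -subr_eq0.
have : (l i - l' i) *: m == 0 by rewrite scalerBl -H -H' subrr.
by rewrite scaler_eq0 => /orP[//|/eqP].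
Qed.

Lemma EV_swap b k l : exists a, forall m, wt l m ->
  EV b k *> EV (~~ b) k *> m = EV (~~ b) k *> EV b k *> m + a *: m.
Proof.
exists (sg K b * c k * (l (nxt k) + l (nxt (nxt k)))) => m lm.
rewrite (act_e _ (EV_even D b k) (EV_even D (~~ b) k)) (EV_self D b).
by rewrite actZl actDl !lm -scalerDl scalerA.
Qed.

Lemma EV_EV b b' k k' m : k != k' -> EV b k *> EV b' k' *> m = EV b' k' *> EV b k *> m.
Proof. by move=> kk'; apply: (act_commute _ (EV_even D b k) (EV_even D b' k')); exact: EV_comm. Qed.

Definition TT k : {linear M -> M} := act (EV true k) \o act (EV false k).

Lemma TTE k m : TT k m = EV true k *> EV false k *> m. Proof. by []. Qed.

Lemma TT_EV b k k' m : k != k' -> TT k (EV b k' *> m) = EV b k' *> TT k m.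
Proof. by move=> kk'; rewrite !TTE !(EV_EV _ _ _ kk'). Qed.

Lemma TT_comm k k' m : TT k (TT k' m) = TT k' (TT k m).
Proof. by have [->//|kk'] := eqVneq k k'; rewrite ![TT k' _]TTE !TT_EV. Qed.

Definition tstab (X : set M) k := forall z, X z -> X (TT k z).

Lemma tstab_swap X k l b z : subspace X -> X `<=` wt l -> tstab X k -> X z ->
  X (EV b k *> EV (~~ b) k *> z).
Proof.
move=> sX Xl TX Xz; case: b; first exact: TX.
have [a /(_ _ (Xl _ Xz)) ->] := EV_swap false k l.
by apply: (subspaceD sX); [exact: TX|exact: subspaceZ].
Qed.

Lemma wt_iter b k n l z : wt l z -> wt (ert D b k *+ n + l) (iter n (act (EV b k)) z).
Proof.
move=> lz; elim: n => [|n IH]; first by rewrite mulr0n add0r.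
by rewrite mulrS -addrA; apply: wt_act IH; [exact: EV_even|exact: EV_root].
Qed.

(** The opposite root vector is moved to the bottom of the string. Commutators are scalars on weight
    vectors, so only the bottom vector changes, within the [TT]-stable space [X]. *)
Lemma ladder_down b k X l n u : subspace X -> X `<=` wt l -> tstab X k -> X u ->
  exists2 u', X u' & EV (~~ b) k *> iter n.+1 (act (EV b k)) u = iter n (act (EV b k)) u'.
Proof.
move=> sX Xl TX Xu; elim: n => [|n [u' Xu' IH]].
  exists (EV (~~ b) k *> EV b k *> u) => //.
  by rewrite -{2}[b]negbK; exact: tstab_swap Xl _ _.
have [a /(_ _ (wt_iter b k n.+1 (Xl _ Xu))) Ea] := EV_swap (~~ b) k (ert D b k *+ n.+1 + l).
exists (u' + a *: u); first by apply: (subspaceD sX) => //; exact: subspaceZ.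
rewrite negbK in Ea; rewrite [iter n.+2 _ _]iterS Ea IH -iterS.
by rewrite [u' + _]addrC iter_act_linear addrC.
Qed.

Definition lad k (j : int) m : M :=
  if j is Posz n then iter n (act (EV true k)) m
  else iter `|j| (act (EV false k)) m.

Definition sgb b : int := if b then 1 else -1.

Lemma lad_step b k X l j u : subspace X -> X `<=` wt l -> tstab X k -> X u ->
  exists2 u', X u' & EV b k *> lad k j u = lad k (j + sgb b) u'.
Proof.
move=> sX Xl TX Xu; case: j => [n|n]; case: b; rewrite /sgb.
- by exists u => //; rewrite -PoszD addn1.
- case: n => [|n]; first by exists u.
  have [u' Xu' E] := ladder_down true n sX Xl TX Xu; exists u' => //.
  by rewrite [LHS]E -addn1 PoszD addrK.
- have [u' Xu' E] := ladder_down false n sX Xl TX Xu; exists u' => //.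
  by rewrite [LHS]E NegzE -[n.+1]addn1 PoszD opprD addrNK; case: (n).
- by exists u => //; rewrite NegzE -opprD -PoszD addn1.
Qed.

Lemma lad_linear k j : linear (lad k j).
Proof. by case: j => n; exact: iter_act_linear. Qed.

Lemma lad_commute k j (A : M -> M) m : (forall b z, A (EV b k *> z) = EV b k *> A z) ->
  A (lad k j m) = lad k j (A m).
Proof. by move=> H; case: j => n; apply: (@iter_commute _ _ _ A (act _)) => z; exact: H. Qed.

Lemma ertN b k : ert D (~~ b) k = - ert D b k.
Proof. by apply/ffunP => i; rewrite !ffunE sgN; ring. Qed.

Lemma wt_lad k j l m : wt l m -> wt (ert D true k *~ j + l) (lad k j m).
Proof.
move=> lm; case: j => n; first by rewrite -pmulrn; exact: wt_iter.
by rewrite NegzE mulrNz -pmulrn -mulNrn -(ertN true); exact: wt_iter.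
Qed.

(** Passing [TT] across a root vector of its own $\mathfrak{sl}_2$ costs a scalar fixed by the
    weight. So [TT]-stability can be pulled back along a string. *)
Lemma TT_lad k j l : exists a, forall m, wt l m ->
  TT k (lad k j m) = lad k j (TT k m) + a *: lad k j m.
Proof.
suff H b n : exists a, forall m, wt l m ->
    TT k (iter n (act (EV b k)) m) = iter n (act (EV b k)) (TT k m) + a *: iter n (act (EV b k)) m.
  by case: j => n; exact: H.
elim: n => [|n [a IH]]; first by exists 0 => m _; rewrite scale0r addr0.
have [d Hd] := EV_swap true k (ert D b k *+ n + l).
have [d' Hd'] := EV_swap true k (ert D b k + (ert D b k *+ n + l)).
exists (a + if b then - d else d') => m lm /=; set z := iter n _ m.
have lz : wt (ert D b k *+ n + l) z by exact: wt_iter.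
have lz' : wt (ert D b k + (ert D b k *+ n + l)) (EV b k *> z).
  by apply: wt_act lz; [exact: EV_even|exact: EV_root].
rewrite scalerDl addrA.
have -> : EV b k *> iter n (act (EV b k)) (TT k m) + a *: EV b k *> z = EV b k *> TT k z.
  by rewrite IH // actDr actZr.
clearbody z; case: b {IH} Hd Hd' z lz lz' => Hd Hd' z lz lz'; rewrite !TTE.
- by rewrite (Hd _ lz) actDr actZr scaleNr addrK.
- by rewrite (Hd' _ lz').
Qed.

Definition ladn (fs : seq 'I_3) (j : 'I_3 -> int) m : M := foldr (fun k z => lad k (j k) z) m fs.

Lemma ladn_linear fs j : linear (ladn fs j).
Proof. by move=> a u v; elim: fs => //= k fs ->; exact: lad_linear. Qed.

Lemma ladn_commute fs j (A : M -> M) m :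
  (forall k b z, k \in fs -> A (EV b k *> z) = EV b k *> A z) ->
  A (ladn fs j m) = ladn fs j (A m).
Proof.
elim: fs => //= k fs IH H; rewrite lad_commute; last by move=> b z; apply: H; exact: mem_head.
by rewrite IH // => k' b z k'fs; apply: H; rewrite inE k'fs orbT.
Qed.

Lemma wt_ladn fs j l m : wt l m -> wt (\sum_(k <- fs) ert D true k *~ j k + l) (ladn fs j m).
Proof.
move=> lm; elim: fs => [|k fs IH] /=; first by rewrite big_nil add0r.
by rewrite big_cons -addrA; exact: wt_lad.
Qed.

Lemma ladn_EV fs j b k m : k \notin fs -> EV b k *> ladn fs j m = ladn fs j (EV b k *> m).
Proof.
move=> kfs; apply: (@ladn_commute fs j (act (EV b k))) => k' b' z k'fs.
by apply: EV_EV; apply: contraNneq kfs => ->.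
Qed.

Lemma ladn_TT fs j k m : k \notin fs -> TT k (ladn fs j m) = ladn fs j (TT k m).
Proof. by move=> kfs; rewrite !TTE !ladn_EV. Qed.

Lemma ladn_step fs j b k X l u : uniq fs -> k \in fs -> subspace X -> X `<=` wt l ->
  (forall k', k' \in fs -> tstab X k') -> X u ->
  exists j', exists2 u', X u' & EV b k *> ladn fs j u = ladn fs j' u'.
Proof.
move=> ufs kfs sX Xl TX Xu.
exists (fun k' => if k' == k then j k + sgb b else j k').
elim: fs ufs kfs TX => //= k0 fs IH /andP[k0fs ufs]; rewrite inE => kk0 TX.
have [E|ne] := eqVneq k0 k.
  (* The vectors already moved in the remaining directions serve as the bottom space of the string
     in direction [k]. *)
  subst k0; pose X' : set M := ladn fs j @` X.
  have ll : linear (ladn fs j) by exact: ladn_linear.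
  have sX' : subspace X'.
    split; first by exists 0; [exact: subspace0|have := ll (-1) 0 0;
      rewrite scaler0 addr0 scaleN1r addNr].
    move=> a _ _ [z Xz <-] [y Xy <-]; exists (a *: z + y); last exact: ll.
    by case: sX => _; apply.
  have X'l : X' `<=` wt (\sum_(k <- fs) ert D true k *~ j k + l).
    by move=> _ [z Xz <-]; apply: wt_ladn; exact: Xl.
  have TX' : tstab X' k.
    move=> _ [z Xz <-]; exists (TT k z); last by rewrite ladn_TT.
    by apply: TX => //; exact: mem_head.
  have [|_ [u' Xu' <-] E] := @lad_step b k X' _ (j k) (ladn fs j u) sX' X'l TX'.
    by exists u.
  exists u' => //; rewrite E; congr (lad _ _ _).
  elim: (fs) k0fs => //= k1 fs' IH'; rewrite inE negb_or => /andP[/negbTE kk1 /IH' ->].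
  by rewrite eq_sym kk1.
have [|u' Xu' E] := IH ufs _ (fun k' h => TX k' (@mem_behead _ (k0 :: fs) k' h)).
  by move: kk0; rewrite eq_sym (negbTE ne).
exists u' => //; rewrite -E.
by apply: (@lad_commute k0 (j k0) (act (EV b k))) => b' z; apply: EV_EV; rewrite eq_sym.
Qed.

Lemma TT_ladn fs j k l : uniq fs -> exists a, forall m, wt l m ->
  TT k (ladn fs j m) = ladn fs j (TT k m) + a *: ladn fs j m.
Proof.
elim: fs => [|k0 fs IH]; first by exists 0 => m _; rewrite scale0r addr0.
rewrite cons_uniq => /andP[k0fs ufs].
have E m : ladn (k0 :: fs) j m = lad k0 (j k0) (ladn fs j m) by [].
have [E0|ne] := eqVneq k0 k.
  subst k0; have [a Ha] := TT_lad k (j k) (\sum_(k <- fs) ert D true k *~ j k + l).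
  by exists a => m lm; rewrite !E Ha ?ladn_TT //; exact: wt_ladn.
have [a Ha] := IH ufs; exists a => m lm; rewrite !E.
rewrite (@lad_commute k0 (j k0) (TT k)) ?Ha //.
  by rewrite [ladn fs j (TT k m) + _]addrC lad_linear addrC.
by move=> b z; rewrite TT_EV // eq_sym.
Qed.

End Ladders.

(** * Finite-dimensionality of the weight spaces *)

Section FinitelyGenerated.
Variables (K : numFieldType) (g : lieSuperalgebra K) (D : d21 g) (M : supermodule g).
Implicit Types (b : bool) (i k f : 'I_3) (l r : {ffun 'I_3 -> K}) (m z : M).
Local Notation "[ x ; y ]" := (bracket x y).
Local Notation "u *> m" := (act u m) (at level 35, right associativity).
Local Notation c := (cc D).
Local Notation e := (ee D).
Local Notation h := (hh D).
Local Notation x := (xx D).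
Local Notation EV := (EV D).

Lemma act_stable (S : set M) : subspace S -> (forall b i z, S z -> S (e b i *> z)) ->
  forall u z, S z -> S (u *> z).
Proof.
move=> sS eS u z Sz.
pose Q p := lie_part g p `&` [set v | forall z, S z -> S (v *> z)].
have [|||u0 [u1 [[_ H0] [_ H1] ->]]] := @chev_gen _ _ D Q _ _ _ u.
- move=> p; apply: subspaceI; first exact: grading_sub (lie_grading g) p.
  split=> [y Sy|a v w Hv Hw y Sy] /=; first by rewrite act0l; exact: subspace0.
  by rewrite actPl; case: sS => _; apply; [exact: Hv|exact: Hw].
- by move=> b i; split; [exact: ee_odd|move=> y; exact: eS].
- move=> p q v w [pv Hv] [qw Hw]; split; first exact: bracket_part.
  move=> y Sy /=; rewrite (act_bracket _ pv qw); apply: (subspaceB sS).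
    by apply: Hv; apply: Hw.
  by apply: (subspaceZ _ sS); apply: Hw; apply: Hv.
- by rewrite actDl; apply: (subspaceD sS); [exact: H0|exact: H1].
Qed.

(** [S] may fail to be graded; the submodule generated by the homogeneous [m] is graded and lies in
    [S]. *)
Lemma simple_full (S : set M) p m : simple_module M -> subspace S ->
  (forall b i z, S z -> S (e b i *> z)) -> mod_part M p m -> m <> 0 -> S m ->
  forall z, S z.
Proof.
move=> [_ simM] sS eS pm m0 Sm z.
pose G := range (fun s : seq (bool * 'I_3) => foldr (fun bi z => e bi.1 bi.2 *> z) m s).
have GS : span G `<=` S.
  by apply: span_min => // _ [s _ <-]; elim: s => //= -[b i] s; exact: eS.
have eG b i y : span G y -> span G (e b i *> y).
  by apply: act_span => _ [s _ <-]; apply: sub_span; exists ((b, i) :: s).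
have subG : submodule (span G).
  split; [exact: subspace_span| |].
    apply: (graded_span (mod_grading M)) => _ [s _ <-].
    elim: s => [|[b i] s [q IH]]; first by exists p.
    by exists (true (+) q); apply: act_part IH; exact: ee_odd.
  by move=> u y; apply: act_stable => //; exact: subspace_span.
have Gm : span G m by apply: sub_span; exists [::].
have [E|E] := simM _ subG; last by apply: GS; rewrite E.
by case: m0; rewrite E in Gm.
Qed.

(** Indexes the eight odd roots: [Some i] stands for $\pm\beta_i$ and [None] for
    $\pm(\beta_1+\beta_2+\beta_3)$. *)
Definition oddix : Type := bool * option 'I_3.
Definition od (o : oddix) : g := if o.2 is Some i then e o.1 i else x o.1.

Lemma od_odd o : lie_part g true (od o).
Proof. by case: o => b [i|]; [exact: ee_odd|exact: xx_odd]. Qed.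

Definition ort (o : oddix) := if o.2 is Some i then rt D o.1 i else xrt D o.1.

Lemma od_root o : has_root D (od o) (ort o).
Proof. by case: o => b [i|]; [exact: e_root|exact: x_root]. Qed.

Lemma bool_or b b' : b' = b \/ b' = ~~ b.
Proof. by case: b b' => [] []; auto. Qed.

Lemma EV_od b k o : exists a o', [EV b k; od o] = a *: od o'.
Proof.
have d := distinct_nxt k; have [d12 d1 d2] := distinctP d.
case: o => b' [i|]; rewrite /od /=; have [->|->] := bool_or b b'.
- have [->|->|->] := distinct_or i d.
  + by exists 0, (b, None); rewrite Ee0 scale0r.
  + by exists 0, (b, None); rewrite Ee0' scale0r.
  + by exists (- (sg K b * c k)), (b, None); rewrite (Ee _ _ d).
- have [->|->|->] := distinct_or i d.
  + by eexists _, (b, Some _); rewrite Ef.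
  + by eexists _, (b, Some _); rewrite Ef'.
  + by exists 0, (b, None); rewrite (Ef0 _ _ d) scale0r.
- by exists 0, (b, None); rewrite Ex0 scale0r.
- by eexists _, (~~ b, Some _); rewrite (Ey _ _ d).
Qed.

Lemma od_sq o : [od o; od o] = 0.
Proof. by case: o => b [i|]; [exact: ee_sq|exact: xx0]. Qed.

Definition stable0 (S : set M) := [/\ subspace S, forall b k z, S z -> S (EV b k *> z) &
  forall i z, S z -> S (h i *> z)].

Lemma stable0_od S o o' z : stable0 S -> S z -> S ([od o; od o'] *> z).
Proof.
move=> [sS ES hS] Sz.
have Z : S (0 *> z) by rewrite act0l; exact: subspace0.
have xe b i : [x (~~ b); e b i] = EV (~~ b) i.
  by rewrite -{2}[b]negbK (xf _ _ (distinct_nxt i)).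
case: o o' => b [i|] [b' [j|]]; rewrite /od /=; have [->|->] := bool_or b b'.
- have [->|ij] := eqVneq i j; first by rewrite ee_sq.
  have [k d] := third ij; rewrite -[[_; _]]/(EE D b i j) (EE_EV D b d); exact: ES.
- rewrite ef_br actZl; apply: (subspaceZ _ sS); exact: hS.
- by rewrite ex0.
- rewrite bracket_oo; [|exact: ee_odd|exact: xx_odd].
  by rewrite xe; exact: ES.
- by rewrite xe0.
- rewrite -{1}[b]negbK xe; exact: ES.
- by rewrite xx0.
- rewrite xy -scaleN1r actZl !actDl; apply: (subspaceZ _ sS).
  by apply: (subspaceD sS); [apply: (subspaceD sS)|]; exact: hS.
Qed.

(** The $U(\mathfrak{g}_{\bar0})$-submodule generated by [G], with the even part represented by its
    six root vectors and the [h i]. *)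
Definition U0 (G : set M) : set M := fun v => forall S, stable0 S -> G `<=` S -> S v.

Lemma U0_stable G : stable0 (U0 G).
Proof.
split.
- split=> [S [sS _ _] _|a u v Hu Hv S sS GS]; first exact: subspace0.
  by case: (sS) => -[_ L] _ _; apply: L; [exact: Hu|exact: Hv].
- by move=> b k z Hz S sS GS; case: (sS) => _ L _; apply: L; exact: Hz.
- by move=> i z Hz S sS GS; case: (sS) => _ _ L; apply: L; exact: Hz.
Qed.

Lemma U0_sub G : G `<=` U0 G. Proof. by move=> v Gv S _; apply. Qed.

Lemma U0_min G S : stable0 S -> G `<=` S -> U0 G `<=` S.
Proof. by move=> sS GS v; apply. Qed.

Definition word (w : seq oddix) m : M := foldr (fun o z => od o *> z) m w.

Lemma word_cat u v m : word (u ++ v) m = word u (word v m).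
Proof. exact: foldr_cat. Qed.

Lemma word_linear w : linear (word w).
Proof. by move=> a y z; elim: w => //= o w ->; exact: actPr. Qed.

Lemma wt_word w l m : wt D l m -> wt D (\sum_(o <- w) ort o + l) (word w m).
Proof.
move=> lm; elim: w => [|o w IH] /=; first by rewrite big_nil add0r.
by rewrite big_cons -addrA; apply: wt_act IH; [exact: od_odd|exact: od_root].
Qed.

Section Words.
Variable m0 : M.
Definition Pw n := U0 [set z | exists2 w, (size w < n)%N & z = word w m0].

Let sP n : subspace (Pw n). Proof. by case: (U0_stable [set z | exists2 w, (size w < n)%N & z =
  word w m0]). Qed.

(** Moving an odd vector inwards past an even one leaves a multiple of an odd one, so only one odd
    factor is added. *)
Lemma Pw_od n o z : Pw n z -> Pw n.+1 (od o *> z).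
Proof.
pose S := [set z | Pw n z /\ forall o, Pw n.+1 (od o *> z)].
suff PS : Pw n `<=` S by move=> /PS [].
have [_ EP hP] := U0_stable [set z | exists2 w, (size w < n)%N & z = word w m0].
have [_ EP' hP'] := U0_stable [set z | exists2 w, (size w < n.+1)%N & z = word w m0].
apply: U0_min; first split.
- split; first by split=> [|o']; rewrite ?actr0; exact: subspace0.
  move=> a u v [Pu Hu] [Pv Hv]; split; first by case: (sP n) => _; apply.
  by move=> o'; rewrite actPr; case: (sP n.+1) => _; apply.
- move=> b k y [Py Hy]; split; first exact: EP.
  move=> o'; have := act_e y (EV_even D b k) (od_odd o').
  have [a [o1 ->]] := EV_od b k o'; rewrite actZl => E.
  apply: (subspaceDr (sP n.+1) (v := a *: (od o1 *> y))); first exact: (subspaceZ _ (sP _) (Hy o1)).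
  by rewrite -E; exact: EP' (Hy o').
- move=> i y [Py Hy]; split; first exact: hP.
  move=> o'; have := act_e y (h_even D i) (od_odd o').
  rewrite od_root actZl => E.
  apply: (subspaceDr (sP n.+1) (v := ort o' i *: (od o' *> y)));
    first exact: (subspaceZ _ (sP _) (Hy o')).
  by rewrite -E; exact: hP' (Hy o').
- move=> _ [w ws ->]; split; first by apply: U0_sub; exists w.
  by move=> o'; apply: U0_sub; exists (o' :: w).
Qed.

(** The anticommutator of two odd vectors is even and shortens the word. The bound in [Pw] is
    strict, so the index [size] means strictly shorter words. *)
Lemma Pw_swap (u v : seq oddix) (a b : oddix) : Pw (size (u ++ a :: b :: v))
  (word (u ++ a :: b :: v) m0 + word (u ++ b :: a :: v) m0).
Proof.
elim: u => [|o u IH] /=; last by rewrite -actDr; exact: Pw_od.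
rewrite -(act_oo _ (od_odd a) (od_odd b)).
by apply: (@stable0_od (Pw _) a b); [exact: U0_stable|apply: U0_sub; exists v].
Qed.

(** The left copy of [a] is moved to the right, modulo shorter words, until it meets the other; the
    square of an odd root vector acts by zero. *)
Lemma Pw_dup (u v w : seq oddix) (a : oddix) : Pw (size (u ++ a :: v ++ a :: w))
  (word (u ++ a :: v ++ a :: w) m0).
Proof.
elim: v u => [|o v IH] u.
  rewrite word_cat /=; set y := word w m0.
  have -> : od a *> od a *> y = 0.
    have := act_oo y (od_odd a) (od_odd a); rewrite od_sq act0l -mulr2n -scaler_nat.
    by move/esym/eqP; rewrite scaler_eq0 pnatr_eq0 => /eqP.
  have -> : word u 0 = 0 by elim: u => //= o u ->; rewrite actr0.
  exact: subspace0.
rewrite cat_cons; have Hs := @Pw_swap u (v ++ a :: w) a o.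
apply: (subspaceDr (sP _) _ Hs).
have -> : u ++ o :: a :: v ++ a :: w = rcons u o ++ a :: v ++ a :: w by rewrite cat_rcons.
have := IH (rcons u o); rewrite !size_cat size_rcons /= !size_cat /= !addSn !addnS //.
Qed.

(** A word of nine or more letters repeats one of the eight odd roots and reduces to shorter
    words. *)
Lemma Pw_word w : Pw 9 (word w m0).
Proof.
have [n] := ubnP (size w); elim: n w => // n IH w ws.
have [small|big] := ltnP (size w) 9; first by apply: U0_sub; exists w.
have : ~~ uniq w.
  apply/negP => /card_uniqP E; have := max_card (mem w).
  by rewrite E card_prod card_bool card_option card_ord leqNgt big.
move/(uniqPn (true, None)) => [i [j [ij jw E]]].
suff : Pw (size w) (word w m0).
  apply: U0_min; first exact: U0_stable.
  by move=> _ [w' w's ->]; apply: IH; exact: leq_trans w's _.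
set a := nth _ w i in E.
have Ew : w = take i w ++ a :: drop i.+1 w by rewrite -drop_nth ?cat_take_drop // (ltn_trans ij).
have aw : a \in drop i.+1 w.
  have -> : a = nth (true, None) (drop i.+1 w) (j - i.+1) by rewrite nth_drop subnKC.
  by rewrite mem_nth // size_drop ltn_sub2r // (leq_ltn_trans ij).
by rewrite Ew; case/splitPr: aw => v w'; exact: Pw_dup.
Qed.

End Words.

Definition words : seq (seq oddix) :=
  flatten [seq [seq val t | t <- enum {: n.-tuple oddix}] | n <- iota 0 9].

Lemma mem_words w : (size w < 9)%N -> w \in words.
Proof.
move=> ws; apply/flatten_mapP; exists (size w); first by rewrite mem_iota.
by apply/mapP; exists (in_tuple w); rewrite ?mem_enum.
Qed.

Lemma Pw_full p m : simple_module M -> mod_part M p m -> m <> 0 -> forall z, Pw m 9 z.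
Proof.
move=> simM pm m0; apply: (simple_full simM _ _ pm m0); last by apply: U0_sub; exists [::].
  by case: (U0_stable [set z | exists2 w, (size w < 9)%N & z = word w m]).
move=> b i z /(Pw_od (b, Some i)); apply: U0_min; first exact: U0_stable.
by move=> _ [w _ ->]; exact: Pw_word.
Qed.

(* U(g)_(mu - nu) is finitely generated over C[T_0, T_1, T_2]. *)
Lemma weight_generators (nu mu : {ffun 'I_3 -> K}) : simple_module M ->
  exists n (Y : 'I_n -> M -> M), [/\ forall i : 'I_n, linear (Y i), forall (i : 'I_n) m, wt D nu m -> wt D mu (Y i m) &
   forall p m, mod_part M p m -> wt D nu m -> m <> 0 ->
     forall N, subspace N -> (forall k z, N z -> N (TT D M k z)) ->
       (forall i : 'I_n, N (Y i m)) -> wt D mu `<=` N].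
Proof.
move=> simM.
pose fs := enum 'I_3.
pose ok w (j : 'I_3 -> int) := \sum_(k <- fs) ert D true k *~ j k + (\sum_(o <- w) ort o + nu) = mu.
(* Each coroot is 2 on its own even root and 0 on the other two, so the weight determines the ladder
   positions. *)
have ok_uniq w j j' : ok w j -> ok w j' -> j =1 j'.
  rewrite /ok => <- /addIr /esym E k.
  have := congr1 (phi D k) E; rewrite /fs !big_enum /=.
  have S (q : 'I_3 -> int) : phi D k (\sum_i ert D true i *~ q i) = (q k)%:~R * 2%:R.
    rewrite (big_I3 _ _ (distinct_nxt k)) /= !phiD !phi_mulz !phi_ert eqxx.
    by have [_ /negbTE-> /negbTE->] := distinctP (distinct_nxt k); rewrite /sg mulr1 !mulr0 !add0r.
  rewrite !S => /(mulIf _) F; apply/eqP; rewrite -(eqr_int K) F //.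
  by rewrite pnatr_eq0.
pose L := [seq w <- words | `[< exists j, ok w j >]].
have /choice[J HJ] : forall w : seq oddix, exists j, w \in L -> ok w j.
  move=> w; have [wL|_] := boolP (w \in L); last by exists (fun=> 0).
  by move: (wL); rewrite mem_filter => /andP[/asboolP[j okj] _]; exists j.
exists (size L), (fun (i : 'I_(size L)) m => ladn D fs (J (nth [::] L i)) (word (nth [::] L i) m)).
split.
- by move=> i a u v; rewrite word_linear ladn_linear.
- move=> i m num; rewrite -(HJ (nth [::] L i)); last by rewrite mem_nth.
  by apply: wt_ladn; exact: wt_word.
move=> p m pm num m0 N sN TN YN z muz.
(* [Cl y] is $K[T_0,T_1,T_2]\,y$. *)
pose Cl y := fun v => forall S, subspace S -> (forall k z, S z -> S (TT D M k z)) -> S y -> S v.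
have Cls y : subspace (Cl y).
  split=> [S [S0 _]|a u v Hu Hv S sS TS Sy] //.
  by case: (sS) => _; apply; [exact: Hu|exact: Hv].
have ClT y k : tstab D (Cl y) k.
  by move=> v Hv S sS TS Sy; exact: (TS k v (Hv S sS TS Sy)).
have Clw y l : wt D l y -> Cl y `<=` wt D l.
  move=> ly v; apply=> //; first exact: subspace_wt.
  move=> k v' lv'; rewrite TTE.
  have := wt_act (EV_even D true k) (EV_root D true k) (wt_act (EV_even D false k)
    (EV_root D false k) lv').
  by rewrite addrA -[false]/(~~ true) ertN subrr add0r.
(* Even root vectors shift the ladder positions and change the bottom vector only inside [Cl], so
   [G] spans a space stable under the even part. *)
pose G : set M := fun v => exists w j u,
  [/\ w \in words, Cl (word w m) u & v = ladn D fs j u].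
have GW v : G v -> exists l', wt D l' v.
  move=> [w [j [u [_ Cu ->]]]]; eexists; apply: wt_ladn.
  by apply: (Clw _ _ _ _ Cu); apply: wt_word num.
have G0 : stable0 (span G).
  split; first exact: subspace_span.
  - move=> b k; apply: act_span => _ [w [j [u [ww Cu ->]]]].
    have kfs : k \in fs by rewrite mem_enum.
    have [|j' [u' Cu' ->]] := ladn_step (D :=
      D) j b (enum_uniq 'I_3) kfs (Cls (word w m)) (Clw _ _ (wt_word w num)) _ Cu.
      by move=> k' _; exact: ClT.
    by apply: sub_span; exists w, j', u'.
  - move=> i; apply: act_span => v Gv; have [l ->] := GW v Gv.
    by apply: (subspaceZ _ (subspace_span _)); exact: sub_span.
have Gfull : span G z.
  apply: (Pw_full simM pm m0) => // _ [w ws ->]; apply: sub_span.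
  exists w, (fun=> 0), (word w m); split; [exact: mem_words|by move=> S _ _|].
  by rewrite /fs; elim: (enum _) => //= k fs' <-.
apply: (span_min sN _ (wt_span GW Gfull muz)) => _ [[w [j [u [ww Cu ->]]]] muv].
have [->|v0] := pselect (ladn D fs j u = 0); first exact: subspace0.
have uw : wt D (\sum_(o <- w) ort o + nu) u by apply: (Clw _ _ _ _ Cu); exact: wt_word.
have okj : ok w j by exact: wt_uniq (wt_ladn fs j uw) muv v0.
have wL : w \in L by rewrite mem_filter ww andbT; apply/asboolP; exists j.
have -> : j = J w by apply/funext => k; apply: ok_uniq okj _ _; exact: HJ.
(* The preimage of [N] along the ladder is [TT]-stable, so it contains all of [Cl] once it contains
   [word w m]. *)
pose S := [set y | wt D (\sum_(o <- w) ort o + nu) y /\ N (ladn D fs (J w) y)].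
suff [] : S u by [].
apply: Cu.
- split.
    split; first by case: (subspace_wt D M (\sum_(o <- w) ort o + nu)).
    have := ladn_linear D fs (J w) (-1) (0 : M) 0; rewrite scaler0 addr0 scaleN1r addNr => ->.
    exact: subspace0.
  move=> a y y' [wy Ny] [wy' Ny']; split.
    by case: (subspace_wt D M (\sum_(o <- w) ort o + nu)) => _; apply.
  by rewrite ladn_linear; case: sN => _; apply.
- move=> k y [wy Ny]; split; first by apply: (Clw y) => //; apply: ClT.
  have [a Ha] := @TT_ladn _ _ D M fs (J w) k (\sum_(o <- w) ort o + nu) (enum_uniq 'I_3).
  apply: (subspaceDr sN (v := a *: ladn D fs (J w) y)); first exact: subspaceZ.
  by rewrite -Ha //; exact: TN.
- split; first exact: wt_word.
  have iL : (index w L < size L)%N by rewrite index_mem.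
  by have := YN (Ordinal iL); rewrite /= nth_index.
Qed.

End FinitelyGenerated.

(** The parity is fixed because simplicity speaks of graded submodules, and homogeneous vectors are
    what generates these. *)
Lemma weight_fin (K : numClosedFieldType) (g : lieSuperalgebra K) (D : d21 g)
    (M : supermodule g) (nu : {ffun 'I_3 -> K}) (p : bool) :
  uncountable_field K -> simple_module M ->
  exists n, dimle (wt D nu `&` mod_part M p) n.
Proof.
move=> uncK simM; set W := _ `&` _.
have sW : subspace W.
  by apply: subspaceI; [exact: subspace_wt|exact: grading_sub (mod_grading M) p].
have [[m0 [num0 pm0] m00]|W0] := pselect (exists2 m, W m & m <> 0); last first.
  exists 0%N => v Wv; exists (fun=> 1); first by exists ord0; exact: oner_neq0.
  by rewrite big_ord1 scale1r; apply: contrapT => v0; apply: W0; exists (v ord0).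
have [n [Y [linY wtY genY]]] := weight_generators D nu nu simM.
have TW k m : wt D nu m -> wt D nu (TT D M k m).
  move=> lm; rewrite TTE.
  have := wt_act (EV_even D true k) (EV_root D true k) (wt_act (EV_even D false k)
    (EV_root D false k) lm).
  by rewrite addrA -[false]/(~~ true) ertN subrr add0r.
have [||||||N [v [sN TN Xv Nv NX]]] := @joint_eigenfunctional K M 'I_3 (TT D M) (wt D nu)
    [seq Y i m0 | i <- enum 'I_n] uncK.
- exact: subspace_wt.
- exact: TW.
- by move=> k k' m _; exact: TT_comm.
- by move=> _ /mapP[i _ ->]; exact: wtY.
- move=> N sN TN GN; apply: (genY p m0) => // i; apply: GN.
  by apply: map_f; rewrite mem_enum.
- by exists m0.
have /choice[a Ha] : forall i : 'I_n, exists a : M -> K, forall m, wt D nu m ->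
  N (Y i m - a m *: v).
  move=> i; have /choice[a Ha] : forall m, exists b, wt D nu m -> N (Y i m - b *: v).
    move=> m; have [lm|lm] := pselect (wt D nu m); last by exists 0.
    by have [b Hb] := NX _ (wtY i _ lm); exists b.
  by exists a.
exists n; apply: (dimle_fun (phi := a)) => // [i b u w [lu _] [lw _]|w [lw pw] a0].
  have luw : wt D nu (b *: u + w) by case: (subspace_wt D M nu) => _; apply.
  (* The coefficient of [v] modulo [N] is unique because [v] is outside [N]; this forces
     linearity. *)
  apply/eqP; rewrite -subr_eq0; apply/negPn/negP => d0; apply: Nv.
  set d := _ - _ in d0; rewrite -[v](scalerK d0); apply: (subspaceZ _ sN).
  have -> : d *: v = (b *: (Y i u - a i u *: v) + (Y i w - a i w *: v)) - (Y i (b *: u +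
    w) - a i (b *: u + w) *: v).
    rewrite linY scalerBr addrACA -opprD scalerA -scalerDl opprB [_ *: v - _]addrC.
    by rewrite addrACA subrr add0r addrC -scalerBl.
  apply: (subspaceB sN); last exact: Ha.
  by apply: (subspaceD sN); [apply: (subspaceZ _ sN)|]; exact: Ha.
apply: contrapT => w0; apply: Nv.
apply: (genY p w pw lw w0 N sN TN _ v Xv) => i.
by have := Ha i w lw; rewrite a0 scale0r subr0.
Qed.

(** * Twisted localization *)

Section UpDown.
Variables (K : numFieldType) (g : lieSuperalgebra K) (D : d21 g).
Implicit Types (b : bool) (i k : 'I_3) (o : oddix).
Local Notation "[ x ; y ]" := (bracket x y).
Local Notation c := (cc D).
Local Notation e := (ee D).
Local Notation h := (hh D).
Local Notation x := (xx D).
Local Notation EV := (EV D).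
Local Notation od := (od D).

(* The odd roots on which the coroot of EV b k takes the value 1. *)
Definition up b k o : bool := (o.1 (+) (o.2 == Some k)) == b.

Definition ups b k : seq oddix :=
  [:: (b, Some (nxt k)); (b, Some (nxt (nxt k))); (b, None); (~~ b, Some k)].

Lemma upN b k o : up (~~ b) k o = ~~ up b k o.
Proof. by rewrite /up; case: (_ (+) _); case: b. Qed.

Lemma mem_ups b k o : (o \in ups b k) = up b k o.
Proof.
by case: b; case: k => [[|[|[|//]]] hk]; case: o => [[] [[[|[|[|//]]] hi]|]].
Qed.

Lemma ups_ind b k (P : oddix -> Prop) : P (b, Some (nxt k)) -> P (b, Some (nxt (nxt k))) ->
  P (b, None) -> P (~~ b, Some k) -> forall o, up b k o -> P o.
Proof.
move=> P1 P2 P3 P4 o; rewrite -mem_ups !inE.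
by case/or4P => /eqP ->.
Qed.

Lemma EV_up b k o : up b k o -> [EV b k; od o] = 0.
Proof.
have d := distinct_nxt k; move=> uo; move: o uo; apply: ups_ind; rewrite /od /=.
- exact: Ee0.
- exact: Ee0'.
- exact: Ex0.
- exact: Ef0 d.
Qed.

Lemma EV_down b k o : exists a o', up b k o' /\ [EV b k; od o] = a *: od o'.
Proof.
have [u|] := boolP (up b k o).
  by exists 0, o; rewrite EV_up // scale0r.
have d := distinct_nxt k; have [d12 d1 d2] := distinctP d.
have U o' : o' \in ups b k -> up b k o' by rewrite mem_ups.
rewrite -upN => uo; move: o uo; apply: ups_ind; rewrite /od /=.
- exists (- (sg K b * cij c (nxt k) (nxt (nxt k)))), (b, Some (nxt (nxt k))).
  by split; [apply: U; rewrite !inE eqxx orbT|exact: Ef].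
- exists (- (sg K b * cij c (nxt k) (nxt (nxt k)))), (b, Some (nxt k)).
  by split; [apply: U; rewrite !inE eqxx|exact: Ef'].
- exists (- (sg K b * c k)), (~~ b, Some k).
  by split; [apply: U; rewrite !inE eqxx !orbT|exact: Ey d].
- exists (- (sg K b * c k)), (b, None).
  by rewrite negbK; split; [apply: U; rewrite !inE eqxx !orbT|exact: Ee d].
Qed.

Lemma up_up b k o o' : up b k o -> up b k o' -> exists r, [od o; od o'] = r *: EV b k.
Proof.
have d := distinct_nxt k; have [d12 d1 d2] := distinctP d.
have Z : exists r, 0 = r *: EV b k by exists 0; rewrite scale0r.
have O : exists r, EV b k = r *: EV b k by exists 1; rewrite scale1r.
have C1 : EE D b (nxt (nxt k)) (nxt k) = EV b k by rewrite EC.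
move=> uo uo'; move: o uo; apply: ups_ind; move: o' uo'; apply: ups_ind; rewrite /od /=;
  rewrite ?ee_sq ?xx0 ?ex0 ?xe0 ?(ef_ij _ _ d1) ?(ef_ij _ _ d2) ?(xf _ _ d) ?(fx _ _ d) //.
- by rewrite -/(EE D b _ _) C1.
- by rewrite fe_ij // eq_sym.
- by rewrite fe_ij // eq_sym.
Qed.

(** The $k'$-th $\mathfrak{sl}_2$ commutes with the $k$-th coroot, hence respects the division into
    upper and lower odd roots. *)
Lemma EV_other b b' k k' o : k != k' -> exists a o',
  up b k o' = up b k o /\ [EV b' k'; od o] = a *: od o'.
Proof.
move=> kk'; have d' := distinct_nxt k'; have [d12' d1' d2'] := distinctP d'.
have S i i' : (Some i == Some i' :> option 'I_3) = (i == i') by [].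
have Z : exists a o', up b k o' = up b k o /\ 0 = a *: od o'.
  by exists 0, o; rewrite scale0r.
have [u|] := boolP (up b' k' o); first by rewrite EV_up.
have [j d] := third kk'.
have E1 : EV b' k' =
  EE D b' k j by rewrite (EE_EV D b' (distinct_swap (distinct_rot (distinct_rot d)))).
have [d1 d2 d3] := distinctP d.
have k'k : (k' == k) = false by rewrite eq_sym (negbTE d1).
have jk : (j == k) = false by rewrite eq_sym (negbTE d2).
have d4 : distinct k j k' by exact: distinct_swap (distinct_rot (distinct_rot d)).
case: o Z => b1 [i|] Z; rewrite /up /od /=.
- rewrite S; have [Eb|Eb] := bool_or b' b1; subst b1.
  + case: (eqVneq i k') => [->|ik'] => [_|]; last by rewrite addbF eqxx.
    exists (- (sg K b' * c k')), (b', None); rewrite /= S addbF k'k addbF.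
    by split=> //; rewrite E1 (Ee _ _ d4).
  + case: (eqVneq i k') => [->|ik']; first by rewrite addbT negbK eqxx.
    move=> _; have [Ei|Ei|Ei] := distinct_or i d; subst i.
    * exists (- (sg K b' * cij c k j)), (b', Some j); rewrite /= !S ?eqxx ?jk.
      by split; [rewrite addbF addbT negbK|rewrite E1 Ef].
    * by rewrite eqxx in ik'.
    * exists (- (sg K b' * cij c k j)), (b', Some k); rewrite /= !S ?eqxx ?jk.
      by split; [rewrite addbF addbT|rewrite E1 Ef'].
- have [Eb|Eb] := bool_or b' b1; subst b1; first by rewrite addbF eqxx.
  move=> _; exists (- (sg K b' * c k')), (~~ b', Some k'); rewrite /= S k'k.
  by split=> //; rewrite E1 (Ey _ _ d4).
Qed.

(** The $k$-th coroot vanishes on the sum of a lower and an upper root, so their anticommutator lies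
    in $\mathfrak{h}$ or in another $\mathfrak{sl}_2$. *)
Lemma down_up (M : supermodule g) (S : set M) b k o o' z : subspace S ->
  (forall b' k' y, k != k' -> S y -> S (act (EV b' k') y)) ->
  (forall i y, S y -> S (act (h i) y)) ->
  ~~ up b k o' -> up b k o -> S z -> S (act [od o'; od o] z).
Proof.
move=> sS ES hS; rewrite -upN => uo' uo Sz.
have Z : S (act 0 z) by rewrite act0l; exact: subspace0.
have d := distinct_nxt k; have [d12 d1 d2] := distinctP d.
have r1 := distinct_rot d; have r2 := distinct_rot r1.
have nE b1 b2 : ~~ b1 = b2 -> forall i, [e b1 i; x b2] = EV b2 i.
  by move=> <- i; rewrite -{1}[b1]negbK (fx _ _ (distinct_nxt i)).
have xE b1 b2 : ~~ b1 = b2 -> forall i, [x b1; e b2 i] = EV b1 i.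
  by move=> <- i; exact: xf (distinct_nxt i).
have EE1 b1 : [e b1 (nxt k); e b1 k] = EV b1 (nxt (nxt k)).
  by rewrite -/(EE D b1 _ _) (EE_EV D b1 (distinct_swap r2)).
have EE2 b1 : [e b1 (nxt (nxt k)); e b1 k] = EV b1 (nxt k) by exact: (EE_EV D b1 r1).
have EE3 b1 : [e b1 k; e b1 (nxt k)] = EV b1 (nxt (nxt k)) by exact: (EE_EV D b1 r2).
have EE4 b1 : [e b1 k; e b1 (nxt (nxt k))] = EV b1 (nxt k).
  by rewrite -/(EE D b1 _ _) (EE_EV D b1 (distinct_swap r1)).
have k1 : k != nxt k by rewrite eq_sym.
have k2 : k != nxt (nxt k) by rewrite eq_sym.
have hx : S (act [x (~~ b); x b] z).
  rewrite -{2}[b]negbK xy -scaleN1r actZl !actDl; apply: (subspaceZ _ sS).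
  by apply: (subspaceD sS); [apply: (subspaceD sS)|]; exact: hS.
have hee i i' : S (act [e (~~ b) i; e b i'] z).
  rewrite -{2}[b]negbK ef_br actZl; apply: (subspaceZ _ sS); exact: hS.
have hee' i i' : S (act [e b i; e (~~ b) i'] z).
  rewrite ef_br actZl; apply: (subspaceZ _ sS); exact: hS.
move: o uo; apply: ups_ind; move: o' uo'; apply: ups_ind; rewrite /od /= ?negbK //.
all: rewrite ?EE1 ?EE2 ?EE3 ?EE4 ?(nE _ _ erefl) ?(nE _ _ (negbK _)) ?(xE _ _ erefl)
  ?(xE _ _ (negbK _)) ?ex0 ?xe0 //; exact: ES.
Qed.

Lemma phi_ort b k o : phi D k (ort D o) = if up b k o then sg K b else - sg K b.
Proof.
case: o => b' [i|]; rewrite /ort /up /=.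
  have S i' : (Some i == Some i' :> option 'I_3) = (i == i') by [].
  rewrite phi_rt S; case: eqP => _; case: b' b => [] []; rewrite /sg //= ?opprK //.
by rewrite phi_xrt; case: b' b => [] []; rewrite /sg //= ?opprK.
Qed.

End UpDown.

Section MoreLinearAlgebra.
Variables (K : numFieldType) (V : lmodType K).
Implicit Types (S W Z G : set V) (T : {linear V -> V}).

(** A polynomial relation on [w] can be divided by [T] while its constant term is zero; a nonzero
    constant term exhibits [w] as an image. *)
Lemma injective_surjective T W n : subspace W -> dimle W n ->
  (forall w, W w -> W (T w)) -> (forall w, W w -> T w = 0 -> w = 0) ->
  forall w, W w -> exists2 u, W u & T u = w.
Proof.
move=> sW Wn TW inj w Ww.
have Wi i : W (iter i T w) by elim: i => //= i; exact: TW.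
have [c [i ci] c0] := Wn (fun i => iter i T w) (fun i => Wi i).
pose p := \poly_(i < n.+1) c (inord i).
have cp (j : 'I_n.+1) : p`_j = c j by rewrite coef_poly ltn_ord inord_val.
have p0 : p != 0 by apply: contra_neq ci => p0; rewrite -cp p0 coef0.
have pw : pact T p w = 0.
  by rewrite (pact_wide _ _ (size_poly _ _)) -[RHS]c0; apply: eq_bigr => j _; rewrite cp.
elim/poly_ind: (p) p0 pw => [|q a IH]; first by rewrite eqxx.
have Tq : pact T (q * 'X) w = T (pact T q w).
  by rewrite mulrC pactM -['X]mul1r pactMX -polyC1 pactC scale1r.
have Wq : W (pact T q w) by exact: pact_stable.
rewrite pactD pactC Tq => qa0 E.
have [a0|a0] := eqVneq a 0.
  apply: IH; first by apply: contraNneq qa0 => ->; rewrite a0 mul0r add0r polyC0.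
  by apply: inj => //; rewrite -E a0 scale0r addr0.
exists (- a^-1 *: pact T q w); first exact: subspaceZ.
rewrite linearZ /= -[w in RHS](scalerK a0) scaleNr.
by move/eqP: E; rewrite addr_eq0 => /eqP ->; rewrite scalerN opprK.
Qed.

(* Lagrange interpolation extracts the eigencomponents inside Z. *)
Lemma stable_span_eigen T Z z : subspace Z -> (forall v, Z v -> Z (T v)) ->
  span [set v | exists a, T v = a *: v] z -> Z z ->
  span [set v | Z v /\ exists a, T v = a *: v] z.
Proof.
move=> sZ TZ Ez Zz.
have [ks uks ks0] : exists2 ks, uniq ks & forall ks', {subset ks <= ks'} -> oppl T ks' z = 0.
  elim/span_ind: {Zz} Ez => [|a u v [ks uks ks0] [ls uls ls0]|v [a Tv]].
  - by exists [::] => // ks' _; exact: oppl0.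
  - exists (undup (ks ++ ls)); first exact: undup_uniq.
    move=> ks' sub; rewrite opplP ks0 ?ls0 ?scaler0 ?addr0 //.
      by move=> k kk; apply: sub; rewrite mem_undup mem_cat kk orbT.
    by move=> k kk; apply: sub; rewrite mem_undup mem_cat kk.
  - exists [:: a] => // ks' sub; rewrite (oppl_eigen _ Tv).
    have /eqP -> : \prod_(k <- ks') (a - k) == 0; last by rewrite scale0r.
    by rewrite prodf_seq_eq0; apply/hasP; exists a; [apply: sub; exact: mem_head|rewrite /= subrr].
have {}ks0 := ks0 ks (fun k h => h).
have ZT l v : Z v -> Z (oppl T l v).
  by move=> Zv; elim: l => //= k l IH; apply: (subspaceB sZ); [exact: TZ|exact: subspaceZ].
elim: ks z uks ks0 Zz {Ez} => [|k ks IH] z; first by move=> _ /= -> _;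
  exact: subspace0 (subspace_span _).
move=> /andP[kks uks] /= /eqP; rewrite subr_eq0 => /eqP Ty Zz.
pose P := \prod_(a <- ks) (k - a).
have P0 : P != 0.
  rewrite prodf_seq_neq0; apply/allP => a aks /=; rewrite subr_eq0.
  by apply: contraNneq kks => ->.
set y := oppl T ks z in Ty; pose y' := P^-1 *: y.
have Ty' : T y' = k *: y' by rewrite linearZ /= Ty !scalerA mulrC.
have Zy' : Z y' by apply: (subspaceZ _ sZ); exact: ZT.
rewrite -(subrK y' z); apply: (subspaceD (subspace_span _)).
  apply: IH => //; last exact: subspaceB.
  rewrite addrC -scaleN1r opplP (oppl_eigen _ Ty') -/P -/y /y' [P *: _]scalerA mulfV //.
  by rewrite scale1r scaleN1r addNr.
by apply: sub_span; split=> //; exists k.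
Qed.

End MoreLinearAlgebra.

Section WeightModule.
Variables (K : numFieldType) (g : lieSuperalgebra K) (D : d21 g) (M : supermodule g).
Local Notation "u *> m" := (act u m) (at level 35, right associativity).
Local Notation h := (hh D).

Lemma wt_parts l (v : M) : wt D l v -> exists w0 w1,
  [/\ (wt D l `&` mod_part M false) w0, (wt D l `&` mod_part M true) w1 & v = w0 + w1].
Proof.
move=> lv; have gM := mod_grading M.
have [w0 [w1 [P0 P1 E]]] := grading_sum gM v.
have W i : h i *> w0 = l i *: w0 /\ h i *> w1 = l i *: w1.
  apply: (grading_uniq gM).
  - exact: (act_part (h_even D i) P0).
  - exact: (act_part (h_even D i) P1).
  - exact: subspaceZ _ (grading_sub gM _) P0.
  - exact: subspaceZ _ (grading_sub gM _) P1.
  - by rewrite -actDr -scalerDr -E.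
by exists w0, w1; split=> //; split=> // i; case: (W i).
Qed.

Hypothesis weightM : forall m : M, span [set v | exists l, wt D l v] m.

Lemma stable_weight_vector (Z : set M) z : subspace Z -> (forall i v, Z v -> Z (h i *> v)) ->
  graded (mod_part M) Z -> Z z -> z <> 0 ->
  exists v l p, [/\ Z v, v <> 0, wt D l v & mod_part M p v].
Proof.
move=> sZ hZ gZ Zz z0.
pose G (s : seq 'I_3) := [set v | Z v /\ forall i, i \in s -> exists a, h i *> v = a *: v].
have H s : span (G s) z.
  elim: s => [|i s IH]; first by apply: sub_span; split.
  apply: (span_min _ _ IH); first exact: subspace_span.
  move=> v [Zv Ev].
  have /choice[a Ha] : forall i, exists a, i \in s -> h i *> v = a *: v.
    move=> i'; have [is_|_] := boolP (i' \in s); last by exists 0.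
    by have [a Ea] := Ev i' is_; exists a.
  (* The eigenvalues already fixed cut out a space still stable under the next [h i], so
     interpolation stays inside it. *)
  pose Zv' := Z `&` [set u | forall i, i \in s -> h i *> u = a i *: u].
  have sZ' : subspace Zv'.
    apply: subspaceI => //; split=> [i' _|b u w Hu Hw i' is_]; first by rewrite actr0 scaler0.
    by rewrite actPr Hu // Hw // scalerDr !scalerA mulrC.
  have TZ' u : Zv' u -> Zv' (act (h i) u).
    move=> [Zu Hu]; split; first exact: hZ.
    move=> i' is_; rewrite (act_commute _ (h_even D i') (h_even D i) (hh0 D i' i)) Hu //.
    exact: actZr.
  have Ew : span [set u | exists a, act (h i) u = a *: u] v.
    by apply: span_mono (weightM v) => u [l lu]; exists (l i).
  have Zv'v : Zv' v by split=> // i' is_; exact: Ha.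
  apply: span_mono (@stable_span_eigen _ _ (act (h i)) Zv' v sZ' TZ' Ew Zv'v).
  move=> u [[Zu Hu] Eu]; split=> // i'; rewrite inE => /orP[/eqP -> //|is_].
  by exists (a i'); exact: Hu.
have [v [Zv v0 Ev]] : exists v, [/\ Z v, v <> 0 & forall i, exists a, h i *> v = a *: v].
  apply: contrapT => N; apply: z0.
  apply: (H (enum 'I_3) [set 0]); first exact: subspace_zero.
  move=> v [Zv Ev] /=; apply: contrapT => v0; apply: N; exists v; split=> // i.
  by apply: Ev; rewrite mem_enum.
have /choice[l Hl] := Ev.
have lv : wt D [ffun i => l i] v by move=> i; rewrite ffunE.
have [w0 [w1 [[W0 P0] [W1 P1] E]]] := wt_parts lv.
have [Zw0 Zw1] : Z w0 /\ Z w1 by apply: gZ => //; rewrite -E.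
have [w00|w00] := pselect (w0 = 0); last by exists w0, [ffun i => l i], false.
exists w1, [ffun i => l i], true; split=> //.
by move=> w10; apply: v0; rewrite E w00 w10 addr0.
Qed.

End WeightModule.

(** * Conjugation of root vectors by powers of $E$ *)

Section Twist.
Variables (K : numFieldType) (g : lieSuperalgebra K) (D : d21 g) (M : supermodule g).
Variables (b : bool) (k : 'I_3) (t : K) (J : M -> M).
Implicit Types (u : g) (m z v w : M) (o : oddix).
Local Notation "[ x ; y ]" := (bracket x y).
Local Notation "u *> m" := (act u m) (at level 35, right associativity).
Local Notation c := (cc D).
Local Notation e := (ee D).
Local Notation h := (hh D).
Local Notation EV := (EV D).
Local Notation od := (od D).
Local Notation E := (EV b k).
Local Notation F := (EV (~~ b) k).
Local Notation up := (up b k).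
Local Notation wp l p := (wt D l `&` mod_part M p).

Hypothesis linJ : linear J.
Hypothesis HJ : (t = 0 /\ forall m, J m = 0) \/
  ((forall m, E *> J m = m) /\ (forall m, J (E *> m) = m)).

Let J0 : J 0 = 0.
Proof. by have := linJ (-1) 0 0; rewrite scaler0 addr0 scaleN1r addNr. Qed.
Let JZ a m : J (a *: m) = a *: J m.
Proof. by have := linJ a m 0; rewrite J0 !addr0. Qed.
Let JD m m' : J (m + m') = J m + J m'.
Proof. by have := linJ 1 m m'; rewrite !scale1r. Qed.
(** Applying $E$ to the right-hand side returns $um$: its expansion stops because $[E,[E,u]]=0$. *)
Lemma J_act u p m : lie_part g p u -> [E; [E; u]] = 0 ->
  J (u *> m) = u *> J m - [E; u] *> J (J m).
Proof.
move=> pu EEu; case: HJ => [[_ Jz]|[EJ JE]]; first by rewrite !Jz !actr0 subrr.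
have EK (v : g) q z : lie_part g q v -> E *> v *> z = v *> E *> z + [E; v] *> z.
  by move=> qv; exact: (act_e z (EV_even D b k) qv).
rewrite -[RHS]JE; congr J.
have pEu : lie_part g (false (+) p) [E; u] by apply: bracket_part => //; exact: EV_even.
by rewrite actBr (EK _ _ _ pu) (EK _ _ _ pEu) !EJ EEu act0l addr0 addrK.
Qed.

Lemma J_comm u p m : lie_part g p u -> [E; u] = 0 -> J (u *> m) = u *> J m.
Proof. by move=> pu Eu; rewrite (J_act m pu) Eu ?bracket0r // act0l subr0. Qed.

Lemma EJ_or m : t = 0 \/ E *> J m = m.
Proof. by case: HJ => [[-> _]|[EJ _]]; [left|right]. Qed.

(* "E^t u E^-t" for J = E^-1: the higher terms of the expansion vanish when
   [E; [E; u]] = 0. *)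
Definition pr u m : M := u *> m + t *: ([E; u] *> J m).

(** The series $E^tFE^{-t}=F+t[E,F]E^{-1}+\binom t2[E,[E,F]]E^{-2}$, with $[E,[E,F]]=2c_k^2E$. *)
Definition prF m : M :=
  F *> m + t *: ([E; F] *> J m) + (t ^+ 2 - t) *: (c k ^+ 2 *: J m).

Lemma pr_linear u : linear (pr u).
Proof.
move=> a m m'; rewrite /pr actPr linJ actPr !scalerDr addrACA.
by rewrite [t *: (a *: _)]scalerA mulrC -scalerA.
Qed.

Lemma EEF : [E; [E; F]] = (2%:R * c k ^+ 2) *: E.
Proof.
rewrite EV_self bracketZr bracketDr !(bracket_ev (EV_even D b k) (h_even D _)).
rewrite !EV_root -opprD -scalerDl -scaleNr scalerA; congr (_ *: _).
have := phi_ert D k b k; rewrite eqxx /phi => /(canRL (divfK (cc_neq0 D k))) ->.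
have -> : sg K b * c k * (2%:R * sg K b * c k) = 2%:R * c k ^+ 2 * (sg K b * sg K b) by ring.
by rewrite sg2 mulr1.
Qed.

Lemma down_root o : ~~ up o -> [E; [E; od o]] = 0.
Proof.
move=> _; have [a [o' [uo' ->]]] := EV_down D b k o.
by rewrite bracketZr EV_up // scaler0.
Qed.

Lemma E_odd u : lie_part g true u -> lie_part g true [E; u].
Proof. by move=> ou; exact: bracket_eo (EV_even D b k) ou. Qed.

(** For $J=E^{-1}$ and integral $t$ this is conjugation of a relation by $E^t$. For arbitrary $t$
    the terms with $1$, $J$ and $J^2$ are compared separately. *)
Lemma pr_anticommute o o' r m : ~~ up o -> ~~ up o' -> [od o; od o'] = r *: F ->
  pr (od o) (pr (od o') m) + pr (od o') (pr (od o) m) = r *: prF m.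
Proof.
move=> uo uo' Er; have [o1 o2] := (od_odd D o, od_odd D o').
set y1 := od o in o1 Er *; set y2 := od o' in o2 Er *.
pose x1 := [E; y1]; pose x2 := [E; y2].
have Ex1 : [E; x1] = 0 by exact: down_root.
have Ex2 : [E; x2] = 0 by exact: down_root.
have ox1 : lie_part g true x1 by exact: E_odd.
have ox2 : lie_part g true x2 by exact: E_odd.
(* In the last coefficient, $t^2$ is the product of the two twists and $-t$ comes from moving [J]
   past [z]. *)
have P (y x z w : g) : x = [E; y] -> w = [E; z] -> lie_part g true z -> [E; w] = 0 ->
  pr y (pr z m) = y *> z *> m + t *: (y *> w *> J m) + t *: (x *> z *> J m) +
     (t ^+ 2 - t) *: (x *> w *> J (J m)).
  move=> Ex Ew oz Ew0; rewrite /pr -Ex -Ew.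
  have ow' : lie_part g true w by rewrite Ew; exact: E_odd.
  rewrite JD JZ (J_act m oz) -?Ew // (J_comm _ ow' Ew0).
  rewrite !actDr !actNr !actZr !scalerDr scalerN !scalerA -expr2 scalerBl -!addrA.
  by congr (_ + (_ + (_ + _))); rewrite addrC.
rewrite (P y1 x1 y2 x2 erefl erefl o2 Ex2) (P y2 x2 y1 x1 erefl erefl o1 Ex1).
(* [A1], [A2], [A3] are the relation $[y_1,y_2]=rF$ and its images under $\mathrm{ad}\,E$ once and
   twice, the last one halved. *)
have A1 : y1 *> y2 *> m + y2 *> y1 *> m = r *: (F *> m).
  by rewrite -act_oo // Er actZl.
have A2 : (y1 *> x2 *> J m + x1 *> y2 *> J m) + (y2 *> x1 *> J m + x2 *> y1 *> J m) =
    r *: ([E; F] *> J m).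
  rewrite -actZl -bracketZr -Er (jacobi_e _ (EV_even D b k) o1) actDl.
  rewrite (act_oo _ ox1 o2) (act_oo _ o1 ox2) -/x1 -/x2.
  by rewrite [y1 *> _ + _]addrC addrACA.
have A3 : x1 *> x2 *> J (J m) + x2 *> x1 *> J (J m) = (r * c k ^+ 2) *: (E *> J (J m)).
  rewrite -act_oo // -actZl; congr (act _ _).
  have : [E; [E; [y1; y2]]] = r *: [E; [E; F]] by rewrite Er !bracketZr.
  rewrite EEF !(jacobi_e _ (EV_even D b k) o1) bracketDr.
  rewrite (jacobi_e _ (EV_even D b k) ox1) (jacobi_e _ (EV_even D b k) o1) Ex1 Ex2.
  rewrite bracket0l bracket0r add0r addr0 -/x1 -/x2 -mulr2n -scaler_nat.
  have n2 : (2%:R : K) != 0 by rewrite pnatr_eq0.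
  by move=> H; apply: (scalerI n2); rewrite H !scalerA; congr (_ *: _); ring.
have [t0|EJ] := EJ_or (J m).
  rewrite /prF t0 !(scale0r, expr0n, mul0r, subr0, addr0) /=; exact: A1.
rewrite EJ in A3.
have -> : forall a1 a2 a3 a4 b1 b2 b3 b4 : M,
    (a1 + a2 + a3 + a4) + (b1 + b2 + b3 + b4) = (a1 + b1) + ((a2 + a3) + (b2 + b3)) + (a4 + b4).
  move=> a1 a2 a3 a4 b1 b2 b3 b4.
  by rewrite addrACA -[a1 + a2 + a3]addrA -[b1 + b2 + b3]addrA [(a1 + _) + _]addrACA.
rewrite -!scalerDr A1 A2 A3 /prF !scalerDr !scalerA [r * t]mulrC.
by congr (_ + _ *: _); ring.
Qed.

Lemma has_root_bracket u p (v : g) r r' : lie_part g p u -> has_root D u r -> has_root D v r' ->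
  has_root D [u; v] (r + r').
Proof.
move=> pu ur vr i; rewrite (jacobi_e _ (h_even D i) pu) ur vr bracketZl bracketZr -scalerDl.
by rewrite ffunE.
Qed.

Lemma wt_J l m : wt D l m -> wt D (l - ert D b k) (J m).
Proof.
move=> lm i; case: HJ => [[_ Jz]|[EJ _]]; first by rewrite Jz actr0 scaler0.
have Eh : [E; h i] = - (ert D b k i *: E).
  by rewrite (bracket_ev (EV_even D b k) (h_even D i)) EV_root.
have EEh : [E; [E; h i]] = 0.
  rewrite Eh -scaleNr bracketZr (_ : [E; E] = 0) ?scaler0 //.
  have := bracket_ev (EV_even D b k) (EV_even D b k) => /eqP.
  by rewrite -addr_eq0 -mulr2n -scaler_nat scaler_eq0 pnatr_eq0 => /eqP.
have := J_act m (h_even D i) EEh; rewrite lm JZ Eh -scaleNr actZl EJ scaleNr opprK.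
by move/(canLR (addrK _)) <-; rewrite !ffunE scalerBl.
Qed.

Lemma part_J p m : mod_part M p m -> mod_part M p (J m).
Proof.
have gM := mod_grading M; have Z q : mod_part M q 0 by exact: subspace0 (grading_sub gM q).
move=> pm; case: HJ => [[_ ->]//|[EJ JE]].
have [w0 [w1 [P0 P1 Jm]]] := grading_sum gM (J m).
have Ep q z : mod_part M q z -> mod_part M q (E *> z) by exact: (act_part (EV_even D b k)).
have Em : E *> w0 + E *> w1 = m by rewrite -actDr -Jm.
rewrite Jm; case: p pm => pm.
  have [E0 _] := grading_uniq gM (Ep _ _ P0) (Ep _ _ P1) (Z false) pm (etrans Em (esym (add0r m))).
  by rewrite -[w0]JE E0 J0 add0r.
have [_ E1] := grading_uniq gM (Ep _ _ P0) (Ep _ _ P1) pm (Z true) (etrans Em (esym (addr0 m))).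
by rewrite -[w1]JE E1 J0 addr0.
Qed.

Lemma wt_pr o l m : wt D l m -> wt D (ort D o + l) (pr (od o) m).
Proof.
move=> lm; rewrite /pr; apply: (subspaceD (subspace_wt _ _ _)).
  by apply: wt_act lm; [exact: od_odd|exact: od_root].
apply: (subspaceZ _ (subspace_wt _ _ _)).
have -> : ort D o + l = (ert D b k + ort D o) + (l - ert D b k).
  by rewrite [ert D b k + _]addrC addrACA subrr addr0.
apply: wt_act (wt_J lm); first exact: E_odd (od_odd D o).
exact: has_root_bracket (EV_even D b k) (EV_root D b k) (od_root D o).
Qed.

Lemma part_pr o p m : mod_part M p m -> mod_part M (~~ p) (pr (od o) m).
Proof.
move=> pm; rewrite /pr; have sP := grading_sub (mod_grading M) (~~ p).
apply: (subspaceD sP); first exact: (act_part (od_odd D o) pm).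
by apply: (subspaceZ _ sP); exact: (act_part (E_odd (od_odd D o)) (part_J pm)).
Qed.

Lemma pr0 u : pr u 0 = 0.
Proof. by have := pr_linear u (-1) 0 0; rewrite scaler0 addr0 scaleN1r addNr. Qed.
Lemma prD u m m' : pr u (m + m') = pr u m + pr u m'.
Proof. by have := pr_linear u 1 m m'; rewrite !scale1r. Qed.
Lemma prZ u a m : pr u (a *: m) = a *: pr u m.
Proof. by have := pr_linear u a m 0; rewrite pr0 !addr0. Qed.

Lemma down_down o o' : ~~ up o -> ~~ up o' -> exists r, [od o; od o'] = r *: F.
Proof. by rewrite -!upN; exact: up_up. Qed.

Lemma pr_sq o m : ~~ up o -> pr (od o) (pr (od o) m) = 0.
Proof.
move=> uo; have := @pr_anticommute o o 0 m uo uo.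
rewrite od_sq !scale0r => /(_ erefl) /eqP; rewrite -mulr2n -scaler_nat scaler_eq0.
by rewrite pnatr_eq0 => /eqP.
Qed.

(** The twisted $F$ is $AB+BA$ for two twisted lower vectors of square zero, so it commutes with $A$
    and $B$. For any other lower vector, its anticommutators with $A$ and $B$ are multiples of
    [prF], and the claim is formal. *)
Lemma prF_comm o m : ~~ up o -> prF (pr (od o) m) = pr (od o) (prF m).
Proof.
move=> uo; pose A := pr (od (~~ b, Some (nxt k))); pose B := pr (od (~~ b, Some (nxt (nxt k)))).
have uA : ~~ up (~~ b, Some (nxt k)) by rewrite -upN -mem_ups !inE eqxx.
have uB : ~~ up (~~ b, Some (nxt (nxt k))) by rewrite -upN -mem_ups !inE eqxx orbT.
pose Y := pr (od o).
have AB z : prF z = A (B z) + B (A z).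
  by rewrite (pr_anticommute (r := 1) z uA uB) ?scale1r.
have [r1 E1] := down_down uo uA; have [r2 E2] := down_down uo uB.
have YA z : Y (A z) = r1 *: prF z - A (Y z) by rewrite -(pr_anticommute z uo uA E1) addrK.
have YB z : Y (B z) = r2 *: prF z - B (Y z) by rewrite -(pr_anticommute z uo uB E2) addrK.
have AD z z' : A (z + z') = A z + A z' by exact: prD.
have BD z z' : B (z + z') = B z + B z' by exact: prD.
have AZB a z z' : A (a *: z - z') = a *: A z - A z' by rewrite AD /A prZ -scaleN1r prZ scaleN1r.
have BZB a z z' : B (a *: z - z') = a *: B z - B z' by rewrite BD /B prZ -scaleN1r prZ scaleN1r.
have A0 : A 0 = 0 by exact: pr0.
have B0 : B 0 = 0 by exact: pr0.
have AA z : A (A z) = 0 by exact: pr_sq.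
have BB z : B (B z) = 0 by exact: pr_sq.
have FA z : prF (A z) = A (prF z) by rewrite (AB (A z)) AA B0 addr0 (AB z) AD AA add0r.
have FB z : prF (B z) = B (prF z) by rewrite (AB (B z)) BB A0 add0r (AB z) BD BB addr0.
have YD z z' : Y (z + z') = Y z + Y z' by exact: prD.
have cancel (P Q R S : M) : P - (Q - R) + (Q - (P - S)) = R + S.
  by rewrite !opprB addrACA [R - Q + _]addrACA -opprD [Q + P]addrC addrC subrK.
rewrite -/Y [in RHS]AB YD (YA (B m)) (YB (A m)) (YB m) (YA m) FA FB AZB BZB cancel.
exact: AB.
Qed.

(** The lower operators are applied in turn, each only if it does not kill the current vector.
    Earlier conditions persist, since anticommutators are multiples of [prF], which commutes with
    them and kills [v]. *)
Lemma exists_killed v l p : v <> 0 -> wp l p v -> prF v = 0 ->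
  exists v' l' p', [/\ v' <> 0, wp l' p' v' & forall o, ~~ up o -> pr (od o) v' = 0].
Proof.
move=> v0 lpv Fv.
suff H (s : seq oddix) : (forall o, o \in s -> ~~ up o) -> exists v' l' p',
    [/\ v' <> 0, wp l' p' v', prF v' = 0 & forall o, o \in s -> pr (od o) v' = 0].
  have [|v' [l' [p' [v'0 H1 _ H2]]]] := H (ups (~~ b) k).
    by move=> o; rewrite mem_ups upN.
  exists v', l', p'; split=> // o; rewrite -upN -mem_ups; exact: H2.
elim: s => [_|o s IH ds]; first by exists v, l, p; split.
have [|w [l' [p' [w0 [lw pw] Fw kw]]]] := IH.
  by move=> o' so'; apply: ds; rewrite inE so' orbT.
have uo : ~~ up o by apply: ds; exact: mem_head.
have [ow|ow] := pselect (pr (od o) w = 0).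
  by exists w, l', p'; split=> // o'; rewrite inE => /orP[/eqP ->|/kw].
exists (pr (od o) w), (ort D o + l'), (~~ p'); split=> //.
- by split; [exact: wt_pr|exact: part_pr].
- by rewrite prF_comm // Fw pr0.
- move=> o'; rewrite inE => /orP[/eqP ->|so']; first exact: pr_sq.
  have uo' : ~~ up o' by apply: ds; rewrite inE so' orbT.
  have [r Er] := down_down uo' uo.
  have := pr_anticommute w uo' uo Er.
  by rewrite (kw _ so') pr0 addr0 Fw scaler0.
Qed.

Section Other.
Variables (b' : bool) (k' : 'I_3).
Hypothesis kk' : k != k'.
Local Notation A := (EV b' k').

Let EA : [E; A] = 0. Proof. exact: EV_comm. Qed.
Let AE : [A; E] = 0. Proof. by apply: EV_comm; rewrite eq_sym. Qed.

Lemma AEod o o' a : [A; od o] = a *: od o' -> [A; [E; od o]] = a *: [E; od o'].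
Proof.
by move=> Eo; rewrite (jacobi_e _ (EV_even D b' k')
  (EV_even D b k)) AE bracket0l add0r Eo bracketZr.
Qed.

Lemma J_EV m : J (A *> m) = A *> J m.
Proof. exact: J_comm (EV_even D b' k') EA. Qed.

Lemma pr_EV o o' a m : [A; od o] = a *: od o' ->
  pr (od o) (A *> m) = A *> pr (od o) m - a *: pr (od o') m.
Proof.
move=> Eo; have oo := od_odd D o; have eA := EV_even D b' k'.
rewrite /pr J_EV actDr actZr (act_e _ eA oo) (act_e _ eA (E_odd oo)) Eo (AEod Eo) !actZl.
rewrite !scalerDr opprD addrACA addrK !scalerA (mulrC t) addrK //.
Qed.

Lemma killed_EV m : (forall o, ~~ up o -> pr (od o) m = 0) ->
  forall o, ~~ up o -> pr (od o) (A *> m) = 0.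
Proof.
move=> km o uo; have [a [o' [uo' Eo]]] := EV_other D b b' o kk'.
by rewrite (pr_EV _ Eo) !km ?uo' // actr0 scaler0 subr0.
Qed.

(** One scalar serves all lower roots: the other two $\mathfrak{sl}_2$ mix these roots, and only a
    common scalar survives their action. *)
Definition Rel z z' := exists r, forall o, ~~ up o -> od o *> z = r *: ([E; od o] *> z').

Lemma Rel_EV z z' : Rel z z' -> Rel (A *> z) (A *> z').
Proof.
move=> [r Hr]; exists r => o uo; have oo := od_odd D o; have eA := EV_even D b' k'.
have [a [o' [uo' Eo]]] := EV_other D b b' o kk'.
have E1 := act_e z eA oo; have E2 := act_e z' eA (E_odd oo).
rewrite Eo actZl in E1; rewrite (AEod Eo) actZl in E2.
move/(canLR (addrK _)): E1 => <-; move/(canLR (addrK _)): E2 => <-.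
by rewrite !Hr ?uo' // actZr scalerBr !scalerA mulrC.
Qed.

End Other.

Definition vj (j : int) v : M := if j is Posz n then iter n (act E) v else iter `|j| J v.

Lemma vj_linear j : linear (vj j).
Proof.
case: j => n; first exact: iter_act_linear.
move=> a x y; rewrite /vj; elim: `|_|%N => //= m ->; exact: linJ.
Qed.

Lemma wt_vj j l v : wt D l v -> wt D (ert D b k *~ j + l) (vj j v).
Proof.
move=> lv; case: j => n; first by rewrite -pmulrn; exact: wt_iter.
have -> : vj (Negz n) v = iter n.+1 J v by [].
rewrite NegzE mulrNz -pmulrn; elim: n.+1 => [|m IH] /=.
  by rewrite mulr0n oppr0 add0r.
by rewrite mulrS opprD -addrA addrC; exact: wt_J.
Qed.

Lemma vj_EV j b' k' v : k != k' -> EV b' k' *> vj j v = vj j (EV b' k' *> v).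
Proof.
move=> kk'; case: j => n; rewrite /vj.
  by apply: (@iter_commute _ _ _ (act (EV b' k'))) => z; apply: EV_EV; rewrite eq_sym.
by apply: (@iter_commute _ _ _ (act (EV b' k'))) => z; rewrite J_EV.
Qed.

Lemma E_vj j v : exists a, E *> vj j v = a *: vj (j + 1) v.
Proof.
case: j => n; first by exists 1; rewrite scale1r -PoszD addn1.
have -> : vj (Negz n + 1) v = iter n J v.
  by rewrite NegzE -addn1 PoszD opprD addrNK /vj; case: (n).
case: HJ => [[_ Jz]|[EJ _]]; last by exists 1; rewrite scale1r /= EJ.
by exists 0; rewrite scale0r /= Jz actr0.
Qed.

(** The scalar is $-(t+j)$: being killed means $yv=-t[E,y]Jv$, and every power of $E$ moved past $y$
    shifts it by one. *)
Lemma Rel_vj j v : (forall o, ~~ up o -> pr (od o) v = 0) -> Rel (vj j v) (vj (j - 1) v).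
Proof.
move=> kv.
have base o : ~~ up o -> od o *> v = - t *: ([E; od o] *> J v).
  by move=> uo; apply/eqP; rewrite scaleNr -addr_eq0; apply/eqP; exact: kv.
case: j => n.
- exists (- (t + n%:R)) => o uo; have oo := od_odd D o; have eE := EV_even D b k.
  elim: n => [|n IH]; first by rewrite addr0; exact: base.
  have := act_e (iter n (act E) v) eE oo => /(canLR (addrK _)) H.
  rewrite [vj _ _]/= -H [_ *> iter n _ v]IH actZr.
  have Ecomm z : E *> [E; od o] *> z = [E; od o] *> E *> z.
    by rewrite (act_e z eE (E_odd oo)) down_root // act0l addr0.
  rewrite Ecomm -[n.+1]addn1 PoszD addrK.
  have -> : - (t + n%:R) *: ([E; od o] *> E *> vj (n%:Z - 1) v) = - (t + n%:R) *: ([E;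
    od o] *> vj n v).
    (* At the bottom, $EJv$ is $v$ unless $t=0$, and then the coefficient vanishes. *)
    case: n {IH H} => [|n]; last first.
      by have -> : vj (n.+1%:Z - 1) v = iter n (act E) v by rewrite -addn1 PoszD addrK.
    by rewrite addr0 /=; have [->|->] := EJ_or v; rewrite // oppr0 !scale0r.
  by rewrite natrD mulr1n addrA [in RHS]opprD [RHS]scalerDl scaleN1r.
- suff H (m : nat) o : ~~ up o -> od o *> iter m.+1 J v = (- t + m.+1%:R) *: ([E;
  od o] *> iter m.+2 J v).
    exists (- t + n.+1%:R) => o uo.
    have -> : vj (Negz n) v = iter n.+1 J v by [].
    have -> : vj (Negz n - 1) v = iter n.+2 J v by rewrite NegzE -opprD -PoszD addn1.
    exact: H.
  move=> uo; case: HJ => [[_ Jz]|[EJ JE]]; first by rewrite /= !Jz !actr0 scaler0.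
  have Jod z : od o *> J z = J (od o *> z) + [E; od o] *> J (J z).
    by rewrite (J_act z (od_odd D o) (down_root uo)) subrK.
  have Jx z : J ([E; od o] *> z) = [E; od o] *> J z.
    exact: J_comm (E_odd (od_odd D o)) (down_root uo).
  elim: m => [|m IH]; first by rewrite /= Jod base // JZ Jx scalerDl scale1r.
  by rewrite [iter m.+2 _ _]iterS Jod IH JZ Jx -!iterS -[m.+2%:R]natr1 addrA [RHS]scalerDl scale1r.
Qed.

End Twist.

(** * Degree *)

Fixpoint sublists (T : Type) (s : seq T) : seq (seq T) :=
  if s is o :: s' then sublists s' ++ map (cons o) (sublists s') else [:: [::]].

(** * A spanning set built from one vector killed by the lower operators *)

Section Spanning.
Variables (K : numFieldType) (g : lieSuperalgebra K) (D : d21 g) (M : supermodule g).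
Variables (b : bool) (k : 'I_3) (t : K) (J : M -> M).
Implicit Types (u : g) (m z v w : M) (o : oddix).
Local Notation "[ x ; y ]" := (bracket x y).
Local Notation "u *> m" := (act u m) (at level 35, right associativity).
Local Notation e := (ee D).
Local Notation h := (hh D).
Local Notation EV := (EV D).
Local Notation od := (od D).
Local Notation E := (EV b k).
Local Notation up := (up b k).
Local Notation vj := (vj D b k J).

Hypothesis linJ : linear J.
Hypothesis HJ : (t = 0 /\ forall m, J m = 0) \/
  ((forall m, E *> J m = m) /\ (forall m, J (E *> m) = m)).

Variables (v : M) (l : {ffun 'I_3 -> K}) (p : bool).
Hypothesis (v0 : v <> 0) (lv : wt D l v) (pv : mod_part M p v).
Hypothesis kv : forall o, ~~ up o -> pr D b k t J (od o) v = 0.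
Hypothesis Tv : forall k', k != k' -> exists a, TT D M k' v = a *: v.

Definition others : seq 'I_3 := [:: nxt k; nxt (nxt k)].
Local Notation fs := others.
Definition rung j jj : M := ladn D fs jj (vj j v).
(** Stable under [E], the [h i] and the other two $\mathfrak{sl}_2$. The action of $F$ is not
    tracked: the simple root vectors generate, and they are all odd. *)
Definition V0 := span [set z | exists j jj, z = rung j jj].

Lemma mem_others k' : (k' \in fs) = (k != k').
Proof.
rewrite !inE; have d := distinct_nxt k; have [d12 d1 d2] := distinctP d.
have [->|->|->] := distinct_or k' d; rewrite eqxx ?orbT //.
- by rewrite [k == _]eq_sym d1.
- by rewrite [k == _]eq_sym d2.
- by rewrite ![k == nxt _]eq_sym (negbTE d1) (negbTE d2).
Qed.

Lemma uniq_others : uniq fs.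
Proof. by have [d12 _ _] := distinctP (distinct_nxt k); rewrite /= inE d12. Qed.

Let sV0 : subspace V0. Proof. exact: subspace_span. Qed.

Lemma rung_wt j jj : wt D (\sum_(k' <- fs) ert D true k' *~ jj k' + (ert D b k *~ j +
  l)) (rung j jj).
Proof. by apply: wt_ladn; exact: wt_vj HJ _ _ _ lv. Qed.

Lemma V0_rung z u : (forall j jj, exists a j' jj', u *> rung j jj = a *: rung j' jj') ->
  V0 z -> V0 (u *> z).
Proof.
move=> H; apply: act_span => _ [j [jj ->]]; have [a [j' [jj' ->]]] := H j jj.
by apply: (subspaceZ _ sV0); apply: sub_span; exists j', jj'.
Qed.

Lemma ladnZ jj a z : ladn D fs jj (a *: z) = a *: ladn D fs jj z.
Proof.
have L := @ladn_linear _ _ D M fs jj; have Z : ladn D fs jj (0 : M) = 0.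
  by have := L (-1) 0 0; rewrite scaler0 addr0 scaleN1r addNr.
by have := L a z 0; rewrite Z !addr0.
Qed.

Lemma vjZ j a z : vj j (a *: z) = a *: vj j z.
Proof.
have L := vj_linear D b k linJ j; have Z : vj j 0 = 0.
  by have := L (-1) 0 0; rewrite scaler0 addr0 scaleN1r addNr.
by have := L a z 0; rewrite Z !addr0.
Qed.

Lemma V0_E z : V0 z -> V0 (E *> z).
Proof.
apply: V0_rung => j jj; rewrite /rung ladn_EV; last by rewrite mem_others eqxx.
by have [a ->] := E_vj HJ j v; exists a, (j + 1), jj; rewrite ladnZ.
Qed.

Lemma V0_EV b' k' z : k != k' -> V0 z -> V0 (EV b' k' *> z).
Proof.
move=> kk'; apply: V0_rung => j jj.
(* As [v] is an eigenvector of the other two [TT], the bottom space of each ladder is a line. *)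
pose X := [set y | exists a, y = a *: vj j v].
have sX : subspace X.
  split; first by exists 0; rewrite scale0r.
  by move=> a _ _ [c ->] [d ->]; exists (a * c + d); rewrite scalerDl scalerA.
have Xl : X `<=` wt D (ert D b k *~ j + l).
  move=> _ [a ->]; apply: (subspaceZ _ (subspace_wt _ _ _)).
  exact: wt_vj HJ _ _ _ lv.
have TX k1 : k1 \in fs -> tstab D X k1.
  rewrite mem_others => kk1 _ [a ->]; have [c Tc] := Tv kk1.
  exists (a * c); rewrite TTE actZr actZr !(vj_EV HJ) // -TTE Tc vjZ scalerA //.
have k'fs : k' \in fs by rewrite mem_others.
have Xv : X (vj j v) by exists 1; rewrite scale1r.
have [jj' [_ [a ->] ->]] := ladn_step jj b' uniq_others k'fs sX Xl TX Xv.
by exists a, j, jj'; rewrite ladnZ.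
Qed.

Lemma V0_h i z : V0 z -> V0 (h i *> z).
Proof.
by apply: V0_rung => j jj; eexists _, j, jj; exact: rung_wt.
Qed.

Lemma Rel_lad k' (n : int) z z' : k != k' -> Rel D b k z z' ->
  Rel D b k (lad D k' n z) (lad D k' n z').
Proof.
move=> kk' R.
have H b1 (m : nat) : Rel D b k (iter m (act (EV b1 k')) z) (iter m (act (EV b1 k')) z').
  by elim: m => //= m; exact: Rel_EV.
by case: n => n; exact: H.
Qed.

Lemma rung_Rel j jj : Rel D b k (rung j jj) (rung (j - 1) jj).
Proof.
have := Rel_vj linJ HJ j kv; rewrite /rung.
have : {subset fs <= fs} by [].
elim: {1 3 4}fs => //= k' s IH sub R; apply: Rel_lad; last first.
  by apply: IH => // k1 k1s; apply: sub; rewrite inE k1s orbT.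
by rewrite -mem_others; apply: sub; exact: mem_head.
Qed.

(** Ordered products over the sublists of [s], applied to [V0]; the recursion plays the role of a
    PBW ordering. *)
Fixpoint VV (s : seq oddix) : set M :=
  if s is o :: s' then [set z | exists x x', [/\ VV s' x, VV s' x' & z = x + od o *> x']]
  else V0.

Lemma sVV s : subspace (VV s).
Proof.
elim: s => //= o s sS; split.
  by exists 0, 0; rewrite actr0 addr0; split=> //; exact: subspace0.
move=> a _ _ [x [x' [Vx Vx' ->]]] [y [y' [Vy Vy' ->]]].
exists (a *: x + y), (a *: x' + y').
by split; [case: sS => _; apply|case: sS => _; apply|rewrite actPr scalerDr addrACA].
Qed.

Lemma VV_sub o s : VV s `<=` VV (o :: s).
Proof. by move=> z Vz; exists z, 0; rewrite actr0 addr0; split=> //; exact: subspace0 (sVV s). Qed.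

Lemma VV_od o s z : VV s z -> VV (o :: s) (od o *> z).
Proof. by move=> Vz; exists 0, z; rewrite add0r; split=> //; exact: subspace0 (sVV s). Qed.

Lemma VV_E s z : all up s -> VV s z -> VV s (E *> z).
Proof.
elim: s z => [z _|o s IH z /andP[uo us] /= [x [x' [Vx Vx' ->]]]]; first exact: V0_E.
exists (E *> x), (E *> x'); split; [exact: IH|exact: IH|].
rewrite actDr (act_e _ (EV_even D b k) (od_odd D o)) EV_up //.
by rewrite act0l addr0.
Qed.

(** Reordering two upper vectors leaves a multiple of [E], under which every [VV s] is stable. *)
Lemma VV_up s o z : all up s -> o \in s -> VV s z -> VV s (od o *> z).
Proof.
elim: s z => // o1 s IH z /andP[u1 us]; rewrite inE.
have [<- _ /= [x [x' [Vx Vx' ->]]]|ne /= os [x [x' [Vx Vx' ->]]]] := eqVneq o o1.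
  rewrite actDr; have -> : od o *> od o *> x' = 0.
    have := act_oo x' (od_odd D o) (od_odd D o); rewrite od_sq act0l -mulr2n -scaler_nat.
    by move/esym/eqP; rewrite scaler_eq0 pnatr_eq0 => /eqP.
  rewrite addr0; exact: VV_od.
have uo : up o by move/allP: us; apply.
have [r Er] := up_up D uo u1.
rewrite actDr; apply: (subspaceD (sVV (o1 :: s))).
  by apply: VV_sub; exact: IH.
have := act_oo x' (od_odd D o) (od_odd D o1); rewrite Er actZl => /esym/(canRL (addrK _)) ->.
apply: (subspaceB (sVV (o1 :: s))).
  by apply: VV_sub; apply: (subspaceZ _ (sVV s)); exact: VV_E.
by apply: VV_od; exact: IH.
Qed.

Local Notation V4 := (VV (ups b k)).

Let all_ups : all up (ups b k). Proof. by apply/allP => o; rewrite mem_ups. Qed.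

Lemma V4_up o z : up o -> V4 z -> V4 (od o *> z).
Proof. by rewrite -mem_ups; exact: VV_up. Qed.

Lemma V0_V4 : V0 `<=` V4.
Proof. by move=> z Vz; do 4!apply: VV_sub. Qed.

Lemma V4_even u : lie_part g false u -> (forall z, V0 z -> V4 (u *> z)) ->
  (forall o, up o -> exists a o', up o' /\ [u; od o] = a *: od o') ->
  forall z, V4 z -> V4 (u *> z).
Proof.
move=> eu uV0 ru.
suff H s : all up s -> VV s `<=` V4 -> forall z, VV s z -> V4 (u *> z) by exact: H.
elim: s => [//|o s IH] /andP[uo us] sV z [x [x' [Vx Vx' ->]]].
have sV' : VV s `<=` V4 by move=> y /(@VV_sub o) /sV.
rewrite actDr; apply: (subspaceD (sVV _)); first exact: IH.
rewrite (act_e _ eu (od_odd D o)); apply: (subspaceD (sVV _)).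
  by apply: V4_up => //; exact: IH.
have [a [o' [uo' ->]]] := ru o uo; rewrite actZl; apply: (subspaceZ _ (sVV _)).
by apply: V4_up => //; exact: sV'.
Qed.

Lemma V4_EV b' k' z : k != k' -> V4 z -> V4 (EV b' k' *> z).
Proof.
move=> kk'; apply: V4_even; first exact: EV_even.
  by move=> y Vy; apply: V0_V4; exact: V0_EV.
by move=> o uo; have [a [o' [uo' Eo]]] := EV_other D b b' o kk'; exists a, o'; rewrite uo'.
Qed.

Lemma V4_h i z : V4 z -> V4 (h i *> z).
Proof.
apply: V4_even; first exact: h_even.
  by move=> y Vy; apply: V0_V4; exact: V0_h.
by move=> o uo; exists (ort D o i), o; rewrite od_root.
Qed.

(** On a rung a lower vector acts as an upper one does on the preceding rung. Past an upper vector
    it leaves elements of $\mathfrak{h}$ or of the other two $\mathfrak{sl}_2$. *)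
Lemma V4_down o z : ~~ up o -> V4 z -> V4 (od o *> z).
Proof.
move=> do_.
have base : V0 `<=` act (od o) @^-1` V4.
  apply: span_min; first exact: (subspace_preim (act (od o)) (sVV (ups b k))).
  move=> _ [j [jj ->]]; rewrite -[(_ @^-1` _) _]/(V4 (od o *> rung j jj)).
  have [r Hr] := rung_Rel j jj; rewrite Hr //; apply: (subspaceZ _ (sVV _)).
  have [a [o' [uo' ->]]] := EV_down D b k o; rewrite actZl; apply: (subspaceZ _ (sVV _)).
  by apply: V4_up => //; apply: V0_V4; apply: sub_span; exists (j - 1), jj.
suff H s : all up s -> VV s `<=` V4 -> forall z, VV s z -> V4 (od o *> z) by exact: H.
elim: s => [_ _|o1 s IH /andP[u1 us] sV y [x [x' [Vx Vx' ->]]]]; first exact: base.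
have sV' : VV s `<=` V4 by move=> y' /(@VV_sub o1) /sV.
rewrite actDr; apply: (subspaceD (sVV _)); first exact: IH.
have := act_oo x' (od_odd D o) (od_odd D o1) => /esym/(canRL (addrK _)) ->.
apply: (subspaceB (sVV _)); last by apply: V4_up => //; exact: IH.
apply: (down_up (sVV _) _ _ do_ u1 (sV' _ Vx')) => *; [exact: V4_EV|exact: V4_h].
Qed.

Lemma V4_full : simple_module M -> forall z, V4 z.
Proof.
move=> simM; apply: (simple_full (D := D) simM (sVV _) _ pv v0).
  move=> b1 i z; have [ui|di] := boolP (up (b1, Some i)).
    exact: (V4_up ui).
  exact: (V4_down di).
apply: V0_V4; apply: sub_span; exists 0, (fun=> 0).
by rewrite /rung /others.
Qed.

Definition vec (q : seq oddix) j jj : M := word D q (rung j jj).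

Lemma VV_span s : VV s `<=` span [set z | exists q j jj, q \in sublists s /\ z = vec q j jj].
Proof.
elim: s => [|o s IH] /=.
  by apply: span_mono => _ [j [jj ->]]; exists [::], j, jj; rewrite inE.
move=> z [x [x' [Vx Vx' ->]]]; apply: (subspaceD (subspace_span _)).
  apply: span_mono (IH _ Vx) => _ [q [j [jj [qs ->]]]].
  by exists q, j, jj; rewrite mem_cat qs.
have := @span_image _ _ (act (od o)) _ _ (IH _ Vx');
  apply: span_mono => _ [_ [q [j [jj [qs ->]]]] <-].
exists (o :: q), j, jj; split=> //.
by rewrite mem_cat; apply/orP; right; exact: map_f.
Qed.

Lemma vec_wt q j jj : wt D (\sum_(o <- q) ort D o +
  (\sum_(k' <- fs) ert D true k' *~ jj k' + (ert D b k *~ j + l))) (vec q j jj).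
Proof. by apply: wt_word; exact: rung_wt. Qed.

Lemma sublists_up s q : all up s -> q \in sublists s -> all up q.
Proof.
elim: s q => [|o s IH] q /=; first by rewrite inE => _ /eqP ->.
move=> /andP[uo us]; rewrite mem_cat => /orP[|/mapP[q' q's ->] /=]; first exact: IH.
by rewrite uo IH.
Qed.

Local Notation weight q j jj := (\sum_(o <- q) ort D o +
  (\sum_(k' <- fs) ert D true k' *~ jj k' + (ert D b k *~ j + l))).

Lemma phi_others k' jj : phi D k' (\sum_(i <- fs) ert D true i *~ jj i) =
  if k' == k then 0 else (jj k')%:~R * 2%:R.
Proof.
have d := distinct_nxt k; have [d12 d1 d2] := distinctP d.
rewrite /others !big_cons big_nil addr0 phiD !phi_mulz !phi_ert /sg mulr1.
have [->|->|->] := distinct_or k' d; rewrite ?eqxx.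
- by rewrite eq_sym (negbTE d12) (negbTE d1) mulr0 addr0.
- by rewrite (negbTE d12) (negbTE d2) mulr0 add0r.
- by rewrite (negbTE d1) (negbTE d2) !mulr0 addr0.
Qed.

(** Up to one common sign, the $k$-th coroot is 1 on upper odd roots, 2 on the root of [E] and 0 on
    the other even roots. *)
Lemma weight_k q j jj q' j' jj' : all up q -> all up q' ->
  weight q j jj = weight q' j' jj' -> (size q)%:Z + 2%:Z * j = (size q')%:Z + 2%:Z * j'.
Proof.
move=> uq uq' /(congr1 (phi D k)).
have W q1 : all up q1 -> phi D k (\sum_(o <- q1) ort D o) = (size q1)%:R * sg K b.
  elim: q1 => [_|o q1 IH /andP[uo us]]; first by rewrite big_nil /phi !ffunE addr0 oppr0 !mul0r.
  by rewrite big_cons phiD (phi_ort _ b) uo IH // -[(size (_ :: _))%:R]natr1 mulrDl mul1r addrC.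
rewrite !phiD !W // !phi_others eqxx !phi_mulz !phi_ert eqxx !add0r !addrA => /addIr E.
apply/eqP; rewrite -(eqr_int K) !rmorphD !rmorphM /=; apply/eqP.
apply: (mulIf (sg_neq0 K b)); rewrite -!pmulrn.
have R (x y : K) : (x + 2%:R * y) * sg K b = x * sg K b + y * (2%:R * sg K b) by ring.
by rewrite !R.
Qed.

Lemma weight_others q j jj j' jj' : weight q j jj = weight q j' jj' ->
  forall k', k' \in fs -> jj k' = jj' k'.
Proof.
move=> /addrI E k'; rewrite mem_others => kk'.
have := congr1 (phi D k') E; rewrite !phiD !phi_others eq_sym (negbTE kk').
rewrite !phi_mulz !phi_ert (negbTE kk') !mulr0 !add0r => /addIr /(mulIf _) F.
by apply/eqP; rewrite -(eqr_int K) F // pnatr_eq0.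
Qed.

Lemma vec_eq q j jj jj' : (forall k', k' \in fs -> jj k' = jj' k') ->
  vec q j jj = vec q j jj'.
Proof.
move=> H; rewrite /vec /rung; congr (word _ _ _).
by rewrite /ladn /others /= !H // !inE eqxx ?orbT.
Qed.

Lemma weight_dimle mu : simple_module M -> dimle (wt D mu : set M) 8.
Proof.
move=> simM.
pose ups4 := ups b k.
pose S q := [set z | exists j jj, [/\ z = vec q j jj, wt D mu z & z <> 0]].
have S_uniq q z z' : all up q -> S q z -> S q z' -> z = z'.
  move=> uq [j [jj [-> muz z0]]] [j' [jj' [-> muz' z'0]]].
  have W : weight q j jj = weight q j' jj'.
    by rewrite (wt_uniq (vec_wt q j jj) muz z0) (wt_uniq (vec_wt q j' jj') muz' z'0).
  have Ej : j = j' by have := weight_k uq uq W; lia.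
  by rewrite -Ej; apply: vec_eq; exact: weight_others W.
have /choice[f Hf] : forall q, exists z, forall z', S q z' -> S q z.
  move=> q; have [[z Sz]|N] := pselect (exists z, S q z); first by exists z.
  by exists 0 => z' Sz'; case: N; exists z'.
have [par Hpar] : exists par : bool, forall q z, q \in sublists ups4 -> S q z -> odd (size q) = par.
  have [[q0 [z0 [q0s S0]]]|N] := pselect (exists q z, q \in sublists ups4 /\ S q z); last first.
    by exists true => q z qs Sz; case: N; exists q, z.
  exists (odd (size q0)) => q z qs [j [jj [Ez muz zn0]]].
  have [j0 [jj0 [Ez0 muz0 z0n0]]] := S0; subst z z0.
  have W : weight q j jj = weight q0 j0 jj0.
    by rewrite (wt_uniq (vec_wt q j jj) muz zn0) (wt_uniq (vec_wt q0 j0 jj0) muz0 z0n0).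
  by have := weight_k (sublists_up all_ups qs) (sublists_up all_ups q0s) W;
    move: (size q) (size q0) => n n0; lia.
pose s := [seq f q | q <- sublists ups4 & odd (size q) == par].
(* Of the sixteen sets of upper roots, eight have each parity. *)
have <- : size s = 8%N by rewrite size_map; case: (par).
apply: dimle_span => z muz.
have GW z' : [set z | exists q j jj, q \in sublists ups4 /\ z = vec q j jj] z' ->
    exists l', wt D l' z'.
  by move=> [q [j [jj [_ ->]]]]; eexists; exact: vec_wt.
have := wt_span GW (VV_span (V4_full simM z)) muz.
apply: span_min; first exact: subspace_span.
move=> _ [[q [j [jj [qs ->]]]] muq].
have [->|n0] := pselect (vec q j jj = 0); first exact: subspace0 (subspace_span _).
have Sq : S q (vec q j jj) by exists j, jj.
rewrite (S_uniq q _ (f q) (sublists_up all_ups qs) Sq (Hf q _ Sq)).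
apply: sub_span => /=; apply: map_f; rewrite mem_filter qs andbT.
by rewrite (Hpar q _ qs Sq).
Qed.

End Spanning.

Section Degree.
Variables (K : numClosedFieldType) (g : lieSuperalgebra K) (D : d21 g) (M : supermodule g).
Local Notation "[ x ; y ]" := (bracket x y).
Local Notation "u *> m" := (act u m) (at level 35, right associativity).
Local Notation EV := (EV D).
Local Notation wp l p := (wt D l `&` mod_part M p).

Lemma subspace_wp l p : subspace (wp l p).
Proof. by apply: subspaceI; [exact: subspace_wt|exact: grading_sub (mod_grading M) p]. Qed.

Lemma wp_TT k l p m : wp l p m -> wp l p (TT D M k m).
Proof.
move=> [lm pm]; rewrite TTE; split.
  have := wt_act (EV_even D true k) (EV_root D true k) (wt_act (EV_even D false k)
    (EV_root D false k) lm).
  by rewrite addrA -[false]/(~~ true) ertN subrr add0r.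
exact: (act_part (EV_even D true k) (act_part (EV_even D false k) pm)).
Qed.

Hypotheses (uncK : uncountable_field K) (simM : simple_module M).
Hypothesis weightM : forall m : M, span [set v | exists l, wt D l v] m.

(** The killed vectors of one weight and parity form a space stable under the two remaining [TT],
    which commute; its finite dimension gives a joint eigenvector. *)
Lemma dimle_from_kernel b k t (J : M -> M) v l p mu : linear J ->
  (t = 0 /\ forall m, J m = 0) \/
    ((forall m, EV b k *> J m = m) /\ (forall m, J (EV b k *> m) = m)) ->
  v <> 0 -> wp l p v -> prF D b k t J v = 0 -> dimle (wt D mu : set M) 8.
Proof.
move=> linJ HJ v0 lpv Fv.
have [v1 [l1 [p1 [v10 lp1 kv1]]]] := exists_killed linJ HJ v0 lpv Fv.
have [n dn] := weight_fin D l1 p1 uncK simM.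
pose W := wp l1 p1 `&` [set m | forall o, ~~ up b k o -> pr D b k t J (od D o) m = 0].
have sW : subspace W.
  apply: subspaceI; first exact: subspace_wp.
  split=> [o _|a x y Hx Hy o uo]; first exact: pr0.
  by rewrite (pr_linear D b k t linJ (od D o)) Hx // Hy // scaler0 addr0.
have TW k' x : k != k' -> W x -> W (TT D M k' x).
  move=> kk' [lx kx]; split; first exact: wp_TT.
  by move=> o uo; apply: (killed_EV HJ true kk') => // o' uo'; exact: (killed_EV HJ false kk').
have d := distinct_nxt k; have [d12 d1 d2] := distinctP d.
have k1 : k != nxt k by rewrite eq_sym.
have k2 : k != nxt (nxt k) by rewrite eq_sym.
have Wn : dimle W n by apply: dimle_sub dn => x [].
have [v2 [a [Wv2 v20 T1]]] := exists_eigenvector sW Wn (TW (nxt k) ^~ k1) (conj lp1 kv1) v10.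
pose W2 := W `&` [set x | TT D M (nxt k) x = a *: x].
have sW2 : subspace W2.
  apply: subspaceI => //; split=> [|c x y Ex Ey]; first by rewrite /= !actr0 scaler0.
  rewrite -[(_ : set M) _]/(TT D M (nxt k) (c *: x + y) = a *: (c *: x + y)).
  by rewrite linearP Ex Ey scalerDr !scalerA mulrC.
have W2n : dimle W2 n by apply: dimle_sub Wn => x [].
have TW2 x : W2 x -> W2 (TT D M (nxt (nxt k)) x).
  move=> [Wx Ex]; split; first exact: TW.
  have {}Ex : TT D M (nxt k) x = a *: x by [].
  have : TT D M (nxt k) (TT D M (nxt (nxt k)) x) = a *: TT D M (nxt (nxt k)) x; last by [].
  by rewrite TT_comm Ex linearZ.
have [v3 [c [[[[lv3 pv3] kv3] T3] v30 T4]]] := exists_eigenvector sW2 W2n TW2 (conj Wv2 T1) v20.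
apply: (weight_dimle linJ HJ v30 lv3 pv3 kv3) => // k'; rewrite -mem_others !inE.
by case/orP => /eqP ->; [exists a|exists c].
Qed.

(** The kernel of a root vector is graded and stable under the [h i], hence contains a homogeneous
    weight vector. *)
Lemma dimle_of_kernel b k (m : M) mu : m <> 0 -> EV (~~ b) k *> m = 0 -> dimle (wt D mu : set M) 8.
Proof.
move=> m0 Fm; pose Z := [set z : M | EV (~~ b) k *> z = 0].
have sZ : subspace Z.
  split=> [|a x y /= Ex Ey]; first exact: actr0.
  by rewrite /Z /= actPr Ex Ey scaler0 addr0.
have hZ i z : Z z -> Z (hh D i *> z).
  move=> /= Ez; have := act_e z (h_even D i) (EV_even D (~~ b) k).
  by rewrite Ez actr0 EV_root actZl Ez scaler0 addr0 => /esym.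
have gZ : graded (mod_part M) Z.
  move=> z0 z1 P0 P1 /= E; have gM := mod_grading M.
  have Zr q : mod_part M q 0 by exact: subspace0 (grading_sub gM q).
  apply: (grading_uniq gM).
  - exact: (act_part (EV_even D (~~ b) k) P0).
  - exact: (act_part (EV_even D (~~ b) k) P1).
  - exact: Zr.
  - exact: Zr.
  - by rewrite -actDr E addr0.
have [v [l [p [Zv v0 lv pv]]]] := stable_weight_vector weightM sZ hZ gZ Fm m0.
apply: (@dimle_from_kernel b k 0 (fun=> 0) v l p mu) => //.
- by move=> a x y; rewrite scaler0 addr0.
- by left.
- by rewrite /prF Zv !scale0r !scaler0 !addr0.
Qed.

Lemma weight_dim_le8 mu : dimle (wt D mu : set M) 8.
Proof.
pose k := @Ordinal 3 0 isT.
have [[b [m [m0 Fm]]]|N] := pselect (exists b (m : M), m <> 0 /\ EV (~~ b) k *> m = 0).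
  exact: (@dimle_of_kernel b k m mu m0 Fm).
have inj b (m : M) : EV b k *> m = 0 -> m = 0.
  move=> Em; apply: contrapT => m0; apply: N; exists (~~ b), m.
  by rewrite negbK.
(* [TT] is injective on a finite-dimensional space, hence onto, so its outer factor reaches every
   vector there. *)
have surj_wp l p m : wp l p m -> exists u, EV true k *> u = m.
  have [n dn] := weight_fin D l p uncK simM.
  move=> lpm; have [|u _ Eu] :=
    injective_surjective (subspace_wp l p) dn (fun w => @wp_TT k l p w) _ lpm.
    by move=> w _; rewrite TTE => /inj /inj.
  by exists (EV false k *> u).
have surj (m : M) : exists u : M, EV true k *> u = m.
  have : range (act (EV true k) : M -> M) m; last by case=> u _ <-; exists u.
  apply: weightM; first split.
  - by exists 0; rewrite ?actr0.
  - by move=> a _ _ [x _ <-] [y _ <-]; exists (a *: x + y); rewrite ?actPr.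
  - move=> v [l /wt_parts[w0 [w1 [/surj_wp[u0 E0] /surj_wp[u1 E1] ->]]]].
    by exists (u0 + u1); rewrite ?actDr ?E0 ?E1.
have [J EJ] := choice surj.
have injE (x y : M) : EV true k *> x = EV true k *> y -> x = y.
  move=> E; apply/eqP; rewrite -subr_eq0; apply/eqP; apply: (inj true).
  by rewrite actBr E subrr.
have JE (m : M) : J (EV true k *> m) = m by apply: injE; exact: EJ.
have linJ : linear J by move=> a x y; apply: injE; rewrite actPr !EJ.
have [m1 m10] := simM.1.
have [//|//|v [l [p [_ v0 lv pv]]]] :=
  @stable_weight_vector _ _ D M weightM setT m1 (@subspaceT _ _) _ _ I m10.
have [n dn] := weight_fin D l p uncK simM.
have [u [th [[lu pu] u0 Tu]]] :=
  exists_eigenvector (subspace_wp l p) dn (fun w => @wp_TT k l p w) (conj lv pv) v0.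
pose c := cc D k; have c0 : c != 0 := cc_neq0 D k.
pose de := c * (l (nxt k) + l (nxt (nxt k))).
have Du : [EV true k; EV false k] *> u = de *: u.
  by rewrite (EV_self D true) /sg mul1r actZl actDl !lu -scalerDl scalerA.
(* Applying the injective $E$ to [prF u] gives $(th+t\,de+(t^2+t)c^2)u$; [P] lists the coefficients
   of $t^2=P_0+P_1t$. *)
pose P (i : nat) := if i == 0%N then - th / c ^+ 2 else - (de + c ^+ 2) / c ^+ 2.
have [t Ht] := @solve_monicpoly K 2 P isT.
have {}Ht : th + t * de + (t ^+ 2 + t) * c ^+ 2 = 0.
  rewrite Ht big_ord_recl big_ord1 /P /= expr0 expr1 mulr1.
  by field.
apply: (@dimle_from_kernel true k t J u l p mu) => //; first by right.
apply: (inj true); rewrite /prF.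
have E1 : EV true k *> [EV true k; EV false k] *> J u = (de + 2%:R * c ^+ 2) *: u.
  rewrite (act_e _ (EV_even D true k) (bracket_ee (EV_even D true k) (EV_even D false k))).
  by rewrite EJ Du (EEF D true k) actZl EJ -scalerDl.
rewrite !actDr !actZr E1 EJ -[EV true k *> _]/(TT D M k u) Tu !scalerA -!scalerDl.
by rewrite [X in X *: _](_ : _ = 0) ?scale0r // -[RHS]Ht /c; ring.
Qed.

End Degree.

Theorem theorem3p5 (R : realType) (alpha : R[i]%C)
    (alpha_neq0 : alpha != 0) (alpha_neqN1 : alpha != -1)
    (M : supermodule (D21 alpha))
    (simpleM : simple_module M) (weightM : weight_module M) :
  bounded M /\ exists2 d : nat, has_degree M d & (d <= 8)%N.
Proof.
pose D := D21_d21 alpha_neq0 alpha_neqN1.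
pose wt_of (mu : {scalar 'rV[R[i]%C]_3}) : {ffun 'I_3 -> R[i]%C} := [ffun i => mu (delta_mx 0 i)].
have cartanE (x : 'rV[R[i]%C]_3) (m : M) :
    act (cartan (D21_cartan alpha) x) m = \sum_i x 0 i *: act (hh D i) m.
  rewrite /cartan (_ : act _ m = \sum_i act (x 0 i *: contra_gen (D21_cartan alpha) (Gh i)) m).
    by apply: eq_bigr => i _; rewrite actZl.
  by apply: (big_morph (fun u : D21 alpha => act u m)) => [u v|]; [exact: actDl|exact: act0l].
have wtE mu : weight_space mu = wt D (wt_of mu) :> set M.
  apply/seteqP; split=> [m lm i|m lm x].
    rewrite ffunE -lm cartanE (bigD1 i) //= big1 ?addr0 ?mxE ?eqxx ?scale1r // => j ji.
    by rewrite mxE eqxx (negbTE ji) scale0r.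
  rewrite cartanE [in RHS](row_sum_delta x) linear_sum scaler_suml.
  by apply: eq_bigr => i _; rewrite lm ffunE scalerA [in RHS]linearZ.
have weightD (m : M) : span [set v | exists l, wt D l v] m.
  have [n [mu [v [wv ->]]]] := weightM m.
  apply: (subspace_sum _ (subspace_span _)) => i _; apply: sub_span.
  by exists (wt_of (mu i)); rewrite -wtE.
have dim8 (mu : {scalar 'rV[R[i]%C]_3}) :
    exists2 d, has_dim (weight_space mu : set M) d & (d <= 8)%N.
  rewrite wtE; apply: dimle_has_dim; first exact: subspace_wt.
  exact: weight_dim_le8 (@complex_uncountable R) simpleM weightD _.
split; first by exists 9%N => mu; have [d] := dim8 mu; exists d.
pose P d := `[< exists mu, has_dim (weight_space mu : set M) d >] && (d <= 8)%N.
have exP : exists d, P d.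
  (* The maximum runs over a nonempty set, since a nonzero vector supplies a weight. *)
  have [m m0] := simpleM.1; have [[|n] [mu [v [_ E]]]] := weightM m.
    by case: m0; rewrite E big_ord0.
  have [d md d8] := dim8 (mu ord0).
  by exists d; rewrite /P d8 andbT; apply/asboolP; exists (mu ord0).
have [d /andP[/asboolP dmu d8] maxd] := ex_maxnP exP (fun d h => (andP h).2).
exists d => //; split=> // mu; have [d' md' d'8] := dim8 mu; exists d' => //.
by apply: maxd; rewrite /P d'8 andbT; apply/asboolP; exists mu.
Qed.
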